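(* Let $\alpha,\beta>0$ be fixed, let $c>0$, and let $i=[cn]$. Let $\tau_j(i)$ be the time it takes, starting with $j$ edges, for the dynamic Erdős–Rényi graph on $n$ vertices to reach $i$ edges. Then, as $n\to\infty$: (a) If $c<\frac{\beta}{2\alpha}$ then $$\tau_0(i)\xrightarrow{p}\frac{-\log\left(1-\frac{2\alpha}{\beta}c\right)}{\alpha}\quad\text{and}\quad \mathbb{E}(\tau_0(i))\to\frac{-\log\left(1-\frac{2\alpha}{\beta}c\right)}{\alpha}.$$ (b) If $c=\frac{\beta}{2\alpha}$ then for all $j\in\mathbb{N}$, $\mathbb{E}(\tau_j(i))=O(\log(n))$. (c) If $c>\frac{\beta}{2\alpha}$ then $$\Theta(n^{-1})\,e^{n\left(c\log\left(\frac{2\alpha}{\beta}c\right)-c+\frac{\beta}{2\alpha}\right)}\le\mathbb{E}(\tau_0(i))\le\Theta(n^{-1/2})\,e^{n\left(c\log\left(\frac{2\alpha}{\beta}c\right)-c+\frac{\beta}{2\alpha}\right)},$$ where $c\log\left(\frac{2\alpha}{\beta}c\right)-c+\frac{\beta}{2\alpha}>0$; that is, there are constants $0<K_1,K_2<\infty$ (not depending on $n$) such that for all sufficiently large $n$ the expectation $\mathbb{E}(\tau_0(i))$ lies between $K_1n^{-1}$ and $K_2n^{-1/2}$ times this exponential. Furthermore, $\frac{\tau_0(i)}{\mathbb{E}(\tau_0(i))}$ converges in distribution to an exponential random variable with expectation $1$.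
   Context: Dynamic Erdős–Rényi graph: for $\alpha,\beta>0$ and an integer $n\ge2$, there are $n$ fixed vertices and, independently for each of the $N=\binom n2$ vertex pairs, if no edge is present an edge is added after an exponentially distributed time with rate $\frac{\beta}{n-1}$, and if an edge is present it is removed after an exponentially distributed time with rate $\alpha$. Let $\eta(t)$ be the number of edges present at time $t$; $\{\eta(t)\}$ is a birth–death process on $\{0,1,\dots,N\}$ with birth rates $\lambda_k=(N-k)\frac{\beta}{n-1}$ and death rates $\mu_k=k\alpha$. For $i,j\in\{0,\dots,N\}$, $\tau_j(i)=\inf\{t>0:\eta(t)=i\}$ when $\eta(0)=j$. The notation $[x]$ denotes the closest integer to $x$. $\xrightarrow{p}$ denotes convergence in probability. $f(n)=\Theta(g(n))$ means $f(n)=O(g(n))$ and $g(n)=O(f(n))$. Statements are for $n$ large enough that the edge numbers involved do not exceed $N$. *)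

(* Defs.v *)
From mathcomp Require Export all_boot all_order all_algebra.
From mathcomp Require Export all_classical all_reals all_analysis.

Set Implicit Arguments.
Unset Strict Implicit.
Unset Printing Implicit Defensive.

Import Order.TTheory GRing.Theory Num.Theory.
Import numFieldNormedType.Exports.

Local Open Scope classical_set_scope.
Local Open Scope ring_scope.

(* A half-integer has two closest integers; both satisfy the predicate. *)
Definition closest_integer (R : realType) (x : R) (k : int) : Prop :=
  forall m : int, `|x - k%:~R| <= `|x - m%:~R|.

Definition mutually_independent (R : realType) (d : measure_display)
    (T : measurableType d) (P : probability T R) (I : eqType)
    (X : I -> {RV P >-> R}) : Prop :=
  forall (J : seq I) (B : I -> set R),
    uniq J -> (forall k, measurable (B k)) ->
    P (\bigcap_(k in [set` J]) (X k @^-1` B k)) =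
    (\prod_(k <- J) P (X k @^-1` B k))%E.

(* The random variables live on possibly different probability spaces and may
   take infinite values. *)
Definition cvg_in_probability (R : realType) (d : nat -> measure_display)
    (T : forall n, measurableType (d n)) (P : forall n, probability (T n) R)
    (X : forall n, T n -> \bar R) (a : R) : Prop :=
  forall eps : R, 0 < eps ->
    (fun n => P n [set w | (eps%:E < `|X n w - a%:E|)%E]) @ \oo --> 0%E.

(* [mu] is the limit law on the real line. *)
Definition cvg_in_distribution (R : realType) (d : nat -> measure_display)
    (T : forall n, measurableType (d n)) (P : forall n, probability (T n) R)
    (X : forall n, T n -> \bar R) (mu : set R -> \bar R) : Prop :=
  forall x : R, {for x, continuous (fun y : R => mu `]-oo, y]%classic)} ->
    (fun n => P n [set w | (X n w <= x%:E)%E]) @ \oo --> mu `]-oo, x]%classic.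

Definition vpair (n : nat) : finType := {e : {set 'I_n} | #|e| == 2%N}.

(* An edge set is a set of vertex pairs. During its [k]-th holding period
   (k = 0, 1, ...) a pair [e] has the state it had at time 0 if [k] is even and
   the opposite one if [k] is odd. *)
Definition present (n : nat) (A : {set vpair n}) (e : vpair n) (k : nat) : bool :=
  (e \in A) (+) odd k.

(* A realisation, on some probability space, of the dynamic Erdos-Renyi graph on
   [n] vertices with edge set [A] at time 0: the pairs switch their states
   independently, [holding e k] being the length of the [k]-th holding period of
   the pair [e].  (For n < 2 there is no vertex pair.) *)
Record dynER (R : realType) (alpha beta : R) (n : nat) (A : {set vpair n}) :=
  DynER {
    disp : measure_display;
    space : measurableType disp;
    law : probability space R;
    holding : vpair n -> nat -> {RV law >-> R};
    holding_ge0 : forall e k w, 0 <= holding e k w;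
    holding_exponential : forall e k (B : set R), measurable B ->
      distribution law (holding e k) B =
      exponential_prob (if present A e k then alpha else beta / (n%:R - 1)) B;
    holding_independent : mutually_independent
      (fun ek : vpair n * nat => holding ek.1 ek.2)
  }.

Section Process.
Variables (R : realType) (alpha beta : R) (n : nat) (A : {set vpair n}).
Variable G : dynER alpha beta A.

Definition switch_time (e : vpair n) (k : nat) (w : space G) : R :=
  \sum_(l < k) holding G e l w.

(* Right-continuous; if the switch times of [e] accumulate (which has
   probability 0), [e] is absent from the accumulation point on. *)
Definition edges (t : R) (w : space G) : {set vpair n} :=
  [set e | `[< exists k, switch_time e k w <= t < switch_time e k.+1 w /\
                        present A e k >]]%SET.

Definition eta (t : R) (w : space G) : nat := #|edges t w|.

(* +oo if [i] edges are never reached. *)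
Definition tau (i : nat) (w : space G) : \bar R :=
  ereal_inf [set t%:E | t in [set t : R | 0 < t /\ eta t w = i]].

Definition Etau (i : nat) : \bar R := (\int[law G]_w tau i w)%E.

End Process.

(* Main.v *)
(* Memorylessness turns the independent exponential switches of the pairs into a
   one-step estimate: given the past up to time s, the mean of g(eta(s + h)) is
   g(eta(s)) + h (L g)(eta(s)) + O(h^2), where L is the birth-death generator.
   Summing over a grid of mesh h and letting h tend to 0 along dyadic refinements
   transfers solutions of L f = -1, L g <= -2 f and L g <= -a g + b to E(tau),
   E(tau^2) and the law of eta(t); right-continuity of eta recovers tau from the
   grids.

   The climb 0 -> i has mean the sum of the step times m_k, with
   lambda_k m_k = 1 + mu_k m_(k-1).  Below equilibrium m_k is close to
   1 / (lambda_k - mu_k), the sum is close to an integral, and f^2 + (C/n) f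
   dominates the second moment, so Chebyshev gives convergence in probability.
   At criticality all but boundedly many steps are handled by the same
   comparison.  Above equilibrium detailed balance and entropy estimates for the
   binomial weights give the exponential order.  There f is almost constant below
   a half-way level that eta rarely exceeds, so f(eta(t)) on {tau > t} is about
   E(tau) P(tau > t), and the survival function nearly solves the equation
   S' = -S / E(tau). *)

From HB Require Import structures.
Require Import Defs.
From mathcomp Require Import measurable_realfun ring lra zify.

Set Implicit Arguments.
Unset Strict Implicit.
Unset Printing Implicit Defensive.

Import Order.TTheory GRing.Theory Num.Theory.
Import numFieldNormedType.Exports.

Local Open Scope classical_set_scope.
Local Open Scope ring_scope.

(** * Independence of a holding time from the past *)

(** Only independent holding times are given, so the Markov property has to be built. [history]
    replaces conditioning: seen from one pair, an event may use everything about the other pairs,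
    but on each window of that pair it must agree with an event of the finished holding periods. The
    pairs can then be treated one after another, and no conditional expectation is needed. For the
    law after one step only lower bounds are proved (no switch, or exactly one); equality of masses
    makes them two-sided. The error constants of the time discretisation may depend on [n], because
    the mesh tends to 0 at fixed [n]; asymptotics in [n] concern explicit birth-death sums only. On
    a grid the process can pass level [i] unseen. This is why the equations are also solved above
    [i], up to all pairs being present. Above equilibrium the exponents [-1] and [-1/2] differ
    because the lower bound keeps a single step and compares it with one near equilibrium, whereas
    the upper bound uses a Stirling estimate of the weights. *)

Section Independence.
Context (R : realType) (d : measure_display) (T : measurableType d)
  (P : probability T R) (I : eqType) (X : I -> {RV P >-> R}).
Hypothesis indepX : mutually_independent X.

(** The pi-system of finite-dimensional events over the coordinates in [Q]; identities of finite
    measures on the generated sigma-algebra need checking on it only. *)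
Definition cylinders (Q : set I) : set (set T) :=
  [set D | exists (J : seq I) (B : I -> set R), [/\ uniq J, [set` J] `<=` Q,
     forall y, measurable (B y) & D = \bigcap_(y in [set` J]) X y @^-1` B y]].

Lemma cylinders_measurable Q : cylinders Q `<=` measurable.
Proof.
move=> _ [J [B [_ _ mB ->]]].
apply: fin_bigcap_measurable => [|y _]; first exact: finite_seq.
by rewrite -[_ @^-1` _]setTI; exact: measurable_funP.
Qed.

Lemma cylinders_setI Q : setI_closed (cylinders Q).
Proof.
move=> _ _ [J1 [B1 [_ Q1 mB1 ->]]] [J2 [B2 [_ Q2 mB2 ->]]].
exists (undup (J1 ++ J2)).
exists (fun y => (if y \in J1 then B1 y else setT) `&`
                 (if y \in J2 then B2 y else setT)).
split; first exact: undup_uniq.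
- by move=> y /=; rewrite mem_undup mem_cat => /orP[/Q1|/Q2].
- by move=> y; apply: measurableI; case: ifP.
- apply/seteqP; split=> w /=.
    by move=> [h1 h2] y /=; rewrite mem_undup => _; split;
      case: ifP => // yJ; [exact: h1|exact: h2].
  move=> h; split => y /= yJ.
    by have := h y; rewrite /= mem_undup mem_cat yJ => /(_ isT)[].
  by have := h y; rewrite /= mem_undup mem_cat yJ orbT => /(_ isT)[].
Qed.

Lemma cylindersT Q : cylinders Q setT.
Proof.
exists [::], (fun=> setT); split => //.
by rewrite set_nil bigcap_set0.
Qed.

Definition sigma_of (Q : set I) := g_sigma_algebraType (cylinders Q).

Lemma sigma_of_sub Q (D : set T) :
  measurable (D : set (sigma_of Q)) -> measurable D.
Proof. by apply: smallest_sub; [exact: sigma_algebra_measurable|exact: cylinders_measurable]. Qed.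

Lemma measurable_sigma_of Q y : Q y ->
  measurable_fun [set: sigma_of Q] (X y : sigma_of Q -> R).
Proof.
move=> Qy _ B mB; rewrite setTI; apply: sub_sigma_algebra.
exists [:: y], (fun=> B); split => //.
  by move=> z /=; rewrite inE => /eqP ->.
apply/seteqP; split=> [w Bw z /=|w /(_ y)].
  by rewrite inE => /eqP ->.
by apply; rewrite /= inE.
Qed.

Lemma sigma_of_mono Q Q' (D : set T) : Q `<=` Q' ->
  measurable (D : set (sigma_of Q)) -> measurable (D : set (sigma_of Q')).
Proof.
move=> QQ'; apply: sub_sigma_algebra2 => _ [J [B [uJ JQ mB ->]]].
by exists J, B; split => // y /JQ /QQ'.
Qed.

(** Both sides are finite measures in [D], the right one a multiple of [P]. They agree on the
    pi-system of cylinders by mutual independence, hence on the generated sigma-algebra. *)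
Lemma indep_sigma_of Q x (D : set T) (C : set R) : ~ Q x ->
  measurable (D : set (sigma_of Q)) -> measurable C ->
  P (D `&` X x @^-1` C) = (P D * P (X x @^-1` C))%E.
Proof.
move=> Qx mD mC.
have mXC : measurable (X x @^-1` C).
  by rewrite -[_ @^-1` _]setTI; exact: measurable_funP.
have pC : (0 <= fine (P (X x @^-1` C))) by exact: fine_ge0.
have Hg := @g_sigma_algebra_measure_unique d R T (cylinders Q)
  (@cylinders_measurable Q) (fun=> setT) (fun=> cylindersT Q) _
  (mrestr P mXC) (mscale (NngNum pC) P) (@cylinders_setI Q).
have -> : P (D `&` X x @^-1` C) = mrestr P mXC D by [].
rewrite Hg //.
- transitivity ((fine (P (X x @^-1` C)))%:E * P D)%E => //.
  by rewrite fineK ?fin_num_measure// muleC.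
- by apply/seteqP; split => // w _; exists 0%N.
- move=> A [J [B [uJ JQ mB ->]]].
  transitivity (P (X x @^-1` C) *
    P (\bigcap_(y in [set` J]) X y @^-1` B y))%E; last first.
    transitivity ((fine (P (X x @^-1` C)))%:E *
      P (\bigcap_(y in [set` J]) X y @^-1` B y))%E => //.
    by rewrite fineK ?fin_num_measure.
  rewrite /mrestr.
  have xJ : x \notin J by apply/negP => /JQ.
  have := @indepX (x :: J) (fun y => if y == x then C else B y).
  rewrite /= xJ uJ => /(_ isT) => h.
  have {h} := h (fun k => ltac:(by case: ifP)).
  rewrite big_cons eqxx => h.
  transitivity (P (X x @^-1` C) * \prod_(k <- J) P (X k @^-1` B k))%E; last first.
    by rewrite -indepX.
  rewrite [X in _ = (_ * X)%E](_ : _ = (\prod_(k <- J)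
     P (X k @^-1` (if k == x then C else B k)))%E); last first.
    rewrite big_seq [RHS]big_seq; apply: eq_bigr => k kJ.
    by case: eqVneq => // kx; rewrite -kx kJ in xJ.
  rewrite -h; congr (P _); apply/seteqP; split => w /=.
    move=> [hJ hC] k /=; rewrite inE => /orP[/eqP ->|kJ]; first by rewrite eqxx.
    by case: eqVneq => [->//|_]; exact: hJ.
  move=> hJ; split; last by have := hJ x; rewrite /= inE eqxx => /(_ isT).
  move=> k /= kJ; have := hJ k; rewrite /= inE kJ orbT => /(_ isT).
  by case: eqVneq => // kx; rewrite -kx kJ in xJ.
- by move=> _; rewrite /= /mrestr setTI ltey_eq fin_num_measure.
Qed.

(** Fubini: the identity into [sigma_of Q] and [X x] have a product law, so [X x] may be integrated
    first with the past frozen. This does the work of a conditional expectation. *)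
Lemma freezing Q x (E : set (sigma_of Q * R)) : ~ Q x -> measurable E ->
  P [set w | E (w, X x w)] = (\int[P]_w distribution P (X x) (xsection E w))%E.
Proof.
move=> Qx mE.
have mid : measurable_fun setT (fun w : T => (w : sigma_of Q)).
  by move=> _ B mB; rewrite setTI; exact: sigma_of_sub mB.
have mpair : measurable_fun setT (fun w : T => ((w, X x w) : sigma_of Q * R)).
  by apply/measurable_fun_pairP; split => //; exact: measurable_funP.
pose HF := isMeasurableFun.Build _ _ _ _ (fun w : T => (w : sigma_of Q)) mid.
pose idm : {mfun T >-> sigma_of Q} := HB.pack (fun w : T => (w : sigma_of Q)) HF.
pose HF2 := isMeasurableFun.Build _ _ _ _ (fun w : T => ((w, X x w) : sigma_of Q * R)) mpair.
pose pairm : {mfun T >-> (sigma_of Q * R)%type} :=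
   HB.pack (fun w : T => ((w, X x w) : sigma_of Q * R)) HF2.
have hP := @product_measure_unique _ _ _ _ R (distribution P idm)
  (distribution P (X x)) (distribution P pairm).
transitivity (distribution P pairm E) => //.
rewrite -hP //; last by move=> A B mA mB; exact: (indep_sigma_of Qx mA mB).
rewrite /product_measure1 ge0_integral_pushforward//=.
exact: measurable_fun_xsection.
Qed.

(** A ratio of conditional probabilities that does not depend on the past passes to the
    unconditional ones. *)
Lemma freezing_scale Q x (E1 E2 : set (sigma_of Q * R)) (c : R) : ~ Q x ->
  measurable E1 -> measurable E2 -> 0 <= c ->
  (forall w, distribution P (X x) (xsection E1 w) =
             (c%:E * distribution P (X x) (xsection E2 w))%E) ->
  P [set w | E1 (w, X x w)] = (c%:E * P [set w | E2 (w, X x w)])%E.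
Proof.
move=> Qx mE1 mE2 c0 h; rewrite !(freezing Qx)//.
rewrite -ge0_integralZl_EFin//; first by apply: eq_integral => w _; exact: h.
move=> _ B mB; rewrite setTI; apply: (@sigma_of_sub Q).
have := measurable_fun_xsection (distribution P (X x)) mE2.
by move=> /(_ measurableT B mB); rewrite setTI.
Qed.

End Independence.

(** * Half-line probabilities of the exponential law *)

Section Exponential.
Context (R : realType) (r : R) (r_gt0 : 0 < r).

Lemma exponential_prob_le (y : R) : 0 <= y ->
  exponential_prob r `]-oo, y]%classic = (1 - expR (- r * y))%:E.
Proof.
pose m' : probability (g_sigma_algebraType (R.-ocitv.-measurable)) R := exponential_prob r.
pose m := m' r_gt0; move=> y0.
have mitv (i : interval R) :
    measurable ([set` i] : set (g_sigma_algebraType (R.-ocitv.-measurable))).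
  exact: (measurable_itv i).
have mneg : m `]-oo, 0[%classic = 0%E.
  rewrite /= /exponential_prob integral0_eq// => x /=; rewrite in_itv/= => x0.
  by rewrite /exponential_pdf patchE ifF// memNset//= in_itv/= andbT; apply/negP; rewrite -ltNge.
have mc : m `[0, y]%classic = (1 - (expR (- r * y))%:E)%E.
  move: y0; rewrite le_eqVlt => /orP[/eqP <-|y0].
    by rewrite mulr0 expR0 subee// set_itv1 /= /exponential_prob integral_set1.
  by rewrite /= exponential_prob_itv0c.
have -> : `]-oo, y]%classic = `]-oo, 0[%classic `|` `[0, y]%classic.
  apply/seteqP; split => x /=; rewrite !in_itv/=; first by case: (ltP x 0) => h; [left|right].
  by case=> [h|/andP[]//]; apply: le_trans (ltW h) y0.
rewrite -[LHS]/(m _) measureU//; last first.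
  by apply/seteqP; split => x //=; rewrite !in_itv/= => -[]; lra.
by rewrite [X in (X + _)%E]mneg add0e; exact: mc.
Qed.

Lemma exponential_prob_gt (y : R) : 0 <= y ->
  exponential_prob r `]y, +oo[%classic = (expR (- r * y))%:E.
Proof.
pose m' : probability (g_sigma_algebraType (R.-ocitv.-measurable)) R := exponential_prob r.
pose m := m' r_gt0; move=> y0.
have -> : `]y, +oo[%classic = ~` `]-oo, y]%classic.
  by apply/seteqP; split => x /=; rewrite !in_itv/= andbT ltNge => /negP.
rewrite -[LHS]/(m _) probability_setC; last exact: (measurable_itv `]-oo, y]).
by rewrite [X in (_ - X)%E](exponential_prob_le y0) -EFinB opprB addrC subrK.
Qed.

End Exponential.

(** * Switches of a vertex pair *)

Lemma measurable_ltr_set (R : realType) (d : measure_display)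
    (T : measurableType d) (f g : T -> R) :
  measurable_fun setT f -> measurable_fun setT g -> measurable [set w | f w < g w].
Proof.
move=> mf mg; rewrite -[X in measurable X]setTI.
exact: (measurable_realfun.measurable_fun_ltr mf mg measurableT (Y := [set true])).
Qed.

Lemma measurable_ler_set (R : realType) (d : measure_display)
    (T : measurableType d) (f g : T -> R) :
  measurable_fun setT f -> measurable_fun setT g -> measurable [set w | f w <= g w].
Proof.
move=> mf mg; rewrite -[X in measurable X]setTI.
exact: (measurable_realfun.measurable_fun_ler mf mg measurableT (Y := [set true])).
Qed.

Lemma measure_bigcup_scale (R : realType) (d : measure_display)
    (T : measurableType d) (P : {measure set T -> \bar R}) (F F' : nat -> set T)
    (c : R) :
  (forall j, measurable (F j)) -> (forall j, measurable (F' j)) ->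
  trivIset setT F -> trivIset setT F' -> (forall j, P (F j) = c%:E * P (F' j))%E ->
  P (\bigcup_j F j) = (c%:E * P (\bigcup_j F' j))%E.
Proof.
move=> mF mF' tF tF' h.
rewrite !measure_bigcup// -nneseriesZl; last by move=> *; exact: measure_ge0.
by apply: eq_eseriesr => j _; exact: h.
Qed.

Section Switching.
Context (R : realType) (alpha beta : R) (n : nat) (A : {set vpair n})
  (G : dynER alpha beta A).
Hypotheses (alpha_gt0 : 0 < alpha) (beta_gt0 : 0 < beta).

Let P := law G.
Let X (x : vpair n * nat) : {RV law G >-> R} := holding G x.1 x.2.
Let indepX : mutually_independent X := holding_independent G.

Definition rate (b : bool) : R := if b then alpha else beta / (n%:R - 1).

(** The pair [e] witnesses that there are at least two vertices, so that [n%:R - 1] is positive. *)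
Lemma rate_gt0 (e : vpair n) b : 0 < rate b.
Proof.
rewrite /rate; case: b => //; apply: divr_gt0 => //.
rewrite subr_gt0 ltr1n; case: e => E /= /eqP E2.
by rewrite -[ltnRHS](card_ord n) (leq_trans _ (max_card (mem E))) ?E2.
Qed.

Lemma holding_tail e k y : 0 <= y ->
  distribution P (holding G e k) `]y, +oo[%classic =
    (expR (- rate (present A e k) * y))%:E.
Proof.
by move=> y0; rewrite holding_exponential// exponential_prob_gt//; exact: rate_gt0.
Qed.

Lemma switch_time0 e w : switch_time (G := G) e 0 w = 0.
Proof. by rewrite /switch_time big_ord0. Qed.

Lemma switch_timeS e k w :
  switch_time (G := G) e k.+1 w = switch_time e k w + holding G e k w.
Proof. by rewrite /switch_time big_ord_recr. Qed.

Lemma switch_time_mono e w : {homo switch_time (G := G) e ^~ w : k l / (k <= l)%N >-> k <= l}.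
Proof.
apply: homo_leq => //; first by move=> ? ? ?; exact: le_trans.
by move=> k; rewrite switch_timeS lerDl holding_ge0.
Qed.

(* What is known during the [j]-th holding period of [e]: all other pairs, and
   the earlier holding times of [e]. *)
Definition past (e : vpair n) (j : nat) : set (vpair n * nat) :=
  [set x | x.1 = e -> (x.2 < j)%N].

Lemma measurable_switch_time Q e k : (forall l, (l < k)%N -> Q (e, l)) ->
  measurable_fun setT (switch_time e k : sigma_of X Q -> R).
Proof.
elim: k => [|k IH] hQ.
  by rewrite (_ : switch_time e 0 = cst 0) //; apply/funext => w; rewrite switch_time0.
rewrite (_ : switch_time e k.+1 = (switch_time e k \+ holding G e k)); last first.
  by apply/funext => w; rewrite switch_timeS.
apply: measurable_realfun.measurable_funD; first by apply: IH => l lk; apply: hQ; exact: ltnW.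
exact: (@measurable_sigma_of _ _ _ _ _ X Q (e, k) (hQ k _)).
Qed.

Definition window (e : vpair n) (s : R) (j : nat) : set (space G) :=
  [set w | switch_time e j w <= s < switch_time e j.+1 w].

Lemma measurable_window Q e s j : (forall l, (l <= j)%N -> Q (e, l)) ->
  measurable (window e s j : set (sigma_of X Q)).
Proof.
move=> hQ; rewrite (_ : window e s j =
  [set w | switch_time e j w <= s] `&` [set w | s < switch_time e j.+1 w]).
  apply: measurableI.
    by apply: measurable_ler_set => //; apply: measurable_switch_time => l /ltnW /hQ.
  by apply: measurable_ltr_set => //; apply: measurable_switch_time => l /hQ.
by apply/seteqP; split => w /=; [move=> /andP[]|move=> [h1 h2]; apply/andP].
Qed.

Lemma window_unique e s j k w : window e s j w -> window e s k w -> j = k.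
Proof.
have aux i l : window e s i w -> window e s l w -> (i < l)%N -> False.
  move=> /andP[_ h1] /andP[h2 _] il.
  have := switch_time_mono e w il; lra.
by move=> hj hk; case: (ltngtP j k) => // h; [have := aux _ _ hj hk h|have := aux _ _ hk hj h].
Qed.

Lemma trivIset_window e s : trivIset setT (window e s).
Proof. by apply/trivIsetP => i j _ _ /eqP ij; apply/eqP/negPn/negP => /set0P[w [h1 h2]];
  apply: ij; exact: window_unique h1 h2. Qed.

Lemma edges_window e s j w : window e s j w ->
  (e \in edges s w) = present A e j.
Proof.
move=> hj; rewrite inE; apply/asboolP/idP => [[k [hk pk]]|pj]; last by exists j.
by rewrite (window_unique hj hk).
Qed.

Lemma edges_nowindow e s w : ~ (\bigcup_j window e s j) w -> (e \in edges s w) = false.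
Proof.
move=> h; rewrite inE; apply/asboolP => -[k [hk pk]].
by apply: h; exists k.
Qed.

Lemma measurable_edge Q e s : (forall l, Q (e, l)) ->
  measurable ([set w | e \in edges s w] : set (sigma_of X Q)).
Proof.
move=> hQ; rewrite (_ : [set w | e \in edges s w] =
   \bigcup_(j in [set j | present A e j]) window e s j).
  by apply: bigcup_measurable => j _; apply: measurable_window.
apply/seteqP; split => w /=.
  by rewrite inE => /asboolP[k [hk pk]]; exists k.
by move=> [k pk hk]; rewrite (edges_window hk).
Qed.

(* Accumulation of switches has probability 0: each of the first K holding
   periods would have to be at most s. *)
Lemma window_total e s : 0 <= s -> P (~` \bigcup_j window e s j) = 0.
Proof.
move=> s0.
pose q k : R := 1 - expR (- rate (present A e k) * s).
pose rho : R := Num.max (1 - expR (- rate true * s)) (1 - expR (- rate false * s)).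
have qE k : P (holding G e k @^-1` `]-oo, s]%classic) = (q k)%:E.
  have -> : holding G e k @^-1` `]-oo, s]%classic =
      ~` (holding G e k @^-1` `]s, +oo[%classic).
    by apply/seteqP; split => w /=; rewrite !in_itv/= andbT leNgt => /negP.
  rewrite probability_setC; last by rewrite -[_ @^-1` _]setTI; exact: measurable_funP.
  have h := holding_tail e k s0; rewrite /distribution/= /pushforward/= in h.
  by rewrite h.
have q0 k : 0 <= q k.
  by rewrite subr_ge0 expR_le1 mulNr oppr_le0 mulr_ge0// ltW// (rate_gt0 e).
have qrho k : q k <= rho by rewrite /rho le_max /q; case: present; rewrite lexx ?orbT.
have rho1 : `|rho| < 1.
  rewrite ger0_norm; last exact: le_trans (q0 0%N) (qrho 0%N).
  by rewrite /rho gt_max; apply/andP; split; have := expR_gt0 (- rate true * s);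
    have := expR_gt0 (- rate false * s); lra.
have mW : measurable (~` \bigcup_j window e s j).
  apply: measurableC; apply: bigcup_measurable => j _.
  by apply: (@sigma_of_sub _ _ _ _ _ X setT); exact: measurable_window.
have key K : (P (~` \bigcup_j window e s j) <= (rho ^+ K)%:E)%E.
  pose J := [seq (e, k) | k <- iota 0 K].
  have sub : (~` \bigcup_j window e s j) `<=`
      \bigcap_(x in [set` J]) X x @^-1` `]-oo, s]%classic.
    move=> w hw x /mapP[k _ ->] /=; rewrite in_itv/=.
    have Sle l : switch_time e l w <= s.
      elim: l => [|l IH]; first by rewrite switch_time0.
      rewrite leNgt; apply/negP => h; apply: hw; exists l => //=.
      by rewrite /window/= IH h.
    have := Sle k.+1; rewrite switch_timeS.
    by have := switch_time_mono e w (leq0n k); rewrite switch_time0; lra.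
  have mcap : measurable (\bigcap_(x in [set` J]) X x @^-1` `]-oo, s]%classic).
    apply: fin_bigcap_measurable => [|y _]; first exact: finite_seq.
    by rewrite -[_ @^-1` _]setTI; exact: measurable_funP.
  have uJ : uniq J by rewrite map_inj_uniq ?iota_uniq// => a b [].
  have hP := @indepX J (fun=> `]-oo, s]%classic) uJ (fun _ => measurable_itv _).
  apply: (@le_trans _ _ (\prod_(k <- J) P (X k @^-1` `]-oo, s]%classic))%E).
    by move: hP => /= <-; apply: le_measure => //; rewrite inE.
  rewrite /J big_map; under eq_bigr do rewrite /= qE.
  rewrite prodEFin lee_fin.
  have -> : rho ^+ K = \prod_(k <- iota 0 K) rho.
    by rewrite big_const_seq count_predT size_iota; elim: (K) => //= m <-; rewrite exprS.
  by apply: ler_prod => k _; rewrite q0 qrho.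
have fP : P (~` \bigcup_j window e s j) \is a fin_num by exact: fin_num_measure.
apply/eqP; rewrite eq_le measure_ge0 andbT -(fineK fP) lee_fin.
apply: (cvgr_to_ge (cvg_expr rho1)); apply: nearW => K.
by rewrite -lee_fin fineK.
Qed.

End Switching.

Lemma measurable_comp_fst (R : realType) d d' (T1 : measurableType d)
    (T2 : measurableType d') (f : T1 -> R) :
  measurable_fun setT f -> measurable_fun setT (fun p : T1 * T2 => f p.1).
Proof. by move=> mf; exact: measurableT_comp mf measurable_fst. Qed.

Lemma trivIset_subfamily (T : Type) (F F' : nat -> set T) :
  (forall j, F' j `<=` F j) -> trivIset setT F -> trivIset setT F'.
Proof.
move=> FF' /trivIsetP tF; apply/trivIsetP => i j _ _ ij.
by rewrite -subset0 -(tF i j I I ij); exact: setISS.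
Qed.

(** * Switching probabilities of one pair given the past *)

Section History.
Context (R : realType) (alpha beta : R) (n : nat) (A : {set vpair n})
  (G : dynER alpha beta A).
Hypotheses (alpha_gt0 : 0 < alpha) (beta_gt0 : 0 < beta).

Let P := law G.
Let X (x : vpair n * nat) : {RV law G >-> R} := holding G x.1 x.2.
Let indepX : mutually_independent X := holding_independent G.

Definition stay (e : vpair n) (s h : R) (j : nat) : set (space G) :=
  [set w | switch_time e j w <= s /\ s + h < switch_time e j.+1 w].

Lemma stay0 e s j : stay e s 0 j = window e s j.
Proof.
by apply/seteqP; split => w; rewrite /stay /window /= addr0 => /andP.
Qed.

Lemma stay_window e s h j : 0 <= h -> stay e s h j `<=` window e s j.
Proof. by move=> h0 w [h1 h2]; apply/andP; split => //; lra. Qed.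

Lemma measurable_stay Q e s h j : (forall l, (l <= j)%N -> Q (e, l)) ->
  measurable (stay e s h j : set (sigma_of X Q)).
Proof.
move=> hQ; rewrite (_ : stay e s h j =
  [set w | switch_time e j w <= s] `&` [set w | s + h < switch_time e j.+1 w]) //.
apply: measurableI.
  by apply: measurable_ler_set => //; apply: measurable_switch_time => l /ltnW /hQ.
by apply: measurable_ltr_set => //; apply: measurable_switch_time => l /hQ.
Qed.

(** Memorylessness: with the past frozen at a switch time not after [s], the probabilities of
    lasting beyond [s + h] and beyond [s] are exponentials whose quotient does not involve the
    switch time. *)
Lemma prob_stay e s h j (D : set (space G)) : 0 <= h ->
  measurable (D : set (sigma_of X (past e j))) ->
  P (D `&` stay e s h j) =
  ((expR (- rate alpha beta n (present A e j) * h))%:E * P (D `&` window e s j))%E.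
Proof.
move=> h0 mD; rewrite -stay0.
pose E (h : R) := [set p : sigma_of X (past e j) * R |
  [/\ D p.1, switch_time e j p.1 <= s & s + h < switch_time e j p.1 + p.2]].
have EE h' : D `&` stay e s h' j = [set w | E h' (w, X (e, j) w)].
  by apply/seteqP; split => w; rewrite /stay /E /= switch_timeS; [move=> [? []]|move=> []].
have mS : measurable_fun setT (switch_time e j : sigma_of X (past e j) -> R).
  by apply: measurable_switch_time => l lj _.
have mS1 : measurable_fun setT
    (fun p : sigma_of X (past e j) * R => switch_time e j p.1).
  exact: (measurable_comp_fst mS).
have mE h' : measurable (E h').
  rewrite (_ : E h' = (D `*` setT) `&`
     ([set p : sigma_of X (past e j) * R | switch_time e j p.1 <= s] `&`
      [set p | s + h' < switch_time e j p.1 + p.2])); last first.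
    by apply/seteqP; split => p; rewrite /E /=; [move=> []|move=> [[? _] []]].
  apply: measurableI; first exact: measurableX.
  apply: measurableI; first exact: measurable_ler_set.
  apply: measurable_ltr_set => //; apply: measurable_realfun.measurable_funD => //.
have Esec h' w : 0 <= h' -> distribution P (X (e, j)) (xsection (E h') w) =
   (if `[< D w /\ switch_time e j w <= s >] then
     expR (- rate alpha beta n (present A e j) * (s + h' - switch_time e j w)) else 0)%:E.
  move=> h'0; case: asboolP => [[Dw Sw]|hw].
    rewrite -(@holding_tail _ _ _ _ _ G alpha_gt0 beta_gt0); last by lra.
    congr (distribution _ _ _); apply/seteqP; split => z;
      rewrite /xsection /= inE /E /= in_itv/= andbT; last by move=> ?; split => //; lra.
    by move=> [_ _]; lra.
  rewrite (_ : xsection _ _ = set0) ?measure0//.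
  by apply/seteqP; split => // z; rewrite /xsection /= inE /E /= => -[h1 h2 _]; case: hw.
rewrite !EE; apply: (@freezing_scale _ _ _ P _ X indepX (past e j) (e, j)) => //.
- by rewrite /past /= ltnn => /(_ erefl).
- move=> w; rewrite !Esec//; case: ifP => _; last by rewrite mule0.
  by rewrite -EFinM -expRD; congr (expR _)%:E; ring.
Qed.

(* The pair switches once in (s, s + h], and its following holding period is
   longer than h. *)
Definition jump (e : vpair n) (s h : R) (j : nat) : set (space G) :=
  (window e s j `\` stay e s h j) `&` [set w | h < holding G e j.+1 w].

Lemma measurable_jump Q e s h j : (forall l, Q (e, l)) ->
  measurable (jump e s h j : set (sigma_of X Q)).
Proof.
move=> hQ; apply: measurableI.
  by apply: measurableD; [apply: measurable_window => l _|apply: measurable_stay => l _].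
apply: measurable_ltr_set => //.
exact: (@measurable_sigma_of _ _ _ _ _ X Q (e, j.+1)).
Qed.

(** The next holding time is independent of [past e j.+1], which already decides the window and the
    stay. Requiring it to exceed [h] excludes a second switch up to [s + h]. *)
Lemma prob_jump e s h j (D : set (space G)) : 0 <= h ->
  measurable (D : set (sigma_of X (past e j))) ->
  P (D `&` jump e s h j) =
  (((1 - expR (- rate alpha beta n (present A e j) * h)) *
    expR (- rate alpha beta n (present A e j.+1) * h))%:E * P (D `&` window e s j))%E.
Proof.
move=> h0 mD.
have mW : measurable (window e s j : set (sigma_of X (past e j.+1))).
  by apply: measurable_window => l lj _.
have mS : measurable (stay e s h j : set (sigma_of X (past e j.+1))).
  by apply: measurable_stay => l lj _.
have mD1 : measurable (D : set (sigma_of X (past e j.+1))).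
  by apply: sigma_of_mono mD => x hx /hx /ltnW.
have mW' := sigma_of_sub mW; have mS' := sigma_of_sub mS; have mD' := sigma_of_sub mD.
rewrite /jump setIA.
have -> : [set w | h < holding G e j.+1 w] = X (e, j.+1) @^-1` `]h, +oo[%classic.
  by apply/seteqP; split => w /=; rewrite in_itv/= andbT.
rewrite (@indep_sigma_of _ _ _ P _ X indepX (past e j.+1)) //; last first.
- by apply: measurableI => //; apply: measurableD.
- by rewrite /past /= ltnn => /(_ erefl).
have := @holding_tail _ _ _ _ _ G alpha_gt0 beta_gt0 e j.+1 h h0 => /= hT.
rewrite [P (X _ @^-1` _)]hT.
have -> : D `&` (window e s j `\` stay e s h j) =
   (D `&` window e s j) `\` (D `&` stay e s h j).
  apply/seteqP; split => w /=; first by move=> [? [? h1]]; split => // -[].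
  by move=> [[? ?] h1]; split => //; split => // h2; apply: h1.
rewrite measureD//; last 3 first.
- exact: measurableI.
- exact: measurableI.
- by rewrite ltey_eq fin_num_measure//; exact: measurableI.
rewrite (_ : (D `&` window e s j) `&` (D `&` stay e s h j) = D `&` stay e s h j);
  last by rewrite setIidr//; apply: setIS; exact: stay_window.
have [r rE] : exists r, P (D `&` window e s j) = r%:E.
  exists (fine (P (D `&` window e s j))); rewrite fineK// fin_num_measure//.
  exact: measurableI.
transitivity ((P (D `&` window e s j) - P (D `&` stay e s h j)) *
  (expR (- rate alpha beta n (present A e j.+1) * h))%:E)%E => //.
rewrite (prob_stay s h0 mD) rE -!EFinM.
by congr (_%:E); ring.
Qed.

(* [H] is determined by the process up to time [s], seen from the pair [e]: on
   each window it agrees with an event of the past of [e]. *)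
Definition history (e : vpair n) (s : R) (H : set (space G)) :=
  measurable H /\ forall j, exists2 D : set (space G),
    measurable (D : set (sigma_of X (past e j))) &
    H `&` window e s j = D `&` window e s j.

Lemma historyT e s : history e s setT.
Proof. by split=> // j; exists setT. Qed.

Lemma historyC e s H : history e s H -> history e s (~` H).
Proof.
move=> [mH h]; split; first exact: measurableC.
move=> j; have [D mD DE] := h j; exists (~` D); first exact: measurableC.
apply/seteqP; split => w /= [h1 h2]; split => // h3; apply: h1.
  by have [] : (H `&` window e s j) w by rewrite DE.
by have [] : (D `&` window e s j) w by rewrite -DE.
Qed.

Lemma historyI e s H H' : history e s H -> history e s H' -> history e s (H `&` H').
Proof.
move=> [mH h] [mH' h']; split; first exact: measurableI.
move=> j; have [D mD DE] := h j; have [D' mD' DE'] := h' j.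
exists (D `&` D'); first exact: measurableI.
by rewrite setIIl DE DE' -setIIl.
Qed.

Lemma history_other e e' s (D : set (space G)) : e != e' ->
  measurable (D : set (sigma_of X [set x | x.1 = e'])) -> history e s D.
Proof.
move=> ee' mD; split; first exact: sigma_of_sub mD.
move=> j; exists D => //; apply: sigma_of_mono mD => x /= xe' xe.
by move: ee'; rewrite -xe xe' eqxx.
Qed.

Lemma history_edge e e' s t : t <= s -> history e s [set w | e' \in edges t w].
Proof.
move=> ts; have [<-|ee'] := eqVneq e e'; last first.
  by apply: (history_other _ ee'); apply: measurable_edge => l /=.
split; first by apply: (@sigma_of_sub _ _ _ _ _ X setT); apply: measurable_edge.
move=> j.
(* On [window e s j] the upper end of period [j] lies beyond [s >= t], so presence at [t] reads only
   the first [j] holding times: either [t] is in an earlier period of presence, or period [j] has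
   begun by [t]. *)
exists ((\bigcup_(k in [set k | (k < j)%N /\ present A e k]) window e t k) `|`
  (if present A e j then [set w | switch_time e j w <= t] else set0)).
  apply: measurableU.
    apply: bigcup_measurable => k [kj _].
    by apply: measurable_window => l lk; rewrite /past /= => _; exact: leq_ltn_trans kj.
  case: ifP => // _.
  by apply: measurable_ler_set => //; apply: measurable_switch_time => l lj _.
apply/seteqP; split => w /= [h1 h2]; split => //.
  have [k _ hk] : (\bigcup_k window e t k) w.
    by apply: contrapT => /edges_nowindow he; rewrite he in h1.
  move: h1; rewrite (edges_window hk) => pk.
  case: (ltngtP k j) => kj.
  - by left; exists k.
  - move: hk h2 => /andP[hk _] /andP[_ h2].
    by have := switch_time_mono e w kj; lra.
  - by right; rewrite -kj pk; case/andP: hk.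
case: h1 => [[k [kj pk] hk]|].
  by rewrite (edges_window hk).
case: ifP => // pj h1; rewrite (@edges_window _ _ _ _ _ _ _ _ j)//.
by rewrite /window /= h1; case/andP: h2 => _; apply: le_lt_trans.
Qed.

Definition no_switch e s h := \bigcup_j stay e s h j.
Definition one_switch e s h := \bigcup_j jump e s h j.

Lemma history_window (e : vpair n) s (H : set (space G)) : 0 <= s -> measurable H ->
  P H = P (\bigcup_j (H `&` window e s j)).
Proof.
move=> s0 mH.
have mW : measurable (\bigcup_j window e s j : set (space G)).
  apply: bigcup_measurable => j _.
  by apply: (@sigma_of_sub _ _ _ _ _ X setT); exact: measurable_window.
rewrite -setI_bigcupr -[in LHS](setIT H) -(setUv (\bigcup_j window e s j)) setIUr.
rewrite measureU//; last 3 first.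
- exact: measurableI.
- by apply: measurableI => //; exact: measurableC.
- by rewrite setIACA setICr setI0.
rewrite [X in (_ + X)%E](_ : _ = 0%E) ?adde0//.
apply/eqP; rewrite eq_le measure_ge0 andbT -(@window_total _ _ _ _ _ G alpha_gt0 beta_gt0 e s s0).
by apply: le_measure; rewrite ?inE//; [apply: measurableI => //|]; exact: measurableC.
Qed.

(** Common to [stay] and [jump]. The factor depends on the parity of the period, so [H] has to fix
    the state of [e] at time [s]; periods of the other parity contribute empty sets on both
    sides. *)
Lemma prob_switch_scale (F : vpair n -> R -> R -> nat -> set (space G)) e s h b (c : R) H :
  0 <= s ->
  (forall j, F e s h j `<=` window e s j) ->
  (forall j, measurable (F e s h j)) ->
  (forall j D, present A e j = b -> measurable (D : set (sigma_of X (past e j))) ->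
    P (D `&` F e s h j) = (c%:E * P (D `&` window e s j))%E) ->
  history e s H -> H `<=` [set w | (e \in edges s w) = b] ->
  P (H `&` \bigcup_j F e s h j) = (c%:E * P H)%E.
Proof.
move=> s0 FW mF hF [mH hH] Hb.
rewrite setI_bigcupr [in RHS](history_window e s0 mH).
have mW j : measurable (window e s j : set (space G)).
  by apply: (@sigma_of_sub _ _ _ _ _ X setT); exact: measurable_window.
apply: measure_bigcup_scale.
- by move=> j; apply: measurableI.
- by move=> j; apply: measurableI.
- apply: (@trivIset_subfamily _ (window e s)); last exact: trivIset_window.
  by move=> j w [_ /FW].
- apply: (@trivIset_subfamily _ (window e s)); last exact: trivIset_window.
  by move=> j w [].
move=> j; have [pj|pj] := eqVneq (present A e j) b.
  have [D mD DE] := hH j.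
  rewrite DE -(hF _ _ pj mD); congr (P _).
  apply/seteqP; split => w [h1 h2]; split => //.
    have : (H `&` window e s j) w by split => //; exact: (FW j).
    by rewrite DE => -[].
  have : (D `&` window e s j) w by split => //; exact: (FW j).
  by rewrite -DE => -[].
have HW : H `&` window e s j = set0.
  apply/seteqP; split => // w [/Hb /= h1 h2].
  by move: pj; rewrite -(edges_window h2) h1 eqxx.
have HF : H `&` F e s h j = set0.
  by rewrite -subset0 -HW; exact: setIS.
by rewrite HW HF measure0 mule0.
Qed.

End History.

(** * The generator of the edge count *)

Section RealProbability.
Context (R : realType) (d : measure_display) (T : measurableType d)
  (P : probability T R).

(** Real-valued copy of the law, so that estimates are accessible to linear arithmetic; by [prE]
    nothing is lost on measurable sets. *)
Definition pr (E : set T) : R := fine (P E).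

Lemma prE E : measurable E -> P E = (pr E)%:E.
Proof. by move=> mE; rewrite /pr fineK// fin_num_measure. Qed.

Lemma pr_ge0 E : 0 <= pr E.
Proof. exact: fine_ge0. Qed.

Lemma pr0 : pr set0 = 0.
Proof. by rewrite /pr measure0. Qed.

Lemma prT : pr setT = 1.
Proof. by rewrite /pr probability_setT. Qed.

Lemma pr_le E F : measurable E -> measurable F -> E `<=` F -> pr E <= pr F.
Proof.
by move=> mE mF EF; rewrite -lee_fin -!prE//; apply: le_measure => //; rewrite inE.
Qed.

Lemma prU E F : measurable E -> measurable F -> E `&` F = set0 ->
  pr (E `|` F) = pr E + pr F.
Proof.
move=> mE mF EF; apply: EFin_inj; rewrite EFinD -!prE//; last exact: measurableU.
exact: measureU.
Qed.

Lemma prU2 E F : measurable E -> measurable F -> pr (E `|` F) <= pr E + pr F.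
Proof.
move=> mE mF; rewrite -lee_fin EFinD -!prE//; last exact: measurableU.
exact: measureU2.
Qed.

Lemma prC E : measurable E -> pr (~` E) = 1 - pr E.
Proof.
move=> mE; have := prU mE (measurableC mE) (setICr _).
by rewrite setUv prT => ->; rewrite addrAC subrr add0r.
Qed.

Lemma pr_partition_seq (I : eqType) (H : set T) (f : T -> I) (r : seq I) :
  uniq r -> measurable H -> (forall i, measurable [set w | f w = i]) ->
  pr (H `&` [set w | f w \in r]) = \sum_(i <- r) pr (H `&` [set w | f w = i]).
Proof.
move=> + mH mf.
have mr (s : seq I) : measurable [set w | f w \in s].
  elim: s => [|i s IH].
    by rewrite (_ : [set w | _] = set0) //; apply/seteqP; split => w.
  rewrite (_ : [set w | _] = [set w | f w = i] `|` [set w | f w \in s]).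
    exact: measurableU.
  apply/seteqP; split => w /=; rewrite inE; first by move=> /orP[/eqP|]; [left|right].
  by move=> [->|->]; rewrite ?eqxx ?orbT.
elim: r => [_|i r IH /= /andP[ir ur]].
  by rewrite big_nil (_ : _ `&` _ = set0) ?pr0//; apply/seteqP; split => w // [].
rewrite big_cons -IH// -prU; first last.
- apply/seteqP; split => w //= [[_ h1] [_ h2]].
  by move: ir; rewrite -h1 h2.
- exact: measurableI.
- exact: measurableI.
congr (pr _); apply/seteqP; split => w /=; rewrite inE.
  by move=> [h /orP[/eqP|]]; [left|right].
by move=> [[h ->]|[h ->]]; rewrite ?eqxx ?orbT.
Qed.

Lemma pr_partition (I : finType) (H : set T) (f : T -> I) :
  measurable H -> (forall i, measurable [set w | f w = i]) ->
  pr H = \sum_i pr (H `&` [set w | f w = i]).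
Proof.
move=> mH mf; rewrite -[in RHS]big_enum /= -pr_partition_seq// ?enum_uniq//.
by congr pr; apply/seteqP; split => w // => [h|[]//]; split => //=; rewrite mem_enum.
Qed.

Lemma pr_partition_nat (H : set T) (f : T -> nat) N : measurable H ->
  (forall i, measurable [set w | f w = i]) -> (forall w, (f w <= N)%N) ->
  pr H = \sum_(m < N.+1) pr (H `&` [set w | f w = m]).
Proof.
move=> mH mf fN.
rewrite -(big_mkord xpredT (fun m => pr (H `&` [set w | f w = m]))).
rewrite -pr_partition_seq//; last exact: iota_uniq.
congr pr; apply/seteqP; split => w //; last by case.
by move=> h; split => //=; rewrite mem_index_iota ltnS fN.
Qed.

End RealProbability.

(* A probability vector that dominates, up to errors [err], another vector with
   the same mass is close to it: the excess mass equals the deficit. *)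
Lemma sum_abs_dominated (R : realFieldType) (I : finType) (g q t err : I -> R) M :
  \sum_m q m = \sum_m t m -> (forall m, t m - err m <= q m) ->
  (forall m, 0 <= err m) -> (forall m, `|g m| <= M) ->
  `|\sum_m g m * q m - \sum_m g m * t m| <= 2 * M * \sum_m err m.
Proof.
move=> qt qerr err0 gM.
rewrite -sumrB; apply: (le_trans (ler_norm_sum _ _ _)).
apply: (@le_trans _ _ (\sum_m (M * (q m - t m) + 2 * M * err m))).
  apply: ler_sum => m _; rewrite -mulrBr normrM.
  have M0 : 0 <= M := le_trans (normr_ge0 _) (gM m).
  have h : `|q m - t m| <= (q m - t m) + 2 * err m.
    by have := qerr m; have := err0 m; case: (ler0P (q m - t m)); lra.
  apply: (@le_trans _ _ (M * ((q m - t m) + 2 * err m))); last by lra.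
  by apply: ler_pM.
by rewrite big_split /= -!mulr_sumr sumrB qt subrr mulr0 add0r.
Qed.

Lemma norm_le_sum (R : numDomainType) (g : nat -> R) N m :
  (forall k, (k <= N)%N -> 0 <= g k) -> (m <= N)%N -> `|g m| <= \sum_(k < N.+1) g k.
Proof.
move=> g0 mN; rewrite ger0_norm ?g0// (bigD1 (Ordinal (mN : (m < N.+1)%N)))//= lerDl.
by rewrite sumr_ge0// => k _; apply: g0; have := ltn_ord k.
Qed.

(** Dividing by [C + 1] allows [C = 0]; this is how meshes are chosen. *)
Lemma mul_le_of_le_div1D (R : realFieldType) (C e h : R) :
  0 <= C -> 0 <= e -> h <= e / (C + 1) -> C * h <= e.
Proof.
move=> C0 e0; rewrite ler_pdivlMr; last lra.
have [h0|h0] := leP 0 h; first lra.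
have : 0 <= C * - h by rewrite mulr_ge0// oppr_ge0 ltW.
lra.
Qed.

Lemma one_sub_expR_ge (R : realType) (x : R) : 0 <= x -> x * (1 - x) <= 1 - expR (- x).
Proof.
move=> x0; have h := expR_ge1Dx x.
have hi : expR (- x) <= (1 + x)^-1.
  by rewrite expRN lef_pV2 ?posrE ?expR_gt0//; lra.
have : (1 + x)^-1 <= 1 - x * (1 - x).
  rewrite -[leLHS]mulr1 ler_pdivrMl; last lra.
  have : 0 <= x ^+ 3 by rewrite exprn_ge0.
  by rewrite !exprS expr0; nra.
lra.
Qed.

(** * Joint switches of all pairs in a short time interval *)

Section OneStep.
Context (R : realType) (alpha beta : R) (n : nat) (A : {set vpair n})
  (G : dynER alpha beta A).
Hypotheses (alpha_gt0 : 0 < alpha) (beta_gt0 : 0 < beta).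

Let P := law G.
Let X (x : vpair n * nat) : {RV law G >-> R} := holding G x.1 x.2.
Let r := rate alpha beta n.
Let N := #|vpair n|.

Definition full_history (s : R) (H : set (space G)) :=
  measurable H /\ forall e, history e s H.

Lemma full_historyT s : full_history s setT.
Proof. by split=> // e; exact: historyT. Qed.

Lemma full_historyC s H : full_history s H -> full_history s (~` H).
Proof. by move=> [mH h]; split=> [|e]; [exact: measurableC|exact: historyC]. Qed.

Lemma full_historyI s H H' :
  full_history s H -> full_history s H' -> full_history s (H `&` H').
Proof.
by move=> [mH h] [mH' h']; split=> [|e]; [exact: measurableI|exact: historyI].
Qed.

Lemma full_historyU s H H' :
  full_history s H -> full_history s H' -> full_history s (H `|` H').
Proof.
move=> h h'; rewrite -[_ `|` _]setCK setCU; apply: full_historyC.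
by apply: full_historyI; exact: full_historyC.
Qed.

Lemma full_history0 s : full_history s set0.
Proof. by rewrite -setCT; apply: full_historyC; exact: full_historyT. Qed.

Lemma full_history_edges t s (a : {set vpair n}) : t <= s ->
  full_history s [set w | edges t w = a].
Proof.
move=> ts.
have -> : [set w : space G | edges t w = a] = \big[setI/setT]_(e <- enum (vpair n))
    [set w : space G | (e \in edges t w) = (e \in a)].
  rewrite -bigcap_seq; apply/seteqP; split => w /=; first by move=> <-.
  by move=> h; apply/setP => e; apply: h; rewrite /= mem_enum.
apply: (@big_ind _ (full_history s)); first exact: full_historyT.
  by move=> ? ?; exact: full_historyI.
move=> e _.
have h : full_history s [set w : space G | e \in edges t w].
  split; first by apply: (@sigma_of_sub _ _ _ _ _ X setT); apply: measurable_edge.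
  by move=> e'; exact: history_edge.
case: (e \in a) => //.
rewrite (_ : [set w | _] = ~` [set w : space G | e \in edges t w]).
  exact: full_historyC.
by apply/seteqP; split => w /=; [move=> ->|move=> /negP/negbTE].
Qed.

Lemma full_history_edges_pred t s (f : {set vpair n} -> bool) : t <= s ->
  full_history s [set w | f (edges t w)].
Proof.
move=> ts.
have -> : [set w : space G | f (edges t w)] = \big[setU/set0]_(a <- enum f)
    [set w : space G | edges t w = a].
  rewrite -bigcup_seq; apply/seteqP; split => w /=.
    by move=> h; exists (edges t w) => //=; rewrite mem_enum.
  by move=> [a /= + ->]; rewrite mem_enum.
apply: (@big_ind _ (full_history s)); first exact: full_history0.
  by move=> ? ?; exact: full_historyU.
by move=> a _; exact: full_history_edges.
Qed.

Lemma full_history_eta t s (f : pred nat) : t <= s ->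
  full_history s [set w | f (eta t w)].
Proof. exact: (@full_history_edges_pred t s (fun a => f #|a|)). Qed.

Lemma measurable_eta t k : measurable [set w : space G | eta t w = k].
Proof.
have [h _] := @full_history_eta t t (pred1 k) (lexx _).
by rewrite (_ : [set w | _] = [set w : space G | pred1 k (eta t w)])//;
  apply/seteqP; split => w /= /eqP.
Qed.

Lemma eta_le t (w : space G) : (eta t w <= N)%N.
Proof. exact: max_card. Qed.

Lemma no_switch_edges e s h (w : space G) : 0 <= h -> no_switch e s h w ->
  (e \in edges (s + h) w) = (e \in edges s w).
Proof.
move=> h0 [j _ hj]; rewrite (edges_window (stay_window h0 hj)).
apply: edges_window; case: hj => h1 h2; apply/andP; split => //.
by apply: le_trans h1 _; lra.
Qed.

Lemma one_switch_edges e s h (w : space G) : 0 <= h -> one_switch e s h w ->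
  (e \in edges (s + h) w) = ~~ (e \in edges s w).
Proof.
move=> h0 [j _ [[hj hst] hT]]; rewrite (edges_window hj).
rewrite (@edges_window _ _ _ _ _ _ _ _ j.+1).
  by rewrite /present /=; case: (e \in A); case: (odd j).
case/andP: hj => h1 h2; rewrite /window /= in hT *.
rewrite (switch_timeS _ j.+1); apply/andP; split; last by lra.
by rewrite leNgt; apply/negP => h3; apply: hst.
Qed.

Lemma measurable_no_switch e s h :
  measurable (no_switch e s h : set (sigma_of X [set x | x.1 = e])).
Proof. by apply: bigcup_measurable => j _; apply: measurable_stay. Qed.

Lemma measurable_one_switch e s h :
  measurable (one_switch e s h : set (sigma_of X [set x | x.1 = e])).
Proof. by apply: bigcup_measurable => j _; apply: measurable_jump. Qed.

Lemma measurable_no_switch_space e s h : measurable (no_switch e s h : set (space G)).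
Proof. by have h1 := @measurable_no_switch e s h; exact: (sigma_of_sub h1). Qed.

Lemma measurable_one_switch_space e s h : measurable (one_switch e s h : set (space G)).
Proof. by have h1 := @measurable_one_switch e s h; exact: (sigma_of_sub h1). Qed.

Definition no_switches (L : seq (vpair n)) s h : set (space G) :=
  \big[setI/setT]_(e <- L) no_switch e s h.

(** The silence of other pairs during (s, s + h] lies in the future of [s], yet it is admissible:
    [history e s] restricts only what is known about [e] itself. *)
Lemma history_no_switches e L s h : e \notin L -> history e s (no_switches L s h).
Proof.
rewrite /no_switches; elim: L => [|e' L IH]; first by rewrite big_nil => _; exact: historyT.
rewrite inE negb_or big_cons => /andP[ee' eL]; apply: historyI; last exact: IH.
by apply: history_other ee' _; exact: measurable_no_switch.
Qed.

Lemma measurable_no_switches L s h : measurable (no_switches L s h).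
Proof.
rewrite /no_switches; elim: L => [|e' L IH]; first by rewrite big_nil.
rewrite big_cons; apply: measurableI => //.
exact: measurable_no_switch_space.
Qed.

Section OneStepFrom.
Variables (s h : R) (H : set (space G)) (a : {set vpair n}).
Hypotheses (s0 : 0 <= s) (h0 : 0 <= h) (hH : full_history s H)
  (Ha : H `<=` [set w | edges s w = a]).

(** Induction over the pairs: the silence of the remaining ones belongs to the history seen from the
    next, so each pair contributes its own factor. *)
Lemma pr_no_switches L : uniq L ->
  pr P (H `&` no_switches L s h) =
  (\prod_(e <- L) expR (- r (e \in a) * h)) * pr P H.
Proof.
have [mH hHe] := hH.
elim: L => [|e L IH] /=; first by rewrite /no_switches !big_nil setIT mul1r.
move=> /andP[eL uL]; rewrite big_cons -mulrA -IH// /no_switches big_cons -/(no_switches L s h).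
rewrite setICA setIC; apply: EFin_inj; rewrite EFinM -!prE; last 2 first.
- by apply: measurableI => //; exact: measurable_no_switches.
- apply: measurableI; last exact: measurable_no_switch_space.
  by apply: measurableI => //; exact: measurable_no_switches.
apply: (@prob_switch_scale _ _ _ _ _ G alpha_gt0 beta_gt0 (@stay _ _ _ _ _ G) e s h (e \in a)) => //.
- by move=> j; exact: stay_window.
- move=> j; apply: (@sigma_of_sub _ _ _ _ _ X setT); exact: measurable_stay.
- by move=> j D <- mD; exact: prob_stay.
- by apply: historyI => //; exact: history_no_switches.
- by move=> w [/Ha /= -> _].
Qed.

Lemma pr_one_switch e L : uniq L -> e \notin L ->
  pr P (H `&` no_switches L s h `&` one_switch e s h) =
  (1 - expR (- r (e \in a) * h)) * expR (- r (e \notin a) * h) *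
  (\prod_(e <- L) expR (- r (e \in a) * h)) * pr P H.
Proof.
have [mH hHe] := hH.
move=> uL eL; rewrite -mulrA -pr_no_switches//.
apply: EFin_inj; rewrite EFinM -!prE; last 2 first.
- by apply: measurableI => //; exact: measurable_no_switches.
- apply: measurableI; last exact: measurable_one_switch_space.
  by apply: measurableI => //; exact: measurable_no_switches.
apply: (@prob_switch_scale _ _ _ _ _ G alpha_gt0 beta_gt0 (@jump _ _ _ _ _ G) e s h (e \in a)) => //.
- by move=> j w [[]].
- move=> j; apply: (@sigma_of_sub _ _ _ _ _ X setT); exact: measurable_jump.
- move=> j D pj mD; rewrite prob_jump//.
  have -> : present A e j.+1 = (e \notin a).
    by rewrite -pj /present /=; case: (e \in A); case: (odd j).
  by rewrite pj.
- by apply: historyI => //; exact: history_no_switches.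
- by move=> w [/Ha /= -> _].
Qed.

End OneStepFrom.

End OneStep.

(** The birth coefficient is 0 at [k = N] and the death coefficient is 0 at [k = 0], so for [k <= N]
    only the values of [g] on 0, ..., N influence the result. *)
Definition generator (R : numDomainType) (birth death : R) (N : nat) (g : nat -> R)
    (k : nat) : R :=
  (N - k)%:R * birth * (g k.+1 - g k) + k%:R * death * (g k.-1 - g k).

Definition toggle (T : finType) (a : {set T}) (e : T) : {set T} :=
  [set x | (x \in a) (+) (x == e)]%SET.

Lemma toggle_inj (T : finType) (a : {set T}) : injective (toggle a).
Proof.
move=> e e' /setP/(_ e); rewrite !inE eqxx.
by case: eqP => // _; case: (e \in a).
Qed.

Lemma card_toggle (T : finType) (a : {set T}) e :
  #|toggle a e| = if e \in a then #|a|.-1 else #|a|.+1.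
Proof.
case: ifPn => ea.
  rewrite (_ : toggle a e = a :\ e)%SET; first by rewrite [in RHS](cardsD1 e) ea.
  apply/setP => x; rewrite !inE; case: eqP => [->|_]; first by rewrite ea.
  by rewrite addbF.
rewrite (_ : toggle a e = e |: a)%SET; first by rewrite cardsU1 ea.
apply/setP => x; rewrite !inE; case: eqP => [->|_]; first by rewrite (negbTE ea).
by rewrite addbF.
Qed.

Lemma sum_ord_eq (R : pzSemiRingType) (N c : nat) (F : nat -> R) :
  \sum_(m < N.+1) F m * ((m : nat) == c)%:R = if (c <= N)%N then F c else 0.
Proof.
case: ifPn => [cN|].
  rewrite (bigD1 (Ordinal (cN : (c < N.+1)%N)))//= eqxx mulr1 big1 ?addr0// => m mc.
  by case: eqP => [mc'|_]; rewrite ?mulr0//; move: mc; rewrite -val_eqE /= mc' eqxx.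
rewrite -ltnNge => Nc; rewrite big1// => m _.
by case: eqP => [mc|_]; rewrite ?mulr0//; have := ltn_ord m; lia.
Qed.

(** * Law of the edge count after a short time step *)

Section OneStep.
Context (R : realType) (alpha beta : R) (n : nat) (A : {set vpair n})
  (G : dynER alpha beta A).
Hypotheses (alpha_gt0 : 0 < alpha) (beta_gt0 : 0 < beta) (n_gt1 : (1 < n)%N).

Let P := law G.
Let r := rate alpha beta n.
Let N := #|vpair n|.

(** A crude bound for the rates of all pairs plus one further rate: a pair that has switched must
    also hold its new state. *)
Definition total_rate : R := (N.+1)%:R * (alpha + rate alpha beta n false).

Lemma rate_ge0 b : 0 <= r b.
Proof.
rewrite /r /rate; case: b; first exact: ltW.
by apply: divr_ge0; [exact: ltW|rewrite subr_ge0 ler1n ltnW].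
Qed.

Lemma rate_le b : r b <= alpha + r false.
Proof.
have := rate_ge0 false; have := alpha_gt0.
by rewrite /r; case: b => /=; lra.
Qed.

Lemma sum_rate (a : {set vpair n}) :
  \sum_(e <- enum (vpair n)) r (e \in a) =
  (N - #|a|)%:R * r false + #|a|%:R * alpha.
Proof.
rewrite big_enum /= (bigID (mem a)) /= addrC; congr (_ + _).
  transitivity (\sum_(e | e \notin a) r false).
    by apply: eq_bigr => e /negbTE ->.
  rewrite sumr_const mulr_natl; congr (_ *+ _).
  by rewrite /N -(cardC (mem a)) addKn.
transitivity (\sum_(e | e \in a) alpha).
  by apply: eq_bigr => e ->.
by rewrite sumr_const mulr_natl.
Qed.

Lemma total_rate_ge0 : 0 <= total_rate.
Proof. by rewrite /total_rate mulr_ge0// addr_ge0//; [exact: ltW|exact: (rate_ge0 false)]. Qed.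

Lemma sum_rate_le (L : seq (vpair n)) (a : {set vpair n}) b :
  (size L <= N)%N -> r b + \sum_(e <- L) r (e \in a) <= total_rate.
Proof.
move=> LN; apply: (@le_trans _ _ ((size L).+1%:R * (alpha + r false))).
  rewrite -nat1r mulrDl mul1r lerD ?rate_le//.
  elim: {LN} L => [|e L IH] /=; first by rewrite big_nil mul0r.
  by rewrite big_cons -nat1r mulrDl mul1r lerD ?rate_le.
rewrite /total_rate ler_wpM2r ?ler_nat//.
by have := rate_ge0 false; have := alpha_gt0; lra.
Qed.

Section OneStepFrom.
Variables (s h : R) (H : set (space G)) (a : {set vpair n}).
Hypotheses (s0 : 0 <= s) (h0 : 0 <= h) (hB : total_rate * h <= 1)
  (hH : full_history s H) (Ha : H `<=` [set w | edges s w = a]).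

Let p := pr P H.
Let q m := pr P (H `&` [set w | eta (s + h) w = m]).
Let lam := (N - #|a|)%:R * r false.
Let mu := #|a|%:R * alpha.

Lemma prod_expR_rate (L : seq (vpair n)) :
  \prod_(e <- L) expR (- r (e \in a) * h) = expR (- ((\sum_(e <- L) r (e \in a)) * h)).
Proof.
elim: L => [|e L IH]; first by rewrite !big_nil mul0r oppr0 expR0.
by rewrite !big_cons IH -expRD; congr expR; ring.
Qed.

Lemma one_step_stay : p * (1 - (lam + mu) * h) <= q #|a|.
Proof.
have [mH _] := hH.
rewrite mulrC /lam /mu -sum_rate.
apply: (@le_trans _ _ (pr P (H `&` no_switches (G := G) (enum (vpair n)) s h))).
  rewrite (pr_no_switches alpha_gt0 beta_gt0 s0 h0 hH Ha) ?enum_uniq//.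
  rewrite prod_expR_rate; apply: ler_wpM2r; first exact: pr_ge0.
  by have := expR_ge1Dx (- ((\sum_(e <- enum (vpair n)) r (e \in a)) * h)); lra.
apply: pr_le.
- by apply: measurableI => //; exact: measurable_no_switches.
- by apply: measurableI => //; exact: measurable_eta.
move=> w [Hw]; rewrite /no_switches -bigcap_seq => hw; split => //=.
rewrite /eta -[in RHS](Ha Hw); congr (#|pred_of_set _|); apply/setP => e.
by apply: no_switch_edges => //; apply: hw; rewrite /= mem_enum.
Qed.

(** The factor [1 - 2 * total_rate * h] collects two losses of relative order [h]: the quadratic
    term in the switching probability of [e], and the chance that something else happens as well. *)
Lemma one_step_switch (e : vpair n) :
  p * (r (e \in a) * h * (1 - 2 * total_rate * h)) <=
  pr P (H `&` [set w | edges (s + h) w = toggle a e]).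
Proof.
have [mH _] := hH.
pose L := rem e (enum (vpair n)).
have uL : uniq L by rewrite rem_uniq// enum_uniq.
have eL : e \notin L by rewrite mem_rem_uniq ?enum_uniq// inE eqxx.
have sL : (size L <= N)%N.
  by rewrite size_rem ?mem_enum// -cardE leq_pred.
apply: (@le_trans _ _ (pr P (H `&` no_switches (G := G) L s h `&` one_switch e s h))).
  rewrite (pr_one_switch alpha_gt0 beta_gt0 s0 h0 hH Ha)// mulrC.
  apply: ler_wpM2r; first exact: pr_ge0.
  rewrite prod_expR_rate -[leRHS]mulrA -expRD.
  set x := r (e \in a) * h.
  have hx : x <= total_rate * h.
    apply: ler_wpM2r => //.
    have := @sum_rate_le [::] a (e \in a) isT.
    by rewrite big_nil addr0.
  have x0 : 0 <= x by apply: mulr_ge0 => //; exact: rate_ge0.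
  have h1 : x * (1 - x) <= 1 - expR (- r (e \in a) * h).
    by rewrite mulNr; exact: one_sub_expR_ge.
  set y := - r _ * h + _.
  have h2 : 1 - total_rate * h <= expR y.
    apply: le_trans (expR_ge1Dx y); rewrite lerD2l /y.
    have := ler_wpM2r h0 (@sum_rate_le L a (e \notin a) sL).
    by lra.
  apply: (@le_trans _ _ (x * (1 - x) * (1 - total_rate * h))); last first.
    have x1 : x <= 1 by exact: le_trans hx hB.
    apply: ler_pM => //; last by rewrite subr_ge0.
    by apply: mulr_ge0 => //; rewrite subr_ge0.
  rewrite -[leRHS]mulrA -[X in 1 - X]mulrA; apply: ler_wpM2l => //.
  move: hx hB; move: (total_rate * h) => z hx z1.
  have : 0 <= (z - x) * (1 - z) by apply: mulr_ge0; rewrite subr_ge0.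
  have := sqr_ge0 z; rewrite expr2.
  lra.
apply: pr_le.
- apply: measurableI; last exact: measurable_one_switch_space.
  by apply: measurableI => //; exact: measurable_no_switches.
- apply: measurableI => //.
  by have [] := @full_history_edges _ _ _ _ _ G (s + h) (s + h) (toggle a e) (lexx _).
move=> w [[Hw]]; rewrite /no_switches -bigcap_seq => hw ew; split => //=.
apply/setP => e'; rewrite [in RHS]inE -(Ha Hw).
have [->|ee'] := eqVneq e' e.
  by rewrite (one_switch_edges h0 ew) addbT.
rewrite addbF; apply: no_switch_edges => //; apply: hw.
by rewrite /= mem_rem_uniq ?enum_uniq// !inE ee' mem_enum.
Qed.

(** Toggling different pairs leads to different edge sets, so the single-switch events are disjoint
    and their lower bounds add up. *)
Lemma one_step_toggle (S : pred (vpair n)) m (b : bool) :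
  (forall e, S e -> (e \in a) = b /\ #|toggle a e| = m) ->
  p * (#|S|%:R * r b * h * (1 - 2 * total_rate * h)) <= q m.
Proof.
move=> hS; have [mH _] := hH.
have meta : measurable (H `&` [set w | eta (s + h) w = m]).
  by apply: measurableI => //; exact: measurable_eta.
have medges a' : measurable [set w : space G | edges (s + h) w = a'].
  by have [] := @full_history_edges _ _ _ _ _ G (s + h) (s + h) a' (lexx _).
rewrite /q (pr_partition P meta medges).
apply: (@le_trans _ _ (\sum_(e in S) pr P (H `&` [set w | eta (s + h) w = m] `&`
    [set w | edges (s + h) w = toggle a e]))).
  apply: (@le_trans _ _ (\sum_(e in S) p * (r (e \in a) * h * (1 - 2 * total_rate * h)))).
    rewrite (eq_bigr (fun=> p * (r b * h * (1 - 2 * total_rate * h)))).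
      by rewrite sumr_const -mulr_natl; lra.
    by move=> e /hS[->].
  apply: ler_sum => e /hS[_ hm]; apply: (le_trans (one_step_switch e)).
  apply: pr_le; [exact: measurableI|exact: measurableI|].
  by move=> w [Hw /= ew]; split => //; split => //=; rewrite /eta ew.
rewrite -(big_imset (fun a' => pr P (H `&` [set w | eta (s + h) w = m] `&`
    [set w | edges (s + h) w = a']))); last by move=> ? ? _ _; exact: toggle_inj.
rewrite [leRHS](bigID [pred a' | a' \in [set toggle a x | x in S]%SET]) /=.
by apply: ler_wpDr => //; apply: sumr_ge0 => *; exact: pr_ge0.
Qed.

(** The lower bounds on [q] meet the target [t] up to [err], and both vectors have mass [p], so
    [sum_abs_dominated] applies. The constant is [2 * M] times the relative error
    [2 * total_rate * h] times the switching probability, at most [total_rate * h]. *)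
Lemma one_step_edges (g : nat -> R) (M : R) : (forall m, (m <= N)%N -> `|g m| <= M) ->
  `|\sum_(m < N.+1) g m * q m - p * (g #|a| + h * generator (r false) alpha N g #|a|)|
    <= 4 * total_rate ^+ 2 * M * h ^+ 2 * p.
Proof.
move=> gM; have [mH _] := hH.
set k := #|a|.
have kN : (k <= N)%N by exact: max_card.
have M0 : 0 <= M by apply: le_trans (gM 0%N _).
have p0 : 0 <= p by exact: pr_ge0.
have r0 := rate_ge0 false.
have lam0 : 0 <= lam by apply: mulr_ge0.
have mu0 : 0 <= mu by apply: mulr_ge0 => //; exact: ltW.
have lammu : lam + mu <= total_rate.
  rewrite /lam /mu -sum_rate; have := @sum_rate_le (enum (vpair n)) a false.
  by rewrite -cardE => /(_ (leqnn _)); lra.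
pose t (m : 'I_N.+1) := p * ((1 - (lam + mu) * h) * ((m : nat) == k)%:R +
   lam * h * ((m : nat) == k.+1)%:R + mu * h * ((m : nat) == k.-1)%:R).
pose err (m : 'I_N.+1) := p * (2 * total_rate * h) * (
   lam * h * ((m : nat) == k.+1)%:R + mu * h * ((m : nat) == k.-1)%:R).
have tg (f : nat -> R) : \sum_(m < N.+1) f m * t m =
    p * (f k + h * generator (r false) alpha N f k).
  rewrite (eq_bigr (fun m : 'I_N.+1 => p * (1 - (lam + mu) * h) * (f m * ((m : nat) == k)%:R)
     + p * (lam * h) * (f m * ((m : nat) == k.+1)%:R)
     + p * (mu * h) * (f m * ((m : nat) == k.-1)%:R))); last by move=> m _; rewrite /t; ring.
  rewrite !big_split /= -!mulr_sumr !sum_ord_eq kN (leq_trans (leq_pred _) kN).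
  rewrite /generator -/k -/lam -/mu.
  case: ifP => k1; first by ring.
  have -> : lam = 0.
    by rewrite /lam -/k (_ : (N - k)%N = 0%N) ?mul0r//; apply/eqP; rewrite subn_eq0 leqNgt k1.
  by ring.
have sum_q : \sum_(m < N.+1) q m = p.
  by rewrite /p (pr_partition_nat P (N := N) mH (measurable_eta G (s + h)))//; exact: eta_le.
have h1 : 0 <= total_rate * h by apply: mulr_ge0 => //; exact: total_rate_ge0.
apply: (@le_trans _ _ (2 * M * \sum_m err m)); last first.
  rewrite (eq_bigr (fun m : 'I_N.+1 => (p * (2 * total_rate * h) * (lam * h)) * ((m : nat) == k.+1)%:R
     + (p * (2 * total_rate * h) * (mu * h)) * ((m : nat) == k.-1)%:R)); last first.
    by move=> m _; rewrite /err; ring.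
  have s1 c : \sum_(m < N.+1) ((m : nat) == c)%:R = (if (c <= N)%N then 1 else 0) :> R.
    by rewrite -(sum_ord_eq N c (fun=> 1)); apply: eq_bigr => m _; rewrite mul1r.
  rewrite big_split /= -!mulr_sumr !s1 (leq_trans (leq_pred _) kN) mulr1.
  apply: (@le_trans _ _ (2 * M * (p * (2 * total_rate * h) * ((lam + mu) * h)))).
    apply: ler_wpM2l; first by lra.
    have : 0 <= p * (2 * total_rate * h) * (lam * h).
      by apply: mulr_ge0; apply: mulr_ge0 => //; lra.
    by case: ifP; lra.
  have : (lam + mu) * h <= total_rate * h by apply: ler_wpM2r.
  move=> h2; apply: (@le_trans _ _ (2 * M * (p * (2 * total_rate * h) * (total_rate * h)))).
    apply: ler_wpM2l; first by lra.
    by apply: ler_wpM2l => //; apply: mulr_ge0 => //; lra.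
  by rewrite le_eqVlt; apply/orP; left; apply/eqP; ring.
rewrite -tg; apply: sum_abs_dominated.
- rewrite sum_q; have := tg (fun=> 1); rewrite /generator !subrr !mulr0 addr0 mulr0 addr0 mulr1 => <-.
  by apply: eq_bigr => m _; rewrite mul1r.
- have up : p * (lam * h * (1 - 2 * total_rate * h)) <= q k.+1.
    have := @one_step_toggle [pred e | e \notin a] k.+1 false.
    have -> : #|[pred e | e \notin a]| = (N - k)%N by rewrite /N -(cardC (mem a)) addKn.
    by apply => e /= /negbTE ea; rewrite card_toggle ea.
  have down : p * (mu * h * (1 - 2 * total_rate * h)) <= q k.-1.
    have := @one_step_toggle (mem a) k.-1 true.
    by apply => e /= ea; rewrite card_toggle ea.
  have st := one_step_stay; rewrite -/k in st.
  move=> m; rewrite /t /err.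
  have q0 : 0 <= q m by exact: pr_ge0.
  case: (eqVneq (m : nat) k) => [->|mk].
    rewrite (ltn_eqF (ltnSn k)).
    (* Equality means [k = 0]: the death term of [t] then falls on the same index as the diagonal
       one, but [mu = 0]. *)
    case: (eqVneq k k.-1) => kk; last by move: st => /=; lra.
    move: st => /=; have -> : mu = 0.
      rewrite /mu -/k; have -> : k = 0%N by case: (k) kk => // k' /esym /n_Sn.
      by rewrite mul0r.
    by lra.
  case: (eqVneq (m : nat) k.+1) => [->|mk1].
    rewrite (gtn_eqF (leq_ltn_trans (leq_pred k) (ltnSn k))).
    by move: up => /=; lra.
  case: (eqVneq (m : nat) k.-1) => [->|mk2].
    by move: down => /=; lra.
  by move: q0 => /=; lra.
- move=> m; rewrite /err; apply: mulr_ge0; first by apply: mulr_ge0 => //; lra.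
  by apply: addr_ge0; apply: mulr_ge0 => //; apply: mulr_ge0.
- by move=> m; apply: gM; have := ltn_ord m.
Qed.

End OneStepFrom.

(** The error in [one_step_edges] is proportional to the probability of the conditioning event, so
    it sums over the edge sets with [k] elements. *)
Lemma one_step (s h : R) (H : set (space G)) k (g : nat -> R) (M : R) :
  0 <= s -> 0 <= h -> total_rate * h <= 1 -> full_history s H ->
  H `<=` [set w | eta s w = k] -> (forall m, (m <= N)%N -> `|g m| <= M) ->
  `|\sum_(m < N.+1) g m * pr P (H `&` [set w | eta (s + h) w = m])
     - pr P H * (g k + h * generator (r false) alpha N g k)|
    <= 4 * total_rate ^+ 2 * M * h ^+ 2 * pr P H.
Proof.
move=> s0 h0 hB hH Hk gM; have [mH _] := hH.
have medges a' : measurable [set w : space G | edges s w = a'].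
  by have [] := @full_history_edges _ _ _ _ _ G s s a' (lexx _).
rewrite [X in `|_ - X * _|](pr_partition P mH medges).
rewrite [X in _ <= _ * X](pr_partition P mH medges).
rewrite (eq_bigr (fun m : 'I_N.+1 => \sum_a g m *
   pr P (H `&` [set w | edges s w = a] `&` [set w | eta (s + h) w = m]))); last first.
  move=> m _; rewrite -mulr_sumr.
  have mHm : measurable (H `&` [set w | eta (s + h) w = m]).
    by apply: measurableI => //; exact: measurable_eta.
  rewrite (pr_partition P mHm medges); congr (_ * _).
  by apply: eq_bigr => a _; rewrite setIAC.
rewrite exchange_big /= mulr_suml -sumrB mulr_sumr.
apply: (le_trans (ler_norm_sum _ _ _)); apply: ler_sum => a _.
have [ak|ak] := eqVneq #|a| k.
  rewrite -ak; apply: one_step_edges => //.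
  by apply: full_historyI => //; exact: full_history_edges.
have -> : H `&` [set w | edges s w = a] = set0.
  apply/seteqP; split => // w [/Hk /= hk ew].
  by move: ak; rewrite -ew -/(eta s w) hk eqxx.
rewrite pr0 mul0r mulr0 subr0 big1 ?normr0// => m _.
by rewrite set0I pr0 mulr0.
Qed.

End OneStep.

(** * The process on a time grid, killed at bad states *)

Section Skeleton.
Context (R : realType) (alpha beta : R) (n : nat) (A : {set vpair n})
  (G : dynER alpha beta A).
Hypotheses (alpha_gt0 : 0 < alpha) (beta_gt0 : 0 < beta) (n_gt1 : (1 < n)%N).

Let P := law G.
Let N := #|vpair n|.
Let B : R := total_rate alpha beta n.
Let L := generator (rate alpha beta n false) alpha N.

(** Holding times are merely nonnegative, so a pair may switch at time 0 itself; the exceptional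
    event, some first holding time being 0, is null. *)
Lemma eta_time0 : pr P [set w | eta 0 w = #|A|] = 1.
Proof.
pose F e := holding G e 0 @^-1` `]0, +oo[%classic.
have mF e : measurable (~` F e).
  by apply: measurableC; rewrite /F -[_ @^-1` _]setTI; exact: measurable_funP.
have F1 e : pr P (~` F e) = 0.
  rewrite prC//; last by rewrite -[F e]setCK; exact: measurableC.
  have := @holding_tail _ _ _ _ _ G alpha_gt0 beta_gt0 e 0 0 (lexx _).
  by rewrite mulr0 expR0 => h; rewrite /pr [P _]h subrr.
have mE : measurable [set w : space G | eta 0 w = #|A|] by exact: measurable_eta.
have [mr r0] : let U := \big[setU/set0]_(e <- enum (vpair n)) ~` F e in
    measurable U /\ pr P U <= 0.
  elim: (enum _) => [|e r [mr IH]]; first by rewrite big_nil /= pr0; split.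
  rewrite big_cons; split; first exact: measurableU.
  by apply: le_trans (prU2 _ _ _) _ => //; rewrite F1 add0r.
rewrite -[LHS](subKr 1) -prC//; suff -> : pr P (~` [set w | eta 0 w = #|A|]) = 0.
  by rewrite subr0.
apply/eqP; rewrite eq_le pr_ge0 andbT; apply: le_trans r0.
apply: pr_le => //; first exact: measurableC.
move=> w hw; apply: contrapT => hU; apply: hw => /=.
rewrite /eta; congr (#|pred_of_set _|); apply/setP => e.
rewrite (@edges_window _ _ _ _ _ _ _ _ 0%N); first by rewrite /present addbF.
have : F e w.
  apply: contrapT => Fw; apply: hU; rewrite -bigcup_seq.
  by exists e => //=; rewrite mem_enum.
by rewrite /F /window /= in_itv/= andbT switch_timeS switch_time0 add0r lexx.
Qed.

(** Grid index 0 is left out because the infimum in [tau] runs over positive times. *)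
Definition survive (good : pred nat) (h : R) (k : nat) : set (space G) :=
  [set w | forall l, (0 < l <= k)%N -> good (eta (l%:R * h) w)].

Lemma survive0 good h : survive good h 0 = setT.
Proof. by apply/seteqP; split => w // _ l /=; case: l. Qed.

Lemma surviveS good h k :
  survive good h k.+1 = survive good h k `&` [set w | good (eta (k.+1%:R * h) w)].
Proof.
apply/seteqP; split => w /=.
  move=> hw; split; last by apply: hw; rewrite ltnS leqnn.
  by move=> l /andP[l0 lk]; apply: hw; rewrite l0 (leqW lk).
move=> [h1 h2] l /andP[l0]; rewrite leq_eqVlt => /orP[/eqP ->//|lk].
by apply: h1; rewrite l0.
Qed.

Lemma full_history_survive good h k s : 0 <= h -> k%:R * h <= s ->
  full_history s (survive good h k).
Proof.
move=> h0; elim: k => [|k IH] hs; first by rewrite survive0; exact: full_historyT.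
rewrite surviveS; apply: full_historyI.
  apply: IH; apply: le_trans hs; rewrite ler_wpM2r// ler_nat //.
exact: full_history_eta.
Qed.

Lemma measurable_survive good h k : 0 <= h -> measurable (survive good h k).
Proof. by move=> h0; have [] := @full_history_survive good h k _ h0 (lexx _). Qed.

Section Expectation.
Variables (good : pred nat) (h : R).
Hypotheses (h0 : 0 <= h) (hB : B * h <= 1).

Definition expct (g : nat -> R) (k : nat) : R :=
  \sum_(m < N.+1) g m * pr P (survive good h k `&` [set w | eta (k%:R * h) w = m]).

Definition surv (k : nat) : R := pr P (survive good h k).

Lemma expct_cst (c : R) k : expct (fun=> c) k = c * surv k.
Proof.
rewrite /expct -mulr_sumr /surv; congr (_ * _); apply/esym.
apply: pr_partition_nat; [exact: measurable_survive|exact: measurable_eta|exact: eta_le].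
Qed.

Lemma expctD f g k : expct (fun m => f m + g m) k = expct f k + expct g k.
Proof. by rewrite /expct -big_split; apply: eq_bigr => m _; rewrite mulrDl. Qed.

Lemma expctZ c f k : expct (fun m => c * f m) k = c * expct f k.
Proof. by rewrite /expct mulr_sumr; apply: eq_bigr => m _; rewrite mulrA. Qed.

Lemma surv_ge0 k : 0 <= surv k.
Proof. exact: pr_ge0. Qed.

Lemma surv0 : surv 0 = 1.
Proof. by rewrite /surv survive0 prT. Qed.

Lemma surv_le k l : (k <= l)%N -> surv l <= surv k.
Proof.
move=> kl; apply: pr_le; [exact: measurable_survive|exact: measurable_survive|].
by move=> w hw i /andP[i0 ik]; apply: hw; rewrite i0 (leq_trans ik).
Qed.

Lemma surv_le1 k : surv k <= 1.
Proof. by rewrite -surv0 surv_le. Qed.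

Lemma expct0 g : expct g 0 = g #|A|.
Proof.
rewrite /expct survive0 mul0r.
rewrite (eq_bigr (fun m : 'I_N.+1 => g m * ((m : nat) == #|A|)%:R)).
  by rewrite sum_ord_eq max_card.
move=> m _; rewrite setTI; congr (_ * _).
have m0 k : measurable [set w : space G | eta 0 w = k] by exact: measurable_eta.
case: eqVneq => [->|mA]; first exact: eta_time0.
apply/eqP; rewrite eq_le pr_ge0 andbT.
apply: (@le_trans _ _ (pr P (~` [set w : space G | eta 0 w = #|A|]))).
  apply: pr_le => //; first exact: measurableC.
  by move=> w /= -> ; apply/eqP.
by rewrite prC// eta_time0 subrr.
Qed.

Hypothesis goodA : good #|A|.

Lemma pr_survive_bad k m : ~~ good m -> (survive good h k `&` [set w | eta (k%:R * h) w = m] = set0)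
   \/ k = 0%N /\ m != #|A|.
Proof.
move=> gm; case: k => [|k]; last first.
  left; apply/seteqP; split => // w [/(_ k.+1)] /=; rewrite ltnS leqnn => /(_ isT) gw ew.
  by move: gm; rewrite -ew gw.
by right; split => //; apply/eqP => mA; move: gm; rewrite mA goodA.
Qed.

Lemma expct_le f g k : (forall m, (m <= N)%N -> good m -> f m <= g m) ->
  expct f k <= expct g k.
Proof.
move=> fg; case: k => [|k].
  by rewrite !expct0; apply: fg => //; exact: max_card.
apply: ler_sum => m _; have [gm|gm] := boolP (good m).
  by apply: ler_wpM2r; [exact: pr_ge0|apply: fg => //; have := ltn_ord m].
by have [->|[]//] := pr_survive_bad k.+1 gm; rewrite pr0 !mulr0.
Qed.

(** Killing costs nothing: [g] vanishes at bad states, so survival of step [k.+1] may be dropped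
    from the expectation, and [one_step] applies from each state at time [k%:R * h]. *)
Lemma expct_step g M k : (forall m, (m <= N)%N -> `|g m| <= M) ->
  (forall m, ~~ good m -> g m = 0) ->
  `|expct g k.+1 - expct g k - h * expct (L g) k| <= 4 * B ^+ 2 * M * h ^+ 2 * surv k.
Proof.
move=> gM gbad.
pose H m := survive good h k `&` [set w : space G | eta (k%:R * h) w = m].
have mS := @measurable_survive good h k h0.
have eta_m t m : measurable [set w : space G | eta t w = m] by exact: measurable_eta.
have -> : surv k = \sum_(m < N.+1) pr P (H m).
  exact: (pr_partition_nat P mS (eta_m _) (eta_le _)).
have -> : expct g k.+1 = \sum_(m < N.+1)
    \sum_(m' < N.+1) g m' * pr P (H m `&` [set w | eta (k%:R * h + h) w = m']).
  rewrite exchange_big /=; apply: eq_bigr => m' _; rewrite -mulr_sumr.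
  have -> : k%:R * h + h = k.+1%:R * h by rewrite -natr1 mulrDl mul1r.
  have [gm|/gbad ->] := boolP (good m'); last by rewrite !mul0r.
  congr (_ * _); rewrite (pr_partition_nat P _ (eta_m (k%:R * h)) (eta_le _)); last first.
    by apply: measurableI => //; exact: measurable_survive.
  apply: eq_bigr => m _; congr pr; rewrite /H surviveS.
  apply/seteqP; split => w /=; first by move=> [[[? _] ?] ?].
  by move=> [[? ?] e]; rewrite e.
rewrite mulr_sumr -!sumrB mulr_sumr.
apply: (le_trans (ler_norm_sum _ _ _)); apply: ler_sum => m _.
have := @one_step _ _ _ _ _ G alpha_gt0 beta_gt0 n_gt1 (k%:R * h) h (H m) m g M.
have -> : \sum_(m' < N.+1) g m' * pr P (H m `&` [set w | eta (k%:R * h + h) w = m']) -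
     g m * pr P (H m) - h * (L g m * pr P (H m)) =
  \sum_(m' < N.+1) g m' * pr P (H m `&` [set w | eta (k%:R * h + h) w = m']) -
    pr P (H m) * (g m + h * L g m) by ring.
apply => //.
- by rewrite mulr_ge0.
- apply: full_historyI; [exact: full_history_survive|].
  rewrite (_ : [set w : space G | _] = [set w : space G | pred1 (m : nat) (eta (k%:R * h) w)]).
    exact: full_history_eta.
  by apply/seteqP; split => w /= /eqP.
- by move=> w [].
Qed.

(** By the tail-sum formula, the mean of the first positive grid time at a bad state, capped at
    [K%:R * h]. *)
Definition elapsed (K : nat) : R := h * \sum_(k < K) surv k.

Lemma elapsed_ge0 K : 0 <= elapsed K.
Proof. by rewrite mulr_ge0// sumr_ge0// => *; exact: surv_ge0. Qed.

(** Dynkin's formula on the grid. The local errors of order [h ^+ 2], weighted by survival, add up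
    to [h] times the elapsed time. *)
Lemma expct_sum g M K : (forall m, (m <= N)%N -> `|g m| <= M) ->
  (forall m, ~~ good m -> g m = 0) ->
  `|expct g K - g #|A| - h * \sum_(k < K) expct (L g) k|
     <= 4 * B ^+ 2 * M * h * elapsed K.
Proof.
move=> gM gbad; elim: K => [|K IH].
  by rewrite expct0 big_ord0 mulr0 subr0 subrr normr0 /elapsed big_ord0 !mulr0.
rewrite /elapsed !big_ord_recr /= !mulrDr.
have := expct_step K gM gbad; rewrite /elapsed in IH.
set x := expct g K.+1; set y := expct g K; set z := h * expct (L g) K.
move=> h1.
have -> : x - g #|A| - (h * (\sum_(i < K) expct (L g) i) + z) =
  (x - y - z) + (y - g #|A| - h * \sum_(i < K) expct (L g) i) by ring.
apply: le_trans (ler_normD _ _) _; rewrite addrC; apply: lerD => //.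
by apply: le_trans h1 _; rewrite le_eqVlt; apply/orP; left; apply/eqP; ring.
Qed.

End Expectation.

End Skeleton.

(** * Moments and tail of the hitting time *)

Section HittingTime.
Context (R : realType) (alpha beta : R) (n : nat) (A : {set vpair n})
  (G : dynER alpha beta A).

Let P := law G.
Let N := #|vpair n|.

(** If no window contains [t], all switch times are at most [t] and the pair is absent from [t] on.
    Right-continuity therefore holds surely, not just almost surely. *)
Lemma edge_right_continuous e t (w : space G) : 0 <= t ->
  exists2 delta : R, 0 < delta &
  forall t', t <= t' < t + delta -> (e \in edges t' w) = (e \in edges t w).
Proof.
move=> t0; have [[j _ hj]|hnone] := pselect ((\bigcup_j window (G := G) e t j) w).
  exists (switch_time e j.+1 w - t).
    by case/andP: hj => _; rewrite subr_gt0.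
  move=> t' /andP[tt' t'S]; rewrite (edges_window hj); apply: edges_window.
  case/andP: hj => h1 h2; rewrite /window /= (le_trans h1 tt')/=.
  by move: t'S; rewrite addrC subrK.
exists 1 => // t' /andP[tt' _]; rewrite (edges_nowindow hnone).
apply: edges_nowindow => -[k _ /andP[_ hk]].
have Sle l : switch_time e l w <= t.
  elim: l => [|l IH]; first by rewrite switch_time0.
  rewrite leNgt; apply/negP => h; apply: hnone; exists l => //=.
  by rewrite /window/= IH h.
by have := lt_le_trans hk (Sle k.+1); rewrite ltNge tt'.
Qed.

Lemma eta_right_continuous t (w : space G) : 0 <= t -> exists2 delta : R, 0 < delta &
  forall t', t <= t' < t + delta -> eta t' w = eta t w.
Proof.
move=> t0.
suff [delta d0 hd] : exists2 delta : R, 0 < delta &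
    forall t', t <= t' < t + delta -> forall e, e \in enum (vpair n) ->
      (e \in edges t' w) = (e \in edges t w).
  exists delta => // t' /hd h; rewrite /eta; congr (#|pred_of_set _|).
  by apply/setP => e; apply: h; rewrite mem_enum.
elim: (enum _) => [|e r [d1 d10 h1]]; first by exists 1.
have [d2 d20 h2] := edge_right_continuous e w t0.
exists (Num.min d1 d2); first by rewrite lt_min d10 d20.
move=> t' /andP[tt' t'd] e'; rewrite inE => /orP[/eqP ->|e'r].
  by apply: h2; rewrite tt' (lt_le_trans t'd)// lerD2l ge_min lexx orbT.
by apply: h1 => //; rewrite tt' (lt_le_trans t'd)// lerD2l ge_min lexx.
Qed.

Lemma tau_ge0 i (w : space G) : (0 <= tau i w)%E.
Proof.
by apply: le_ereal_inf_tmp => _ [t [t0 _] <-]; rewrite lee_fin ltW.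
Qed.

Lemma tau_le i t (w : space G) : 0 < t -> eta t w = i -> (tau i w <= t%:E)%E.
Proof. by move=> t0 ti; apply: ereal_inf_lbound; exists t. Qed.

Lemma tau_lt i t (w : space G) : (tau i w < t%:E)%E ->
  exists s, [/\ 0 < s, s < t & eta s w = i].
Proof.
by move/ereal_inf_lt => [_ [s [s0 si] <-]]; rewrite lte_fin => st; exists s.
Qed.

Lemma tau_gt_survive i h K (w : space G) : 0 < h -> ((K%:R * h)%:E < tau i w)%E ->
  survive (fun m => m != i) h K w.
Proof.
move=> h0 hK l /andP[l0 lK]; apply/eqP => li.
have := @tau_le i (l%:R * h) w; rewrite mulr_gt0 ?ltr0n// => /(_ isT li) h1.
have := lt_le_trans hK h1; rewrite lte_fin ltr_pM2r// ltr_nat.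
by rewrite ltnNge lK.
Qed.

(** Halving makes the grids nested, hence the survival events decreasing in [m]. *)
Definition mesh (theta : R) (m : nat) : R := theta / 2 ^+ m.

Lemma mesh_gt0 theta m : 0 < theta -> 0 < mesh theta m.
Proof. by move=> t0; rewrite divr_gt0// exprn_gt0. Qed.

Lemma mesh_mul theta m k : (k * 2 ^ m)%:R * mesh theta m = k%:R * theta.
Proof.
rewrite /mesh natrM natrX mulrACA -[RHS]mulr1; congr (_ * _).
by rewrite divff// expf_neq0.
Qed.

Lemma mesh_small theta eps : 0 < theta -> 0 < eps -> exists m0, forall m, (m0 <= m)%N ->
  mesh theta m < eps.
Proof.
move=> t0 e0; exists (Num.truncn (theta / eps)).+1 => m hm.
rewrite /mesh ltr_pdivrMr ?exprn_gt0// mulrC -ltr_pdivrMr//.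
apply: (lt_le_trans (truncnS_gt _)).
rewrite -natrX ler_nat; apply: leq_trans hm _; exact: ltnW (ltn_expl _ _).
Qed.

Lemma grid_hit theta i t T (w : space G) : 0 < theta -> 0 < t -> t < T -> eta t w = i ->
  exists m l, [/\ (0 < l)%N, l%:R * mesh theta m < T & eta (l%:R * mesh theta m) w = i].
Proof.
move=> th0 t0 tT ti.
have [d d0 hd] := eta_right_continuous w (ltW t0).
have e0 : 0 < Num.min d (T - t) by rewrite lt_min d0 subr_gt0.
have [m hm] := mesh_small th0 e0.
have {hm} := hm m (leqnn _); rewrite lt_min => /andP[md mT].
have h0 := mesh_gt0 m th0.
set h := mesh theta m in md mT h0 *.
exists m, (Num.truncn (t / h)).+1.
have h1 : t < (Num.truncn (t / h)).+1%:R * h.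
  by rewrite -ltr_pdivrMr//; exact: truncnS_gt.
have h2 : (Num.truncn (t / h)).+1%:R * h <= t + h.
  rewrite -natr1 mulrDl mul1r lerD2r -ler_pdivlMr//.
  by have /andP[] := truncn_itv (divr_ge0 (ltW t0) (ltW h0)).
split => //; first by rewrite -/h; lra.
by rewrite -ti; apply: hd; rewrite -/h; apply/andP; split; lra.
Qed.

Lemma survive_tau_ge theta i k (w : space G) : 0 < theta ->
  (forall m, survive (fun j => j != i) (mesh theta m) (k * 2 ^ m) w) ->
  ((k%:R * theta)%:E <= tau i w)%E.
Proof.
move=> th0 hw; rewrite leNgt; apply/negP => /tau_lt[s [s0 sT si]].
have [m [l [l0 lT li]]] := grid_hit th0 s0 sT si.
suff lk : (l <= k * 2 ^ m)%N by have := hw m l; rewrite l0 lk li eqxx => /(_ isT).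
by rewrite -(@ler_nat R) -(ler_pM2r (mesh_gt0 m th0)) mesh_mul ltW.
Qed.

(** By right-continuity, a hit before [x] is seen before [x] on some dyadic grid, so the event is a
    countable union. *)
Lemma measurable_tau i : measurable_fun setT (tau (G := G) i).
Proof.
have mlt (x : R) : measurable [set w : space G | (tau i w < x%:E)%E].
  rewrite (_ : [set w | _] = \bigcup_m \bigcup_(l in [set l | (0 < l)%N /\ l%:R * mesh 1 m < x])
     [set w : space G | eta (l%:R * mesh 1 m) w = i]).
    apply: bigcup_measurable => m _; apply: bigcup_measurable => l _.
    exact: measurable_eta.
  apply/seteqP; split => w /=.
    move=> /tau_lt[s [s0 sx si]].
    have [m [l [l0 lT li]]] := grid_hit ltr01 s0 sx si.
    by exists m => //; exists l.
  move=> [m _ [l [l0 lx] /= li]]; apply: (@le_lt_trans _ _ (l%:R * mesh 1 m)%:E).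
    by apply: tau_le => //; rewrite mulr_gt0 ?ltr0n ?mesh_gt0.
  by rewrite lte_fin.
apply: (measurability _ (@ErealGenInftyO.measurableE R)) => _ [_ [x ->] <-].
rewrite setTI (_ : _ @^-1` _ = [set w : space G | (tau i w < x%:E)%E]) //.
Qed.

Lemma measurable_tau_ge i (x : \bar R) : measurable [set w : space G | (x <= tau i w)%E].
Proof.
rewrite -[X in measurable X]setTI; apply: emeasurable_fun_c_infty => //.
exact: measurable_tau.
Qed.

Lemma measurable_tau_gt i (x : \bar R) : measurable [set w : space G | (x < tau i w)%E].
Proof.
rewrite -[X in measurable X]setTI; apply: emeasurable_fun_o_infty => //.
exact: measurable_tau.
Qed.

End HittingTime.

(* [f] is the expected hitting time of [i], characterised by its equation. *)
Definition hitting_time (R : numDomainType) (birth death : R) (N i : nat) (f : nat -> R) :=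
  [/\ f i = 0, forall m, (m <= N)%N -> 0 <= f m &
      forall m, (m <= N)%N -> m != i -> generator birth death N f m = - 1].

(** * Mean and second moment of the hitting time *)

Section HittingTimeMoments.
Context (R : realType) (alpha beta : R) (n : nat) (A : {set vpair n})
  (G : dynER alpha beta A) (i : nat).
Hypotheses (alpha_gt0 : 0 < alpha) (beta_gt0 : 0 < beta) (n_gt1 : (1 < n)%N)
  (Ai : #|A| != i).

Let P := law G.
Let N := #|vpair n|.
Let B : R := total_rate alpha beta n.
Let L := generator (rate alpha beta n false) alpha N.
Let avoid : pred nat := fun m => m != i.

(** Continuity from above along the nested grids: survival on all of them forces [tau] to be at
    least [k%:R * theta]. Equality cannot be excluded, hence the non-strict event. *)
Lemma surv_limit theta k eps : 0 < theta -> 0 < eps -> exists m0, forall m, (m0 <= m)%N ->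
  surv G avoid (mesh theta m) (k * 2 ^ m) <=
    pr P [set w | ((k%:R * theta)%:E <= tau i w)%E] + eps.
Proof.
move=> th0 e0.
pose F m := survive (G := G) avoid (mesh theta m) (k * 2 ^ m).
have mF m : measurable (F m) by apply: measurable_survive; exact/ltW/mesh_gt0.
have mcap : measurable (\bigcap_m F m) by exact: bigcapT_measurable.
have ndF : nonincreasing_seq F.
  apply/nonincreasing_seqP => m; apply/subsetPset => w hw l /andP[l0 lk].
  have := hw (2 * l)%N; rewrite muln_gt0 l0 /= expnS mulnCA leq_mul2l lk orbT.
  move=> /(_ isT); suff -> : (2 * l)%:R * mesh theta m.+1 = l%:R * mesh theta m by [].
  by rewrite /mesh exprS natrM; field; rewrite expf_neq0.
have Poo : (P (F 0%N) < +oo)%E by rewrite ltey_eq fin_num_measure.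
have := nonincreasing_cvg_mu Poo mF mcap ndF.
move=> hc.
have {hc} : (pr P (F m))%:E @[m --> \oo] --> (pr P (\bigcap_m F m))%:E.
  rewrite -prE//; apply: cvg_trans hc; apply: near_eq_cvg.
  by apply: nearW => m /=; rewrite prE.
move=> /fine_cvgP[_] /cvgrPdist_le/(_ _ e0)[m0 _ hm0].
exists m0 => m mm0; have := hm0 m mm0 => /=.
rewrite ler_distlC => /andP[_ h].
apply: (le_trans h); rewrite lerD2r; apply: pr_le => //.
  exact: measurable_tau_ge.
move=> w hw /=; apply: survive_tau_ge => // m'; exact: hw.
Qed.

Lemma surv_limit_unif theta K eps : 0 < theta -> 0 < eps -> exists m0, forall m k,
  (m0 <= m)%N -> (k <= K)%N -> surv G avoid (mesh theta m) (k * 2 ^ m) <=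
    pr P [set w | ((k%:R * theta)%:E <= tau i w)%E] + eps.
Proof.
move=> th0 e0; elim: K => [|K [m1 h1]].
  by have [m0 h0] := surv_limit 0 th0 e0; exists m0 => m k mm; rewrite leqn0 => /eqP ->; exact: h0.
have [m2 h2] := surv_limit K.+1 th0 e0.
exists (maxn m1 m2) => m k; rewrite geq_max => /andP[mm1 mm2].
by rewrite leq_eqVlt => /orP[/eqP ->|]; [exact: h2|exact: h1].
Qed.

(* [tau] is bounded by the first grid time at which [i] is seen. *)
Lemma integral_survive_le (X : space G -> \bar R) (c : nat -> R) (b h : R) :
  0 < h -> (forall k, 0 <= c k) -> measurable_fun setT X -> (forall w, 0 <= X w)%E ->
  (forall K w, (0 < K)%N -> eta (K%:R * h) w = i -> X w <= (\sum_(k < K) c k)%:E)%E ->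
  (forall x, exists K, x <= \sum_(k < K) c k) ->
  (forall K, \sum_(k < K) c k * surv G avoid h k <= b) ->
  (\int[P]_w X w <= b%:E)%E.
Proof.
move=> h0 c0 mX X0 Xle cub cb.
pose S k := survive (G := G) avoid h k.
have mS k : measurable (S k) by apply: measurable_survive; exact: ltW.
pose F k w := ((c k)%:E * (\1_(S k) w)%:E)%E.
have F0 k w : (0 <= F k w)%E by rewrite /F -EFinM lee_fin mulr_ge0.
have mF k : measurable_fun setT (F k).
  by apply: measurable_funeM; apply/measurable_EFinP; exact: measurable_indic.
have intF k : (\int[P]_w F k w = (c k * surv G avoid h k)%:E)%E.
  rewrite ge0_integralZl//; last 2 first.
  - by apply/measurable_EFinP; exact: measurable_indic.
  - by rewrite lee_fin.
  by rewrite integral_indic// setIT EFinM; congr (_ * _)%E; exact: prE.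
apply: (@le_trans _ _ (\int[P]_w \sum_(0 <= k <oo) F k w)%E).
  apply: ge0_le_integral => //.
    by apply: ge0_emeasurable_sum.
  move=> w _.
  have part K : (forall k, (k < K)%N -> S k w) ->
      ((\sum_(k < K) c k)%:E <= \sum_(0 <= k <oo) F k w)%E.
    move=> hK; apply: le_trans (nneseries_lim_ge K _); last by [].
    rewrite -sumEFin -(big_mkord xpredT (fun k => (c k)%:E)).
    rewrite big_nat_cond [leRHS]big_nat_cond; apply: lee_sum => k /andP[/andP[_ kK] _].
    by rewrite /F indicE mem_set ?mule1//; exact: hK.
  have [[K [K0 hK]]|nohit] := pselect (exists K, (0 < K)%N /\ eta (K%:R * h) w = i).
    have ex : exists K, (0 < K)%N && (eta (K%:R * h) w == i) by exists K; rewrite K0 hK /=.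
    case: (ex_minnP ex) => m /andP[m0 /eqP mi] mmin.
    apply: (le_trans (Xle _ _ m0 mi)); apply: part => k km l /andP[l0 lk].
    apply/negP => li; have := mmin l; rewrite l0 li => /(_ isT).
    by rewrite leqNgt (leq_ltn_trans lk km).
  suff -> : (\sum_(0 <= k <oo) F k w = +oo)%E by rewrite leey.
  apply/eqyP => x x0; have [K hK] := cub x.
  apply: (@le_trans _ _ (\sum_(k < K) c k)%:E); first by rewrite lee_fin.
  apply: part => k _ l /andP[l0 _]; apply/negP => /eqP li.
  by apply: nohit; exists l.
rewrite integral_nneseries//.
apply: lime_le; first by apply: is_cvg_nneseries => k _ _; exact: integral_ge0.
apply: nearW => K; rewrite big_mkord.
under eq_bigr do rewrite intF.
by rewrite sumEFin lee_fin.
Qed.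

Lemma elapsed_block h a b : 0 <= h ->
  b%:R * h * surv G avoid h (a + b) <= elapsed G avoid h (a + b) - elapsed G avoid h a
    <= b%:R * h * surv G avoid h a.
Proof.
move=> h0; elim: b => [|b /andP[IH1 IH2]]; first by rewrite addn0 subrr !mul0r lexx.
have e : elapsed G avoid h (a + b.+1) = elapsed G avoid h (a + b) + h * surv G avoid h (a + b).
  by rewrite /elapsed addnS big_ord_recr mulrDr.
have s1 : surv G avoid h (a + b.+1) <= surv G avoid h (a + b) by apply: surv_le => //; lia.
have s2 : surv G avoid h (a + b) <= surv G avoid h a by apply: surv_le => //; lia.
have b0 : 0 <= b%:R * h by apply: mulr_ge0.
rewrite e -natr1; apply/andP; split.
  apply: (@le_trans _ _ ((b%:R + 1) * h * surv G avoid h (a + b))).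
    by apply: ler_wpM2l => //; rewrite mulrDl mul1r addr_ge0.
  by lra.
have := ler_wpM2l h0 s2; lra.
Qed.

Section Equation.
Variable f : nat -> R.
Hypothesis hf : hitting_time (rate alpha beta n false) alpha N i f.

Let M := \sum_(m < N.+1) f m.
Let C := 4 * B ^+ 2 * M.

Let f0 : f i = 0. Proof. by case: hf. Qed.
Let f_ge0 m : (m <= N)%N -> 0 <= f m. Proof. by case: hf => _ + _; exact. Qed.
Let AN : (#|A| <= N)%N. Proof. exact: max_card. Qed.

Lemma hitting_time_bound m : (m <= N)%N -> `|f m| <= M.
Proof. exact: norm_le_sum. Qed.

Lemma hitting_time_bound_ge0 : 0 <= M.
Proof. by rewrite sumr_ge0// => k _; apply: f_ge0; have := ltn_ord k. Qed.

Lemma hitting_const_ge0 : 0 <= C.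
Proof.
by rewrite /C mulr_ge0 ?hitting_time_bound_ge0// mulr_ge0// exprn_even_ge0.
Qed.

Section Mesh.
Variable h : R.
Hypotheses (h0 : 0 <= h) (hB : B * h <= 1).

(** Dynkin's formula with [L f = - 1]: what the mean of [f] loses is the elapsed time. *)
Lemma hitting_elapsed K :
  `|expct G avoid h f K - f #|A| + elapsed G avoid h K| <= C * h * elapsed G avoid h K.
Proof.
have := @expct_sum _ _ _ _ _ G alpha_gt0 beta_gt0 n_gt1 avoid h h0 hB f M K
  hitting_time_bound.
have bad m : ~~ avoid m -> f m = 0 by rewrite negbK => /eqP ->.
move=> /(_ bad).
have -> : elapsed G avoid h K = - (h * \sum_(k < K) expct G avoid h (L f) k).
  rewrite /elapsed -mulrN -sumrN; congr (_ * _); apply: eq_bigr => k _.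
  apply: oppr_inj; rewrite opprK -mulN1r -expct_cst//.
  case: hf => _ _ Lf.
  apply/eqP; rewrite eq_le; apply/andP; split; apply: expct_le => // m mN gm;
    by rewrite /L Lf.
by [].
Qed.

Lemma expct_hitting_ge0 K : 0 <= expct G avoid h f K.
Proof.
by apply: sumr_ge0 => m _; apply: mulr_ge0; [apply: f_ge0; have := ltn_ord m|exact: pr_ge0].
Qed.

Lemma elapsed_le K : (1 - C * h) * elapsed G avoid h K <= f #|A|.
Proof.
have := hitting_elapsed K; rewrite ler_norml => /andP[_].
by have := expct_hitting_ge0 K; lra.
Qed.

(** An a priori bound free of mesh and horizon; it turns the relative error [C * h] into an absolute
    one. *)
Lemma elapsed_le_double K : C * h <= 1 / 2 -> elapsed G avoid h K <= 2 * f #|A|.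
Proof.
move=> hC; have := elapsed_le K; have e0 := elapsed_ge0 G avoid h0 K.
have : 0 <= (1 / 2 - C * h) * elapsed G avoid h K by rewrite mulr_ge0// subr_ge0.
lra.
Qed.

End Mesh.

Lemma fine_mesh eps : 0 < eps -> exists2 h : R, 0 < h & B * h <= 1 /\ C * h <= eps.
Proof.
move=> e0; have B0 : 0 <= B by exact: total_rate_ge0.
have C0 := hitting_const_ge0.
have d0 : 0 < Num.min (B + 1)^-1 (eps / (C + 1)).
  by rewrite lt_min invr_gt0 divr_gt0//; lra.
exists (Num.min (B + 1)^-1 (eps / (C + 1))) => //; split.
  by apply: mul_le_of_le_div1D => //; rewrite div1r ge_min lexx.
by apply: mul_le_of_le_div1D; rewrite ?(ltW e0)// ge_min lexx orbT.
Qed.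

Lemma block_mesh theta K delta eps : 0 < theta -> 0 < delta -> 0 < eps ->
  exists m, let h := mesh theta m in [/\ B * h <= 1, C * h <= delta &
    forall k, (k <= K)%N -> surv G avoid h (k * 2 ^ m) <=
      pr P [set w | ((k%:R * theta)%:E <= tau i w)%E] + eps].
Proof.
move=> th0 d0 e0; have [hh hh0 [hhB hhC]] := fine_mesh d0.
have [m0 hm0] := surv_limit_unif K th0 e0.
have [m1 hm1] := mesh_small th0 hh0.
exists (maxn m0 m1); set m := maxn _ _ => /=.
have hle : mesh theta m <= hh by apply/ltW/hm1; rewrite leq_maxr.
have B0 : 0 <= B by exact: total_rate_ge0.
split; last by move=> k kK; apply: hm0 => //; exact: leq_maxl.
- by apply: le_trans hhB; exact: ler_wpM2l.
- by apply: le_trans hhC; apply: ler_wpM2l => //; exact: hitting_const_ge0.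
Qed.

Lemma elapsed_mesh theta m k : 0 < theta -> let h := mesh theta m in
  theta * surv G avoid h (k.+1 * 2 ^ m) <=
    elapsed G avoid h (k.+1 * 2 ^ m) - elapsed G avoid h (k * 2 ^ m) <=
  theta * surv G avoid h (k * 2 ^ m).
Proof.
move=> th0 /=; have := elapsed_block (k * 2 ^ m) (2 ^ m) (ltW (mesh_gt0 m th0)).
by have := mesh_mul theta m 1; rewrite mul1n mul1r -mulSnr => ->.
Qed.

Lemma Etau_le : (Etau G i <= (f #|A|)%:E)%E.
Proof.
have fA := f_ge0 AN.
apply/lee_addgt0Pr => eps e0; rewrite -EFinD.
pose delta := Num.min (1 / 2) (eps / (2 * f #|A| + 1)).
have d0 : 0 < delta by rewrite lt_min !divr_gt0//; lra.
have d1 : delta <= 1 / 2 by rewrite ge_min lexx.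
have d2 : delta * (2 * f #|A| + 1) <= eps.
  by rewrite -ler_pdivlMr ?ge_min ?lexx ?orbT//; lra.
have [h h0 [hB hC]] := fine_mesh d0.
apply: (@integral_survive_le _ (fun=> h) _ h) => //.
- by move=> k; exact: ltW.
- exact: measurable_tau.
- exact: tau_ge0.
- move=> K w K0 hK; rewrite sumr_const card_ord -mulr_natl.
  by apply: tau_le => //; rewrite mulr_gt0 ?ltr0n.
- move=> x; exists (Num.truncn (x / h)).+1.
  by rewrite sumr_const card_ord -mulr_natl -ler_pdivrMr//; exact/ltW/truncnS_gt.
move=> K; rewrite -mulr_sumr -/(elapsed G avoid h K).
have := elapsed_le_double (ltW h0) hB K (le_trans hC d1).
have := elapsed_le (ltW h0) hB K.
have := elapsed_ge0 G avoid (ltW h0) K.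
set e := elapsed _ _ _ _ => e_ge0 he h2.
have h1 : (1 - delta) * e <= f #|A| by apply: le_trans he; apply: ler_wpM2r => //; lra.
have : delta * e <= delta * (2 * f #|A|) by apply: ler_wpM2l => //; exact: ltW.
lra.
Qed.

Lemma Etau_ge_layers theta K : 0 < theta ->
  ((theta * \sum_(k < K) pr P [set w | ((k.+1%:R * theta)%:E <= tau i w)%E])%:E
    <= Etau G i)%E.
Proof.
move=> th0.
pose S k := [set w : space G | ((k.+1%:R * theta)%:E <= tau i w)%E].
have mS k : measurable (S k) by exact: measurable_tau_ge.
have mF k : measurable_fun setT (fun w => (\1_(S k) w : R)%:E).
  by apply/measurable_EFinP; exact: measurable_indic.
have -> : (theta * \sum_(k < K) pr P (S k))%:E =
    (\int[P]_w (theta%:E * \sum_(k < K) (\1_(S k) w)%:E))%E.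
  rewrite ge0_integralZl//; last 3 first.
  - exact: emeasurable_sum.
  - by move=> w _; apply: sume_ge0.
  - by rewrite lee_fin ltW.
  rewrite ge0_integral_sum// EFinM -sumEFin; congr (_ * _)%E.
  by apply: eq_bigr => k _; rewrite integral_indic// setIT; apply/esym; exact: prE.
apply: ge0_le_integral => //.
- by move=> w _; apply: mule_ge0; [rewrite lee_fin ltW|apply: sume_ge0].
- by apply: measurable_funeM; exact: emeasurable_sum.
- exact: measurable_tau.
move=> w _.
rewrite sumEFin -EFinM.
elim: K => [|K IH]; first by rewrite big_ord0 mulr0 tau_ge0.
rewrite big_ord_recr /= indicE; have [SK|_] := boolP (w \in S K); last by rewrite addr0.
apply: le_trans (set_mem SK); rewrite lee_fin mulrC ler_pM2r// -natr1 lerD2r.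
rewrite -[leRHS]mulr1 -[X in X%:R * _](card_ord K) mulr_natl -sumr_const.
by apply: ler_sum => k _; rewrite indicE; case: (_ \in _).
Qed.

(** On a fixed coarse grid of step [theta] the elapsed time is nearly a sum of survival
    probabilities. As the fine mesh shrinks these are bounded by tails of [tau], and
    [Etau_ge_layers] bounds the sum of tails by the mean. *)
Lemma Etau_ge : ((f #|A|)%:E <= Etau G i)%E.
Proof.
have fA := f_ge0 AN; have M0 := hitting_time_bound_ge0; have C0 := hitting_const_ge0.
apply/lee_addgt0Pr => eps e0.
(* The five shares of [eps]: the first coarse block, the survivors at the horizon, the passage from
   grid survival to [tau], and two for the mesh error [delta * (2 * f #|A|)]. *)
pose theta := eps / 5.
have th0 : 0 < theta by rewrite divr_gt0.
(* As in Markov's inequality, survival up to the horizon has probability at most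
   [2 * f #|A| / (K.+1%:R * theta)], and [f] is at most [M] there. *)
have [K hK] : exists K : nat, 2 * f #|A| * M / (K.+1%:R * theta) <= eps / 5.
  exists (Num.truncn (2 * f #|A| * M / (theta * theta))).
  rewrite ler_pdivrMr ?mulr_gt0 ?ltr0n// -/theta mulrCA -ler_pdivrMr ?mulr_gt0//.
  exact/ltW/truncnS_gt.
pose e1 := eps / 5 / (K.+1%:R * theta).
have e10 : 0 < e1 by rewrite !divr_gt0// ?mulr_gt0// ltr0n.
pose delta := Num.min (1 / 2) (eps / 5 / (f #|A| + 1)).
have d0 : 0 < delta by rewrite lt_min !divr_gt0//; lra.
have d1 : delta <= 1 / 2 by rewrite ge_min lexx.
have d2 : delta * (f #|A| + 1) <= eps / 5.
  by rewrite -ler_pdivlMr ?ge_min ?lexx ?orbT//; lra.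
have [m [hB hC hm0]] := block_mesh K.+1 th0 d0 e10.
set h := mesh theta m in hB hC hm0; have h0 : 0 < h by exact: mesh_gt0.
pose v k := surv G avoid h (k * 2 ^ m).
pose I k := elapsed G avoid h (k * 2 ^ m).
have step k : theta * v k.+1 <= I k.+1 - I k <= theta * v k by exact: elapsed_mesh.
have vle k l : (k <= l)%N -> v l <= v k.
  by move=> kl; apply: surv_le; [exact: ltW|rewrite leq_mul2r kl orbT].
have v_ge0 k : 0 <= v k by exact: surv_ge0.
have I_ge0 k : 0 <= I k by apply: elapsed_ge0; exact: ltW.
have I0 : I 0%N = 0 by rewrite /I mul0n /elapsed big_ord0 mulr0.
have I_v k : k%:R * theta * v k <= I k.
  elim: k => [|k IH]; first by rewrite I0 !mul0r.
  have /andP[s1 _] := step k.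
  have := ler_wpM2l (mulr_ge0 (ler0n R k) (ltW th0)) (vle k k.+1 (leqnSn _)).
  by rewrite -natr1; lra.
have I_sum k : I k.+1 <= theta + theta * \sum_(l < k) v l.+1.
  elim: k => [|k IH].
    have /andP[_] := step 0%N; rewrite I0 subr0 big_ord0 mulr0 addr0 => h1.
    apply: le_trans h1 _; rewrite -[leRHS]mulr1 ler_wpM2l ?(ltW th0)//.
    by apply: surv_le1; exact: ltW.
  by have /andP[_] := step k.+1; rewrite big_ord_recr /= mulrDr; lra.
have he := hitting_elapsed (ltW h0) hB (K.+1 * 2 ^ m).
rewrite -/(I K.+1) in he.
have I2 : I K.+1 <= 2 * f #|A| by apply: elapsed_le_double => //; [exact: ltW|exact: le_trans d1].
have expM : expct G avoid h f (K.+1 * 2 ^ m) <= M * v K.+1.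
  rewrite /v -expct_cst; last exact: ltW.
  apply: expct_le => // j jN _; apply: le_trans (ler_norm _) _; exact: hitting_time_bound.
have vK : M * v K.+1 <= eps / 5.
  apply: le_trans hK; rewrite ler_pdivlMr ?mulr_gt0 ?ltr0n// -mulrA mulrC.
  have := ler_wpM2l M0 (I_v K.+1); have := ler_wpM2l M0 I2; lra.
have CI : C * h * I K.+1 <= delta * (2 * f #|A|).
  apply: ler_pM => //; first by apply: mulr_ge0 => //; exact: ltW.
have lowI : f #|A| - 3 * (eps / 5) <= I K.+1.
  move: he; rewrite ler_norml => /andP[h1 _]; lra.
have lay := @Etau_ge_layers theta K th0.
suff hreal : f #|A| <= theta * (\sum_(k < K) pr P [set w | ((k.+1%:R * theta)%:E <= tau i w)%E]) + eps.
  move: lay hreal; move: (theta * _) => x lay hreal.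
  apply: (@le_trans _ _ (x + eps)%:E); first by rewrite lee_fin.
  by rewrite EFinD; exact: leeD2r.
have vS : \sum_(k < K) v k.+1 <=
    \sum_(k < K) pr P [set w | ((k.+1%:R * theta)%:E <= tau i w)%E] + K.+1%:R * e1.
  apply: (@le_trans _ _ (\sum_(k < K) (pr P [set w | ((k.+1%:R * theta)%:E <= tau i w)%E] + e1))).
    by apply: ler_sum => k _; apply: hm0; exact/leqW/ltn_ord.
  rewrite big_split /= lerD2l sumr_const card_ord -[leLHS]mulr_natl.
  by apply: ler_wpM2r; [exact: ltW|rewrite ler_nat].
have th1 : theta * (K.+1%:R * e1) = eps / 5.
  rewrite /e1; field; rewrite (gt_eqF th0) /=.
  by rewrite gt_eqF// ltr0n.
have := ler_wpM2l (ltW th0) vS; have := I_sum K.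
by rewrite mulrDr th1 /theta; lra.
Qed.

Lemma Etau_eq : Etau G i = (f #|A|)%:E.
Proof. by apply/eqP; rewrite eq_le Etau_le Etau_ge. Qed.

(** Discretises twice the identity that the integral of t P(tau > t) over time equals that of
    E[f(eta(t)); tau > t], the latter being controlled by [g] through Dynkin's formula. The weights
    [h ^+ 2 * (2 * k%:R + 1)] are the increments of the squared grid time. *)
Lemma Etau_sqr_le (g : nat -> R) : g i = 0 -> (forall m, (m <= N)%N -> 0 <= g m) ->
  (forall m, (m <= N)%N -> m != i -> L g m <= - 2 * f m) ->
  (\int[P]_w (tau i w * tau i w) <= (g #|A|)%:E)%E.
Proof.
move=> gi g0 Lg.
have fA := f_ge0 AN; have M0 := hitting_time_bound_ge0; have C0 := hitting_const_ge0.
have B0 : 0 <= B by exact: total_rate_ge0.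
have gA := g0 _ AN.
pose M' := \sum_(m < N.+1) g m.
have gM m : (m <= N)%N -> `|g m| <= M' by exact: norm_le_sum.
have M'0 : 0 <= M' by apply: le_trans (gM 0%N _).
pose C' := 4 * B ^+ 2 * M'.
have C'0 : 0 <= C' by rewrite /C' mulr_ge0// mulr_ge0// exprn_even_ge0.
apply/lee_addgt0Pr => eps e0; rewrite -EFinD.
pose D := C' * (2 * f #|A|) + g #|A|.
have D0 : 0 <= D by rewrite /D; apply: addr_ge0 => //; apply: mulr_ge0 => //; apply: mulr_ge0.
pose delta := Num.min (1 / 2) (eps / (4 * D + 1)).
have d0 : 0 < delta by rewrite lt_min !divr_gt0//; lra.
have d1 : delta <= 1 / 2 by rewrite ge_min lexx.
have d2 : delta * (4 * D + 1) <= eps.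
  by rewrite -ler_pdivlMr ?ge_min ?lexx ?orbT//; lra.
have [h' h'0 [h'B h'C]] := fine_mesh d0.
(* [fine_mesh] controls only the error constant [C] of [f]. For the constant [C'] of [g],
   [h <= delta] suffices, as [delta] is small against [D], which contains [C']. *)
pose h := Num.min h' delta.
have h0 : 0 < h by rewrite lt_min h'0.
have hle : h <= h' by rewrite ge_min lexx.
have hd : h <= delta by rewrite ge_min lexx orbT.
have hB : B * h <= 1 by apply: le_trans h'B; exact: ler_wpM2l.
have hC : C * h <= delta by apply: le_trans h'C; exact: ler_wpM2l.
have sq K : \sum_(k < K) (h ^+ 2 * (2 * k%:R + 1)) = (K%:R * h) * (K%:R * h).
  elim: K => [|K IH]; first by rewrite big_ord0 !mul0r.
  by rewrite big_ord_recr /= IH -natr1; ring.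
apply: (@integral_survive_le _ (fun k => h ^+ 2 * (2 * k%:R + 1)) _ h) => //.
- by move=> k; rewrite mulr_ge0 ?exprn_even_ge0// addr_ge0// mulr_ge0.
- by apply: emeasurable_funM; exact: measurable_tau.
- by move=> w; rewrite mule_ge0// tau_ge0.
- move=> K w K0 hK; rewrite sq EFinM.
  by apply: lee_pmul; rewrite ?tau_ge0//; apply: tau_le => //; rewrite mulr_gt0 ?ltr0n.
- move=> x; exists (Num.truncn (x / (h * h))).+1.
  rewrite sq; set K := (Num.truncn _).+1.
  apply: (@le_trans _ _ (K%:R * (h * h))).
    by rewrite -ler_pdivrMr ?mulr_gt0//; exact/ltW/truncnS_gt.
  rewrite mulrACA; apply: ler_wpM2r; first by rewrite mulr_ge0 // ltW.
  by rewrite -[leLHS]mulr1 ler_wpM2l// ler1n.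
move=> K.
pose u k := surv G avoid h k; pose e k := expct G avoid h f k.
have u0 k : 0 <= u k by exact: surv_ge0.
have e_ge0 k : 0 <= e k by exact: expct_hitting_ge0.
have bad m : ~~ avoid m -> f m = 0 by rewrite negbK => /eqP ->.
have badg m : ~~ avoid m -> g m = 0 by rewrite negbK => /eqP ->.
have estep k : (1 - delta) * h * u k <= e k - e k.+1.
  have := @expct_step _ _ _ _ _ G alpha_gt0 beta_gt0 n_gt1 avoid h (ltW h0) hB f M k
    hitting_time_bound bad.
  have -> : expct G avoid h (generator (rate alpha beta n false) alpha #|vpair n| f) k = - u k.
    rewrite -mulN1r /u -expct_cst; last exact: ltW.
    case: hf => _ _ Lf; apply/eqP; rewrite eq_le.
    by apply/andP; split; apply: expct_le => // m mN gm; rewrite Lf.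
  rewrite ler_norml => /andP[_]; rewrite -/(e k) -/(e k.+1) -/(u k).
  have -> : 4 * total_rate alpha beta n ^+ 2 * M * h ^+ 2 * u k = C * h * (h * u k).
    by rewrite /C /B; ring.
  have : C * h * (h * u k) <= delta * (h * u k) by apply: ler_wpM2r => //; rewrite mulr_ge0// ltW.
  lra.
(* Summation by parts of [estep]; the boundary term [k%:R * e k] has a favourable sign and is
   dropped in [hS]. *)
have abel k : \sum_(l < k) ((1 - delta) * h * (l%:R + 1) * u l) <= \sum_(l < k) e l - k%:R * e k.
  elim: k => [|k IH]; first by rewrite !big_ord0 mul0r subr0.
  rewrite !big_ord_recr /= -natr1.
  have := ler_wpM2l (addr_ge0 (ler0n R k) ler01) (estep k).
  lra.
have h1 : expct G avoid h g K - g #|A| -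
    h * \sum_(k < K) expct G avoid h (generator (rate alpha beta n false) alpha #|vpair n| g) k
    <= C' * h * elapsed G avoid h K.
  have := @expct_sum _ _ _ _ _ G alpha_gt0 beta_gt0 n_gt1 avoid h (ltW h0) hB g M' K gM badg.
  by rewrite ler_norml => /andP[].
have el2 : elapsed G avoid h K <= 2 * f #|A|.
  by apply: elapsed_le_double => //; [exact: ltW|exact: le_trans d1].
have eg : 0 <= expct G avoid h g K.
  by apply: sumr_ge0 => m _; apply: mulr_ge0; [apply: g0; have := ltn_ord m|exact: pr_ge0].
have Lge : \sum_(k < K)
    expct G avoid h (generator (rate alpha beta n false) alpha #|vpair n| g) k <=
  - 2 * \sum_(k < K) e k.
  rewrite mulr_sumr; apply: ler_sum => k _; rewrite /e -expctZ.
  by apply: expct_le => // m mN gm; exact: Lg.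
have eS : h * \sum_(k < K) (2 * e k) <= g #|A| + delta * (C' * (2 * f #|A|)).
  have := ler_wpM2l (ltW h0) Lge.
  have : C' * h * elapsed G avoid h K <= delta * (C' * (2 * f #|A|)).
    rewrite (mulrC C') -mulrA; apply: ler_pM => //; first exact: ltW.
      by rewrite mulr_ge0//; exact/elapsed_ge0/ltW.
    exact: ler_wpM2l.
  by rewrite -mulr_sumr; lra.
pose S := \sum_(k < K) (h ^+ 2 * (2 * k%:R + 1) * u k).
have S0 : 0 <= S.
  apply: sumr_ge0 => k _; apply: mulr_ge0 => //.
  by rewrite mulr_ge0 ?exprn_even_ge0// addr_ge0// mulr_ge0.
have hS : (1 - delta) * S <= h * \sum_(k < K) (2 * e k).
  have h2 : \sum_(l < K) ((1 - delta) * h * (l%:R + 1) * u l) <= \sum_(l < K) e l.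
    by apply: le_trans (abel K) _; rewrite lerBlDr lerDl mulr_ge0.
  have := ler_wpM2l (ltW h0) h2; rewrite -mulr_sumr.
  suff : (1 - delta) * S <= 2 * (h * \sum_(l < K) ((1 - delta) * h * (l%:R + 1) * u l)) by lra.
  rewrite /S !mulr_sumr; apply: ler_sum => k _.
  have : 0 <= (1 - delta) * (h * h) * u k.
    by apply: mulr_ge0 => //; apply: mulr_ge0; [lra|rewrite mulr_ge0// ltW].
  by rewrite expr2; lra.
rewrite -/S.
have hD : (1 - delta) * S <= g #|A| + delta * (C' * (2 * f #|A|)) by lra.
have S2 : S <= 2 * D.
  have q1 : 0 <= (1 / 2 - delta) * S by apply: mulr_ge0 => //; lra.
  have q2 : 0 <= (1 - delta) * (C' * (2 * f #|A|)).
    by apply: mulr_ge0; [lra|apply: mulr_ge0 => //; apply: mulr_ge0].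
  by rewrite /D; lra.
have : delta * S <= delta * (2 * D) by apply: ler_wpM2l => //; exact: ltW.
have : delta * (C' * (2 * f #|A|)) <= delta * D by apply: ler_wpM2l; [exact: ltW|rewrite /D; lra].
lra.
Qed.

End Equation.

End HittingTimeMoments.

Lemma expR_div1D_le (R : realType) (x : R) : 0 <= x -> expR (x / (1 + x)) <= 1 + x.
Proof.
move=> x0; have h := expR_ge1Dx (- (x / (1 + x))).
have x1 : 0 < 1 + x by lra.
have e : 1 - x / (1 + x) = (1 + x)^-1 by field; rewrite gt_eqF.
rewrite e expRN in h.
by rewrite -lef_pV2 ?posrE ?expR_gt0.
Qed.

(* Explicit and implicit Euler steps for [a' = - a], with [a] and [- a'] equal
   up to [eps]. *)
Lemma euler_exp (R : realType) (v a : nat -> R) (K : nat) (delta eps : R) :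
  0 < delta -> delta < 1 -> 0 <= eps -> a 0%N = 1 ->
  (forall k, delta * v k.+1 <= a k - a k.+1 <= delta * v k) ->
  (forall k, (k <= K)%N -> `|v k - a k| <= eps) ->
  expR (- (K%:R * delta) / (1 - delta)) - (K%:R * delta + 1) * eps <= v K /\
  v K <= expR (- (K%:R * delta) / (1 + delta)) + (K%:R * delta + 1) * eps.
Proof.
move=> d0 d1 e0 a0 step close.
have lo k : (k <= K)%N -> (1 - delta) ^+ k - k%:R * delta * eps <= a k.
  elim: k => [|k IH] kK; first by rewrite expr0 a0 !mul0r subr0.
  have := IH (ltnW kK); have := close _ (ltnW kK).
  have /andP[_ s2] := step k; rewrite ler_norml => /andP[_ c2] IHk.
  have h1 : (1 - delta) * ((1 - delta) ^+ k - k%:R * delta * eps) <= (1 - delta) * a k.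
    by apply: ler_wpM2l => //; lra.
  have h2 : delta * v k <= delta * (a k + eps) by apply: ler_wpM2l; lra.
  have h3 : 0 <= delta * (k%:R * delta * eps) by rewrite !mulr_ge0// ltW.
  by rewrite exprS -natr1; lra.
have up k : (k <= K)%N -> a k <= (1 + delta)^-1 ^+ k + k%:R * delta * eps.
  elim: k => [|k IH] kK; first by rewrite expr0 a0 !mul0r addr0.
  have := IH (ltnW kK); have := close _ kK.
  have /andP[s1 _] := step k; rewrite ler_norml => /andP[c1 _] IHk.
  have h2 : delta * (a k.+1 - eps) <= delta * v k.+1 by apply: ler_wpM2l; lra.
  have h3 : a k.+1 * (1 + delta) <= (1 + delta)^-1 ^+ k + k%:R * delta * eps + delta * eps by lra.
  rewrite exprSr -natr1 -(@ler_pM2r _ (1 + delta)); last lra.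
  apply: (le_trans h3).
  rewrite [leRHS]mulrDl -[X in _ <= X + _]mulrA mulVf ?mulr1; last by rewrite gt_eqF//; lra.
  have : 0 <= (k%:R + 1) * delta * eps * delta by rewrite !mulr_ge0 ?addr_ge0// ltW.
  by lra.
have := close K (leqnn K); rewrite ler_norml => /andP[c1 c2].
have := lo K (leqnn K); have := up K (leqnn K) => u l.
have pl : expR (- (K%:R * delta) / (1 - delta)) <= (1 - delta) ^+ K.
  have -> : - (K%:R * delta) / (1 - delta) = K%:R * (- (delta / (1 - delta))).
    by field; rewrite gt_eqF//; lra.
  rewrite expRM_natl lerXn2r ?nnegrE ?expR_ge0//; first lra.
  have x0 : 0 <= delta / (1 - delta) by rewrite divr_ge0//; lra.
  have := expR_ge1Dx (delta / (1 - delta)).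
  rewrite expRN => h; have h1 : 1 - delta = (1 + delta / (1 - delta))^-1.
    by field; rewrite gt_eqF//; lra.
  by rewrite [leRHS]h1 lef_pV2 ?posrE ?expR_gt0//; lra.
have pu : (1 + delta)^-1 ^+ K <= expR (- (K%:R * delta) / (1 + delta)).
  have -> : - (K%:R * delta) / (1 + delta) = K%:R * (- (delta / (1 + delta))).
    by field; rewrite gt_eqF//; lra.
  rewrite expRM_natl lerXn2r ?nnegrE ?expR_ge0//; first by rewrite invr_ge0; lra.
  by rewrite expRN lef_pV2 ?posrE ?expR_gt0 ?expR_div1D_le//; lra.
by split; lra.
Qed.

(** * Drift inequalities for the law of the edge count *)

Section Drift.
Context (R : realType) (alpha beta : R) (n : nat) (A : {set vpair n})
  (G : dynER alpha beta A).
Hypotheses (alpha_gt0 : 0 < alpha) (beta_gt0 : 0 < beta) (n_gt1 : (1 < n)%N).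

Let P := law G.
Let N := #|vpair n|.
Let B : R := total_rate alpha beta n.
Let L := generator (rate alpha beta n false) alpha N.

Lemma surv_predT h k : surv G xpredT h k = 1.
Proof. by rewrite /surv -(prT (law G)); congr pr; apply/seteqP; split. Qed.

(** A Gronwall argument on the grid without killing. The local error [C * h ^+ 2] is at most
    [eps * a * h], which raises the limiting value [b / a] by [eps]. *)
Lemma eta_drift (g : nat -> R) (a b t : R) : 0 < a -> 0 <= b -> 0 < t ->
  (forall m, (m <= N)%N -> 0 <= g m) ->
  (forall m, (m <= N)%N -> L g m <= - a * g m + b) ->
  \sum_(m < N.+1) g m * pr P [set w | eta t w = m] <= expR (- (a * t)) * g #|A| + b / a.
Proof.
move=> a0 b0 t0 g0 Lg.
have AN : (#|A| <= N)%N by exact: max_card.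
pose M := \sum_(m < N.+1) g m.
have gM m : (m <= N)%N -> `|g m| <= M by exact: norm_le_sum.
have M0 : 0 <= M by apply: le_trans (gM 0%N _).
pose C := 4 * B ^+ 2 * M.
have C0 : 0 <= C by rewrite /C mulr_ge0// mulr_ge0// exprn_even_ge0.
have B0 : 0 <= B by exact: total_rate_ge0.
apply/ler_addgt0Pr => eps e0.
pose h0 := Num.min (B + 1)^-1 (Num.min (a + 1)^-1 (eps * a / (C + 1))).
have h00 : 0 < h0.
  by rewrite !lt_min; apply/and3P; split; rewrite ?invr_gt0 ?divr_gt0 ?mulr_gt0//; lra.
have [m hm] := mesh_small t0 h00.
have {hm} := hm m (leqnn m); set h := mesh t m => hh0.
have h_gt0 : 0 < h by exact: mesh_gt0.
have hB : B * h <= 1.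
  apply: mul_le_of_le_div1D => //.
  by rewrite div1r; apply/ltW/(lt_le_trans hh0); rewrite ge_min lexx.
have ha : a * h <= 1.
  apply: mul_le_of_le_div1D => //; first exact: ltW.
  by rewrite div1r; apply/ltW/(lt_le_trans hh0); rewrite !ge_min lexx orbT.
have hC : C * h <= eps * a.
  apply: mul_le_of_le_div1D => //; first by rewrite mulr_ge0// ltW.
  by apply/ltW/(lt_le_trans hh0); rewrite !ge_min lexx !orbT.
pose E k := expct G xpredT h g k.
have rec k : E k <= (1 - a * h) ^+ k * g #|A| + (b + eps * a) / a.
  elim: k => [|k IH].
    rewrite /E expct0// expr0 mul1r lerDl.
    by apply: divr_ge0; [apply: addr_ge0 => //; apply: mulr_ge0|]; exact: ltW.
  have := @expct_step _ _ _ _ _ G alpha_gt0 beta_gt0 n_gt1 xpredT h (ltW h_gt0) hB g M k gM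
    (fun _ => ltac:(by [])).
  rewrite surv_predT -/(E k) -/(E k.+1) ler_norml => /andP[_ h1].
  have h2 : expct G xpredT h (generator (rate alpha beta n false) alpha #|vpair n| g) k <= - a * E k + b.
    have -> : - a * E k + b = expct G xpredT h (fun m => - a * g m + b) k.
      by rewrite expctD expctZ expct_cst ?ltW// surv_predT mulr1.
    by apply: expct_le => // j jN _; exact: Lg.
  have h3 := ler_wpM2l (ltW h_gt0) h2.
  have h4 : 4 * total_rate alpha beta n ^+ 2 * M * h ^+ 2 * 1 <= eps * a * h.
    by rewrite -/B -/C mulr1 expr2 mulrA ler_wpM2r// ltW.
  have h5 : (1 - a * h) * E k <= (1 - a * h) * ((1 - a * h) ^+ k * g #|A| + (b + eps * a) / a).
    by apply: ler_wpM2l => //; lra.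
  have h6 : a * h * ((b + eps * a) / a) = h * (b + eps * a) by field; rewrite gt_eqF.
  by rewrite exprS; lra.
have := rec (2 ^ m)%N.
have -> : E (2 ^ m)%N = \sum_(m < N.+1) g m * pr P [set w | eta t w = m].
  rewrite /E /expct; apply: eq_bigr => j _; congr (_ * pr _ _).
  have := mesh_mul t m 1; rewrite mul1n mul1r -/h => ->.
  by apply/seteqP; split => w // [].
move=> h1; apply: (le_trans h1); rewrite -addrA; apply: lerD; last first.
  by rewrite mulrDl mulfK// gt_eqF.
apply: ler_wpM2r; first exact: g0.
have -> : expR (- (a * t)) = expR (- (a * h)) ^+ (2 ^ m)%N.
  rewrite -expRM_natl; congr expR.
  by have := mesh_mul t m 1; rewrite mul1n mul1r -/h => <-; ring.
rewrite lerXn2r ?nnegrE ?expR_ge0//; first lra.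
by have := expR_ge1Dx (- (a * h)); lra.
Qed.

End Drift.

(** * Approximate exponential law of the hitting time *)

Section ExponentialLaw.
Context (R : realType) (alpha beta : R) (n : nat) (A : {set vpair n})
  (G : dynER alpha beta A) (i : nat).
Hypotheses (alpha_gt0 : 0 < alpha) (beta_gt0 : 0 < beta) (n_gt1 : (1 < n)%N).

Let P := law G.
Let N := #|vpair n|.
Let B : R := total_rate alpha beta n.
Let avoid : pred nat := fun m => m != i.

(** [x] is the time in units of the mean and [K] the number of Euler steps. The two bounds concern
    different events: grid survival contains [tau > x * f #|A|], whereas only its limit along
    refinements is contained in [tau >= x * f #|A|]. *)
Lemma tau_almost_exponential (f : nat -> R) (k0 K : nat) (x p dist F : R) :
  hitting_time (rate alpha beta n false) alpha N i f -> #|A| != i ->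
  0 < f #|A| -> 0 < x -> x < K%:R ->
  (forall m, (m <= N)%N -> (m <= k0)%N -> `|f #|A| - f m| <= dist) ->
  (forall m, (m <= N)%N -> f m <= F) ->
  (forall k, (0 < k)%N ->
    pr P [set w | (k0 < eta (k%:R * (x / K%:R * f #|A|)) w)%N] <= p) ->
  let eps := (x + 1) * ((dist + F * p) / f #|A|) in
  expR (- x / (1 - x / K%:R)) - eps <= pr P [set w | ((x * f #|A|)%:E <= tau i w)%E] /\
  pr P [set w | ((x * f #|A|)%:E < tau i w)%E] <= expR (- x / (1 + x / K%:R)) + eps.
Proof.
move=> hf Ai fA x0 xK hdist hF hp eps.
set M0 := f #|A| in fA hdist hp eps *.
have AN : (#|A| <= N)%N by exact: max_card.
have f_ge0 m : (m <= N)%N -> 0 <= f m by case: hf => _ + _; exact.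
pose C := 4 * B ^+ 2 * \sum_(m < N.+1) f m.
have C0 : 0 <= C by exact: hitting_const_ge0 hf.
have K0 : 0 < K%:R :> R by exact: lt_trans xK.
pose delta := x / K%:R.
have d0 : 0 < delta by rewrite divr_gt0.
have d1 : delta < 1 by rewrite ltr_pdivrMr// mul1r.
have Kd : K%:R * delta = x by rewrite /delta mulrCA mulfV ?mulr1// gt_eqF.
pose theta := delta * M0.
have th0 : 0 < theta by rewrite mulr_gt0.
have Kth : K%:R * theta = x * M0 by rewrite /theta mulrA Kd.
have p0 : 0 <= p by apply: le_trans (hp 1%N isT); exact: pr_ge0.
have F0 : 0 <= F by apply: le_trans (hF _ AN); exact: ltW.
have dist0 : 0 <= dist by apply: le_trans (hdist 0%N _ _).
have dFp0 : 0 <= dist + F * p by rewrite addr_ge0// mulr_ge0.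
suff main e1 : 0 < e1 ->
    expR (- x / (1 - delta)) - eps <= pr P [set w | ((x * M0)%:E <= tau i w)%E] + e1 /\
    pr P [set w | ((x * M0)%:E < tau i w)%E] <= expR (- x / (1 + delta)) + eps + e1.
  by split; apply/ler_addgt0Pr => e1 /main[].
move=> e10.
pose eh := Num.min (1 / 2) (e1 / (4 * (x + 1))).
have eh0 : 0 < eh by rewrite lt_min !divr_gt0// mulr_gt0//; lra.
have eh1 : eh <= 1 / 2 by rewrite ge_min lexx.
have eh2 : eh * (4 * (x + 1)) <= e1.
  by rewrite -ler_pdivlMr ?ge_min ?lexx ?orbT// mulr_gt0//; lra.
have e120 : 0 < e1 / 2 by rewrite divr_gt0.
have [m [hB hC hm0]] := block_mesh G alpha_gt0 beta_gt0 n_gt1 hf K th0 eh0 e120.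
set h := mesh theta m in hB hC hm0; have h0 : 0 < h by exact: mesh_gt0.
pose v k := surv G avoid h (k * 2 ^ m).
pose I k := elapsed G avoid h (k * 2 ^ m).
have step k : theta * v k.+1 <= I k.+1 - I k <= theta * v k by exact: elapsed_mesh.
have I_ge0 k : 0 <= I k by apply: elapsed_ge0; exact: ltW.
have I0 : I 0%N = 0 by rewrite /I mul0n /elapsed big_ord0 mulr0.
have I2 k : I k <= 2 * M0.
  by apply: (elapsed_le_double _ alpha_gt0 beta_gt0 n_gt1 Ai hf (ltW h0) hB); exact: le_trans eh1.
(* The mean of [f] over survivors is [M0 - I k] up to the mesh error. Replacing [f] by the constant
   [M0] in it costs [dist] at levels up to [k0] and [F * p] at higher ones. *)
have vI k : `|v k - (1 - I k / M0)| <= (dist + F * p) / M0 + 2 * eh.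
  case: k => [|k].
    rewrite I0 mul0r subr0 /v mul0n surv0 subrr normr0.
    by rewrite addr_ge0 ?divr_ge0 ?mulr_ge0 // ltW.
  have he := hitting_elapsed G alpha_gt0 beta_gt0 n_gt1 Ai hf (ltW h0) hB (k.+1 * 2 ^ m).
  have hd : `|M0 * v k.+1 - expct G avoid h f (k.+1 * 2 ^ m)| <= dist + F * p.
    rewrite /v -expct_cst; last exact: ltW.
    rewrite /expct -sumrB; apply: (le_trans (ler_norm_sum _ _ _)).
    pose t := (k.+1 * 2 ^ m)%:R * h.
    have tE : t = k.+1%:R * (x / K%:R * M0) by rewrite /t /h mesh_mul.
    have met j : measurable [set w : space G | eta t w = j] by exact: measurable_eta.
    have msv := @measurable_survive _ _ _ _ _ G avoid h (k.+1 * 2 ^ m) (ltW h0).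
    apply: (@le_trans _ _ (\sum_(j < N.+1) (dist * pr P (setT `&` [set w | eta t w = j])
        + F * pr P ([set w | (k0 < eta t w)%N] `&` [set w | eta t w = j])))).
      apply: ler_sum => j _; rewrite -mulrBl normrM (ger0_norm (pr_ge0 _ _)) setTI.
      have jN : (j <= N)%N by have := ltn_ord j.
      have sub : pr P (survive avoid h (k.+1 * 2 ^ m) `&` [set w | eta t w = j]) <=
          pr P [set w | eta t w = j].
        by apply: pr_le => //; exact: measurableI.
      have [jk|jk] := leqP j k0.
        have := hdist j jN jk => hdj.
        apply: (@le_trans _ _ (dist * pr P [set w | eta t w = j])).
          by apply: ler_pM => //; exact: pr_ge0.
        by rewrite lerDl mulr_ge0// pr_ge0.
      have -> : [set w : space G | (k0 < eta t w)%N] `&` [set w | eta t w = j] =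
          [set w | eta t w = j].
        by apply/seteqP; split => w /=; [move=> []|move=> ->].
      apply: (@le_trans _ _ (F * pr P [set w | eta t w = j])).
        apply: ler_pM => //; first exact: pr_ge0.
        have := hF j jN; have := f_ge0 j jN; have := hF _ AN; rewrite -/M0 ler_norml; lra.
      by rewrite lerDr mulr_ge0// pr_ge0.
    rewrite big_split /= -!mulr_sumr.
    have mk : measurable [set w : space G | (k0 < eta t w)%N].
      by have [] := @full_history_eta _ _ _ _ _ G t t (fun j => (k0 < j)%N) (lexx _).
    rewrite -(pr_partition_nat P measurableT met (eta_le t)).
    rewrite -(pr_partition_nat P mk met (eta_le t)) prT mulr1 lerD2l.
    by apply: ler_wpM2l => //; rewrite tE; exact: hp.
  have CI : C * h * I k.+1 <= eh * (2 * M0).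
    by apply: ler_pM => //; apply: mulr_ge0 => //; exact: ltW.
  have -> : v k.+1 - (1 - I k.+1 / M0) = (M0 * v k.+1 - M0 + I k.+1) / M0.
    by field; rewrite gt_eqF.
  have -> : (dist + F * p) / M0 + 2 * eh = (dist + F * p + eh * (2 * M0)) / M0.
    by field; rewrite gt_eqF.
  rewrite normrM (ger0_norm (x := M0^-1)) ?invr_ge0 ?(ltW fA)//.
  apply: ler_wpM2r; first by rewrite invr_ge0 ltW.
  have -> : M0 * v k.+1 - M0 + I k.+1 = (M0 * v k.+1 - expct G avoid h f (k.+1 * 2 ^ m)) +
    (expct G avoid h f (k.+1 * 2 ^ m) - M0 + I k.+1) by ring.
  apply: le_trans (ler_normD _ _) _; apply: lerD => //.
  exact: le_trans he CI.
have euler := @euler_exp _ v (fun k => 1 - I k / M0) K delta ((dist + F * p) / M0 + 2 * eh).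
have {euler} : expR (- x / (1 - delta)) - (x + 1) * ((dist + F * p) / M0 + 2 * eh) <= v K /\
    v K <= expR (- x / (1 + delta)) + (x + 1) * ((dist + F * p) / M0 + 2 * eh).
  rewrite -Kd; apply: euler => //.
  - by rewrite addr_ge0 ?divr_ge0 ?mulr_ge0 // ltW.
  - by rewrite I0 mul0r subr0.
  - move=> k; have -> : 1 - I k / M0 - (1 - I k.+1 / M0) = (I k.+1 - I k) / M0.
      by field; rewrite gt_eqF.
    have /andP[s1 s2] := step k.
    rewrite ler_pdivlMr// ler_pdivrMr// mulrAC -/theta s1 /=.
    by rewrite mulrAC -/theta.
have e2 : (x + 1) * (2 * eh) <= e1 / 2 by lra.
move=> [lo up]; rewrite /eps; split.
  have := hm0 K (leqnn K); rewrite Kth -/(v K).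
  by move: lo; rewrite mulrDr; lra.
apply: (@le_trans _ _ (v K)).
  apply: pr_le.
  - exact: measurable_tau_gt.
  - by apply: measurable_survive; exact: ltW.
  by move=> w /=; rewrite -Kth -(mesh_mul theta m); exact: tau_gt_survive.
by apply: (le_trans up); rewrite mulrDr; lra.
Qed.

End ExponentialLaw.

(** * Hitting times of birth-death chains *)

Lemma card_vpair n : #|vpair n| = 'C(n, 2).
Proof.
rewrite /vpair card_sig -[in RHS](card_ord n) -card_draws cardsE.
by apply: eq_card => x; rewrite !inE.
Qed.

Lemma card_vpair_natr (R : realType) n : (0 < n)%N ->
  #|vpair n|%:R = n%:R * (n%:R - 1) / 2 :> R.
Proof.
move=> n0; have : (2 * 'C(n, 2))%:R = (n * n.-1)%:R :> R.
  by congr (_%:R); have := mul_bin_diag n 1; rewrite bin1 => ->.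
by rewrite card_vpair !natrM -subn1 natrB// => h; lra.
Qed.

(** The factors [n%:R - 1] cancel, so the birth rate of the empty graph is exactly linear in [n]. *)
Lemma vpair_rate (R : realType) (beta : R) n : (1 < n)%N ->
  #|vpair n|%:R * (beta / (n%:R - 1)) = n%:R * beta / 2.
Proof.
move=> n1; have n0 : n%:R - 1 != 0 :> R by rewrite subr_eq0 pnatr_eq1; lia.
by rewrite card_vpair_natr ?(ltnW n1)//; field.
Qed.

Lemma closest_integer_dist (R : realType) (x : R) (k : int) :
  closest_integer x k -> `|x - k%:~R| <= 1 / 2.
Proof.
move=> /(_ (Num.floor (x + 1 / 2))) h; apply: (le_trans h).
have := floor_le_tmp (x + 1 / 2); have := floorD1_gt (x + 1 / 2).
by rewrite intrD ler_norml; lra.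
Qed.

Section BirthDeath.
Context (R : realType) (b d : R) (N : nat).
Hypotheses (b0 : 0 < b) (d0 : 0 < d).

Let lam k : R := (N - k)%:R * b.
Let mu k : R := k%:R * d.

Lemma lam_gt0 k : (k < N)%N -> 0 < lam k.
Proof. by move=> kN; rewrite mulr_gt0// ltr0n subn_gt0. Qed.

Lemma lam_ge0 k : 0 <= lam k.
Proof. by rewrite mulr_ge0// ltW. Qed.

Lemma mu_ge0 k : 0 <= mu k.
Proof. by rewrite mulr_ge0// ltW. Qed.

(* Expected time to go from [k] to [k + 1]. *)
Fixpoint step_time (k : nat) : R :=
  if k is k'.+1 then (1 + mu k * step_time k') / lam k else (lam 0)^-1.

Lemma step_time_ge0 k : 0 <= step_time k.
Proof.
elim: k => [|k IH] /=; first by rewrite invr_ge0 lam_ge0.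
by rewrite divr_ge0 ?lam_ge0// addr_ge0// mulr_ge0// mu_ge0.
Qed.

Lemma step_timeE k : (k < N)%N -> lam k * step_time k = 1 + mu k * step_time k.-1.
Proof.
move=> kN; have l0 := lam_gt0 kN; case: k kN l0 => [|k] kN l0 /=.
  by rewrite /mu mul0r mul0r addr0 mulfV// gt_eqF.
by rewrite mulrCA mulfV ?mulr1// gt_eqF.
Qed.

Definition climb_time (i j : nat) : R := \sum_(j <= k < i) step_time k.

Lemma climb_time_ge0 i j : 0 <= climb_time i j.
Proof. by rewrite sumr_ge0// => k _; exact: step_time_ge0. Qed.

Lemma climb_timeS i j : (j < i)%N -> climb_time i j = step_time j + climb_time i j.+1.
Proof. by move=> ji; rewrite /climb_time big_ltn. Qed.

Lemma climb_time_diag i : climb_time i i = 0.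
Proof. by rewrite /climb_time big_geq. Qed.

(* Above [i] the equation is solved from the top [N] downwards. *)
Lemma descent_solution (i : nat) (s : nat -> R) : (forall k, 0 <= s k) ->
  exists g : nat -> R, [/\ g i = 0, forall k, (i < k)%N -> 0 <= g k,
    forall k, (i < k <= N)%N -> generator b d N g k = - s k &
    (forall k, (i < k <= N)%N -> s k <= mu k - lam k) ->
    forall k, (i < k <= N)%N -> g k <= k%:R].
Proof.
move=> s0.
pose e := fix e (l : nat) : R := if l is l'.+1 then
  (s (N - l)%N + lam (N - l) * e l') / mu (N - l) else s N / mu N.
have e0 l : 0 <= e l.
  elim: l => [|l IH] /=; first by rewrite divr_ge0// mu_ge0.
  by rewrite divr_ge0 ?mu_ge0// addr_ge0// mulr_ge0// lam_ge0.
pose D k := e (N - k)%N.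
have DE k : (0 < k <= N)%N -> mu k * D k = s k + lam k * D k.+1.
  move=> /andP[k0 kN]; have m0 : mu k != 0 by rewrite gt_eqF// mulr_gt0// ltr0n.
  rewrite /D; move: kN; rewrite leq_eqVlt => /orP[/eqP kN|kN].
    rewrite kN in m0 *; rewrite subnn /= /lam subnn !mul0r addr0.
    by rewrite mulrCA mulfV ?mulr1.
  rewrite -(subnSK kN) /= subnSK// subKn ?(ltnW kN)//.
  by rewrite mulrCA mulfV ?mulr1.
exists (fun k => \sum_(i.+1 <= l < k.+1) D l); split.
- by rewrite big_geq.
- by move=> k _; rewrite sumr_ge0// => l _; exact: e0.
- move=> k /andP[ik kN]; rewrite /generator.
  have k0 : (0 < k)%N by exact: leq_ltn_trans ik.
  rewrite (big_nat_recr k.+1) /=; last by apply: ltnW.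
  have -> : \sum_(i.+1 <= l < k.-1.+1) D l - \sum_(i.+1 <= l < k.+1) D l = - D k.
    by rewrite prednK// (big_nat_recr k) //= opprD addrA subrr add0r.
  have := DE k; rewrite k0 kN => /(_ isT); rewrite /mu /lam => h.
  by rewrite addrAC subrr add0r mulrN h; ring.
- move=> hs.
  (* [D] is the increment of the solution. If the increment above is at most 1, then
     [mu * D <= s + lam <= mu], so the bound 1 propagates downwards from [N]. *)
  have D1 l : (l < N - i)%N -> D (N - l)%N <= 1.
    elim: l => [|l IH] lN.
      have N0 : (0 < N)%N by lia.
      have := DE N; rewrite N0 leqnn => /(_ isT).
      have m0 : 0 < mu N by rewrite mulr_gt0// ltr0n.
      have := hs N; rewrite leqnn andbT (_ : (i < N)%N); last by lia.
      rewrite subn0 /lam subnn !mul0r addr0 subr0 => /(_ isT) h1 h2.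
      by rewrite -(ler_pM2l m0) h2 mulr1.
    have kN : (0 < N - l.+1 <= N)%N by lia.
    have := DE _ kN; rewrite -subSn; last by lia.
    rewrite subSS => h2.
    have m0 : 0 < mu (N - l.+1) by rewrite mulr_gt0// ltr0n; case/andP: kN.
    have h1 : s (N - l.+1)%N <= mu (N - l.+1) - lam (N - l.+1) by apply: hs; lia.
    have h3 : D (N - l)%N <= 1 by apply: IH; lia.
    rewrite -(ler_pM2l m0) h2 mulr1.
    have := ler_wpM2l (lam_ge0 (N - l.+1)) h3; lra.
  move=> k /andP[ik kN].
  apply: (@le_trans _ _ (\sum_(i.+1 <= l < k.+1) 1)).
    rewrite big_nat_cond [leRHS]big_nat_cond; apply: ler_sum => l /andP[/andP[il lk] _].
    by have := D1 (N - l)%N; rewrite subKn; [apply; lia|lia].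
  by rewrite sumr_const_nat ler_nat; lia.
Qed.

(** The climbing sums up to [i] are glued to a solution above [i]: at [k != i] the equation involves
    only levels on one side of [i], and [i] itself, where both pieces vanish. The linear bound
    serves levels above equilibrium. *)
Lemma hitting_time_exists i : (i <= N)%N -> exists f : nat -> R,
  [/\ hitting_time b d N i f, forall j, (j <= i)%N -> f j = climb_time i j &
    (forall k, (i < k <= N)%N -> 1 <= mu k - lam k) ->
    forall k, (i < k <= N)%N -> f k <= k%:R].
Proof.
move=> iN.
have [g [gi g0 Lg gk]] := @descent_solution i (fun=> 1) (fun=> ler01).
pose f k := if (k <= i)%N then climb_time i k else g k.
have fle k : (k <= i)%N -> f k = climb_time i k by rewrite /f => ->.
have fge k : (i <= k)%N -> f k = g k.
  rewrite leq_eqVlt => /orP[/eqP <-|ik]; first by rewrite fle// climb_time_diag gi.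
  by rewrite /f leqNgt ik.
exists f; split => //; last first.
  by move=> h k ik; rewrite fge; [exact: gk|case/andP: ik => /ltnW].
split; first by rewrite fle// climb_time_diag.
  move=> k _; have [ki|ik] := leqP k i; first by rewrite fle// climb_time_ge0.
  by rewrite fge ?g0// ltnW.
move=> k kN ki; have [ik|{}ki|ik] := ltngtP i k; last by rewrite ik eqxx in ki.
  rewrite -(Lg k) ?ik// /generator !fge ?(ltnW ik)//; last exact: leqW (ltnW ik).
  by case: k ik {kN ki} => // k; rewrite ltnS.
rewrite /generator !fle//; [|exact: leq_trans (leq_pred _) (ltnW ki)|exact: ltnW].
have := step_timeE (leq_trans ki iN); rewrite /lam /mu (climb_timeS ki) => h.
case: k h ki {kN} => [|k] h ki.
  by rewrite !mul0r addr0; move: h; rewrite /= !mul0r addr0; lra.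
by rewrite [k.+1.-1]/= (climb_timeS (ltnW ki)) (climb_timeS ki); move: h; rewrite [k.+1.-1]/=; lra.
Qed.

(* Below [i] the function [f ^+ 2 + c * f] is a supersolution, because the step
   variances are at most [c]. *)
Lemma second_moment_exists i (f : nat -> R) c : (i <= N)%N -> 0 <= c ->
  hitting_time b d N i f -> (forall j, (j <= i)%N -> f j = climb_time i j) ->
  (forall k, (k < i)%N -> lam k * step_time k ^+ 2 + mu k * step_time k.-1 ^+ 2 <= c) ->
  exists g : nat -> R, [/\ g i = 0, forall m, (m <= N)%N -> 0 <= g m,
    forall m, (m <= N)%N -> m != i -> generator b d N g m <= - 2 * f m &
    forall j, (j <= i)%N -> g j = f j ^+ 2 + c * f j].
Proof.
move=> iN c0 [fi f0 Lf] fclimb hc.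
have [g [gi g0 Lg _]] := @descent_solution i (fun k => 2 * `|f k|) (fun k => ltac:(by rewrite mulr_ge0)).
pose G k := if (k <= i)%N then f k ^+ 2 + c * f k else g k.
have Gle k : (k <= i)%N -> G k = f k ^+ 2 + c * f k by rewrite /G => ->.
have Gge k : (i <= k)%N -> G k = g k.
  rewrite leq_eqVlt => /orP[/eqP <-|ik]; first by rewrite Gle// fi gi expr0n /= mulr0 addr0.
  by rewrite /G leqNgt ik.
exists G; split => //.
- by rewrite Gge.
- move=> m mN; have [mi|im] := leqP m i.
    by rewrite Gle// addr_ge0// ?sqr_ge0// mulr_ge0// f0.
  by rewrite Gge ?g0// ltnW.
move=> k kN ki; have [ik|{}ki|ik] := ltngtP i k; last by rewrite ik eqxx in ki.
  have -> : generator b d N G k = generator b d N g k.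
    rewrite /generator !Gge ?(ltnW ik)//; last exact: leqW (ltnW ik).
    by case: k ik {kN ki} => // k; rewrite ltnS.
  by rewrite Lg ?ik// ger0_norm ?f0// mulNr.
have h1 := Lf k kN; have {h1} h1 := h1 (ltac:(by rewrite ltn_eqF)).
have h2 := hc k ki.
rewrite /generator !Gle//; [|exact: leq_trans (leq_pred _) (ltnW ki)|exact: ltnW].
have e1 : f k.+1 = f k - step_time k.
  by rewrite !fclimb// ?(ltnW ki)// (climb_timeS ki) addrAC subrr add0r.
move: h1 h2; rewrite /generator /lam /mu; case: k kN ki e1 => [|k] kN ki e1.
  rewrite e1 !mul0r !addr0.
  set x := (N - 0)%:R * b; set F := f 0; set m1 := step_time 0 => h1 h2.
  have -> : x * ((F - m1) ^+ 2 + c * (F - m1) - (F ^+ 2 + c * F)) =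
    (2 * F + c) * (x * (F - m1 - F)) + x * m1 ^+ 2 by ring.
  by rewrite h1; lra.
have e2 : f k = f k.+1 + step_time k.
  by rewrite !fclimb// ?(ltnW (ltnW ki))// ?(ltnW ki)// (climb_timeS (ltnW ki)) addrC.
rewrite [k.+1.-1]/= e1 e2.
set x := (N - k.+1)%:R * b; set y := k.+1%:R * d; set F := f k.+1.
set m1 := step_time k.+1; set m0 := step_time k.
move=> h1 h2.
have -> : x * ((F - m1) ^+ 2 + c * (F - m1) - (F ^+ 2 + c * F)) +
   y * ((F + m0) ^+ 2 + c * (F + m0) - (F ^+ 2 + c * F)) =
   (2 * F + c) * (x * (F - m1 - F) + y * (F + m0 - F)) + (x * m1 ^+ 2 + y * m0 ^+ 2) by ring.
by rewrite h1; lra.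
Qed.

Let drift k : R := lam k - mu k.

Lemma driftS k : (k < N)%N -> drift k.+1 = drift k - (b + d).
Proof.
move=> kN; rewrite /drift /lam /mu subnS -natr1.
have -> : (N - k).-1%:R = (N - k)%:R - 1 :> R.
  by rewrite -subn1 natrB// subn_gt0.
ring.
Qed.

Lemma drift_le k l : (k <= l <= N)%N -> drift l <= drift k.
Proof.
move=> /andP[kl lN]; elim: l kl lN => [|l IH]; first by rewrite leqn0 => /eqP ->.
rewrite leq_eqVlt => /orP[/eqP ->//|]; rewrite ltnS => kl lN.
by rewrite driftS//; have := IH kl (ltnW lN); have := b0; have := d0; lra.
Qed.

(** With [lam = drift + mu], the inverse drift is the fixed point of the recursion with frozen
    rates. It stays an upper bound because the drift decreases in [k]. *)
Lemma step_time_le k : (k < N)%N -> 0 < drift k -> step_time k <= (drift k)^-1.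
Proof.
elim: k => [|k IH] kN hd.
  by rewrite /= /drift /mu mul0r subr0.
have hd' : 0 < drift k by have := driftS (ltnW kN); have := b0; have := d0; lra.
have h := IH (ltnW kN) hd'.
have l0 := lam_gt0 kN.
rewrite -(ler_pM2l l0) (step_timeE kN) /=.
have h1 : step_time k <= (drift k.+1)^-1.
  apply: (le_trans h); rewrite lef_pV2 ?posrE//.
  by apply: drift_le; rewrite leqnSn ltnW.
have := ler_wpM2l (mu_ge0 k.+1) h1.
have -> : lam k.+1 = drift k.+1 + mu k.+1 by rewrite /drift subrK.
by rewrite mulrDl mulfV ?gt_eqF// lerD2l.
Qed.

(** The inverse drift alone lags behind as the drift falls by [b + d] per step; the slack [s] pays
    for this, and the condition on [mu k] is stated at [i], where the drift is smallest. *)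
Lemma step_time_ge s i : (i <= N)%N -> 0 < s -> 0 <= drift i ->
  (forall k, (k < i)%N -> mu k * (b + d) <= s * (drift i + s)) ->
  forall k, (k < i)%N -> (drift k + s)^-1 <= step_time k.
Proof.
move=> iN s0 di hs.
have pos k : (k <= i)%N -> 0 < drift k + s /\ drift i + s <= drift k + s.
  by move=> ki; have := @drift_le k i; rewrite ki iN => /(_ isT); lra.
elim=> [|k IH] ki.
  have [p _] := pos 0%N (ltnW ki).
  rewrite /= lef_pV2 ?posrE//; last by apply: lam_gt0; exact: leq_trans iN.
  by rewrite /drift /mu mul0r; lra.
have kN : (k.+1 < N)%N by exact: leq_trans iN.
have [p _] := pos _ (ltnW ki); have [p' q'] := pos _ (ltnW (ltnW ki)).
have l0 := lam_gt0 kN.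
rewrite -(ler_pM2l l0) (step_timeE kN) /=.
have h := ler_wpM2l (mu_ge0 k.+1) (IH (ltnW ki)).
apply: (@le_trans _ _ (1 + mu k.+1 / (drift k + s))); last by rewrite lerD2l.
have -> : lam k.+1 = (drift k.+1 + s) + mu k.+1 - s by rewrite /drift; ring.
have e : drift k + s = drift k.+1 + s + (b + d) by rewrite (driftS (ltnW kN)); ring.
have h2 := hs _ ki.
have h3 : mu k.+1 * (b + d) <= s * (drift k + s).
  by apply: (le_trans h2); rewrite ler_pM2l.
set y := drift k.+1 + s in p e *.
rewrite ler_pdivrMr// mulrDl mul1r.
have : mu k.+1 - s <= mu k.+1 / (drift k + s) * y.
  by rewrite mulrAC ler_pdivlMr// e; rewrite e in h3; lra.
lra.
Qed.

(** The drifts form an arithmetic progression of difference [- (b + d)], so this is a Riemann sum of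
    the inverse function; each term is compared with a logarithmic increment that telescopes. *)
Lemma sum_inv_drift_le i : (i <= N)%N -> 0 < drift i ->
  \sum_(k < i) (drift k)^-1 <= (b + d)^-1 * ln (drift 0 / drift i).
Proof.
elim: i => [|i IH] iN hd; first by rewrite big_ord0 divff ?gt_eqF// ln1 mulr0.
have bd : 0 < b + d by rewrite addr_gt0.
have e := driftS iN.
have hd' : 0 < drift i by lra.
have hd0 : 0 < drift 0 by apply: (lt_le_trans hd'); apply: drift_le; rewrite leq0n ltnW.
have h := IH (ltnW iN) hd'.
rewrite big_ord_recr /=.
have : (drift i)^-1 <= (b + d)^-1 * ln (drift i / drift i.+1).
  rewrite -(ler_pM2l bd) mulrA mulfV ?gt_eqF// mul1r.
  have := @le_ln1Dx _ (drift i.+1 / drift i - 1).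
  have r0 : 0 < drift i.+1 / drift i by rewrite divr_gt0.
  move=> /(_ ltac:(lra)); rewrite addrC subrK.
  rewrite -[X in ln X](invf_div (drift i)) lnV ?posrE ?divr_gt0//.
  have -> : drift i.+1 / drift i - 1 = - ((b + d) / drift i) by rewrite e; field; rewrite gt_eqF.
  lra.
rewrite !ln_div ?posrE// in h *; rewrite !mulrBr in h *; lra.
Qed.

Lemma sum_inv_drift_ge s i : (i <= N)%N -> 0 < s -> 0 <= drift i ->
  (b + d)^-1 * ln ((drift 0 + s + (b + d)) / (drift i + s + (b + d))) <= \sum_(k < i) (drift k + s)^-1.
Proof.
move=> + s0.
elim: i => [|i IH] iN hd.
  by rewrite big_ord0 divff ?ln1 ?mulr0// gt_eqF//; have := b0; have := d0; lra.
have bd : 0 < b + d by rewrite addr_gt0.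
have e := driftS iN.
have hd' : 0 < drift i by lra.
have hd0 : 0 < drift 0 by apply: (lt_le_trans hd'); apply: drift_le; rewrite leq0n ltnW.
have h := IH (ltnW iN) (ltW hd').
rewrite big_ord_recr /=.
have : (b + d)^-1 * ln ((drift i + s + (b + d)) / (drift i.+1 + s + (b + d))) <= (drift i + s)^-1.
  rewrite -(ler_pM2l bd) mulrA mulfV ?gt_eqF// mul1r.
  have -> : drift i.+1 + s + (b + d) = drift i + s by rewrite e; ring.
  have p : 0 < drift i + s by lra.
  have := @le_ln1Dx _ ((b + d) / (drift i + s)).
  have r0 : 0 < (b + d) / (drift i + s) by rewrite divr_gt0.
  move=> /(_ ltac:(lra)).
  by have -> : 1 + (b + d) / (drift i + s) = (drift i + s + (b + d)) / (drift i + s) by field; rewrite gt_eqF.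
have p0 : 0 < drift 0 + s + (b + d) by lra.
have p1 : 0 < drift i + s + (b + d) by lra.
have p2 : 0 < drift i.+1 + s + (b + d) by lra.
rewrite !ln_div ?posrE// in h *; rewrite !mulrBr in h *; lra.
Qed.

End BirthDeath.

(** * Many vertices *)

Lemma cvg_of_div_nat (R : realType) (u : nat -> R) (l C : R) :
  (\forall n \near \oo, `|u n - l| <= C / n%:R) -> u @ \oo --> l.
Proof.
move=> h; apply/cvgrPdist_le => eps e0; near=> n.
have n0 : 0 < n%:R :> R by near: n; exact: nbhs_infty_gtr.
rewrite distrC; apply: (@le_trans _ _ (C / n%:R)); first by near: n.
rewrite ler_pdivrMr// mulrC -ler_pdivrMr//.
by near: n; exact: nbhs_infty_ger.
Unshelve. all: by end_near. Qed.

Lemma div_same (K : fieldType) (z x y : K) : z != 0 -> y != 0 ->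
  x / z / (y / z) = x / y.
Proof. by move=> z0 y0; field; rewrite z0 y0. Qed.

Section Asymptotics.
Context (R : realType) (alpha beta c : R) (i : nat -> nat).
Hypotheses (alpha_gt0 : 0 < alpha) (beta_gt0 : 0 < beta) (c_gt0 : 0 < c)
  (hi : forall n, closest_integer (c * n%:R) (i n)%:Z).

Let b (n : nat) : R := beta / (n%:R - 1).
Let N n := #|vpair n|.

Lemma level_dist n : `|(i n)%:R - c * n%:R| <= 1 / 2.
Proof. by rewrite distrC; exact: (closest_integer_dist (hi n)). Qed.

Lemma level_itv n : c * n%:R - 1 / 2 <= (i n)%:R <= c * n%:R + 1 / 2.
Proof. by have := level_dist n; rewrite ler_norml; lra. Qed.

Lemma near_gt1 : \forall n \near \oo, (1 < n)%N.
Proof. by exists 2%N. Qed.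

Lemma birth_rate_gt0 n : (1 < n)%N -> 0 < b n.
Proof. by move=> n1; rewrite divr_gt0// subr_gt0 ltr1n. Qed.

Lemma birth_rate_le n : (1 < n)%N -> b n <= 2 * beta / n%:R.
Proof.
move=> n1; have n2 : 2 <= n%:R :> R by rewrite ler_nat.
rewrite /b ler_pdivrMr; last lra.
rewrite mulrAC ler_pdivlMr; last lra.
have := beta_gt0; nra.
Qed.

Lemma birth_rate_le_beta n : (1 < n)%N -> b n <= beta.
Proof.
move=> n1; have n2 : 2 <= n%:R :> R by rewrite ler_nat.
by rewrite ler_pdivrMr; have := beta_gt0; nra.
Qed.

Lemma level_le_card_vpair : \forall n \near \oo, (i n <= N n)%N.
Proof.
near=> n.
have n1 : (1 < n)%N by near: n; exact: near_gt1.
rewrite -(ler_nat R) /N card_vpair_natr ?(ltnW n1)//.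
have /andP[_ h] := level_itv n; apply: (le_trans h).
have : 2 * c + 3 <= n%:R by near: n; exact: nbhs_infty_ger.
have : 2 <= n%:R :> R by rewrite ler_nat.
nra.
Unshelve. all: by end_near. Qed.

Lemma level_gt j : \forall n \near \oo, (j < i n)%N.
Proof.
near=> n; rewrite -(ltr_nat R).
have /andP[h _] := level_itv n; apply: lt_le_trans h.
have : (j%:R + 1) / c <= n%:R by near: n; exact: nbhs_infty_ger.
by rewrite ler_pdivrMr// [_ * c]mulrC; lra.
Unshelve. all: by end_near. Qed.

Lemma ratio_cvg : (fun n => (i n)%:R / n%:R : R) @ \oo --> c.
Proof.
apply: (@cvg_of_div_nat _ _ _ (1 / 2)); near=> n.
have n0 : 0 < n%:R :> R by near: n; exact: nbhs_infty_gtr.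
have -> : (i n)%:R / n%:R - c = ((i n)%:R - c * n%:R) / n%:R by field; rewrite gt_eqF.
by rewrite normrM (ger0_norm (x := n%:R^-1)) ?invr_ge0// ler_wpM2r ?invr_ge0// level_dist.
Unshelve. all: by end_near. Qed.

Lemma birth_rate_cvg : b @ \oo --> 0.
Proof.
apply: (@cvg_of_div_nat _ _ _ (2 * beta)); near=> n.
have n1 : (1 < n)%N by near: n; exact: near_gt1.
by rewrite subr0 ger0_norm ?birth_rate_le// ltW// birth_rate_gt0.
Unshelve. all: by end_near. Qed.

Let drift n k : R := (N n - k)%:R * b n - k%:R * alpha.

Lemma driftE n k : (1 < n)%N -> (k <= N n)%N ->
  drift n k = n%:R * beta / 2 - k%:R * (b n + alpha).
Proof.
by move=> n1 kN; rewrite /drift natrB// mulrBl /b (vpair_rate _ n1); ring.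
Qed.

Let F n : R := climb_time (b n) alpha (N n) (i n) 0.

(** * Climbing to a level below equilibrium *)

Section Subcritical.
Hypothesis c_lt : c < beta / (2 * alpha).

Let gap := beta / 2 - c * alpha.

Lemma gap_gt0 : 0 < gap.
Proof.
by move: c_lt; rewrite ltr_pdivlMr ?mulr_gt0// /gap; lra.
Qed.

Lemma scaled_drift_cvg (s : nat -> R) : s @ \oo --> 0 ->
  (fun n => beta / 2 - ((i n)%:R / n%:R) * (b n + alpha) + s n) @ \oo --> gap.
Proof.
move=> s0; rewrite -[gap]addr0; apply: cvgD => //; apply: cvgB; first exact: cvg_cst.
apply: cvgM; first exact: ratio_cvg.
by rewrite -[alpha in X in _ --> X]add0r; apply: cvgD; [exact: birth_rate_cvg|exact: cvg_cst].
Qed.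

Lemma div_nat_cvg0 (C : R) : (fun n => C / n%:R) @ \oo --> 0.
Proof.
apply: (@cvg_of_div_nat _ _ _ `|C|); near=> n.
by rewrite subr0 normrM (ger0_norm (x := n%:R^-1))// invr_ge0.
Unshelve. all: by end_near. Qed.

Lemma drift_level_ge : \forall n \near \oo, gap / 2 * n%:R <= drift n (i n).
Proof.
have h := scaled_drift_cvg (@cvg_cst _ _ _ _ _).
near=> n.
have n1 : (1 < n)%N by near: n; exact: near_gt1.
have iN : (i n <= N n)%N by near: n; exact: level_le_card_vpair.
have n0 : 0 < n%:R :> R by rewrite ltr0n ltnW.
rewrite driftE// -ler_pdivlMr//.
have -> : (n%:R * beta / 2 - (i n)%:R * (b n + alpha)) / n%:R =
  beta / 2 - ((i n)%:R / n%:R) * (b n + alpha) + 0 by field; rewrite gt_eqF.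
apply: ltW; near: n; apply: cvgr_gt; first exact: (scaled_drift_cvg (cvg_cst _)).
have := gap_gt0; lra.
Unshelve. all: by end_near. Qed.

Let T := - ln (1 - 2 * alpha / beta * c) / alpha.

Lemma limit_timeE : alpha^-1 * ln (beta / 2 / gap) = T.
Proof.
have b20 : 0 < beta / 2 by have := beta_gt0; lra.
have g := gap_gt0.
rewrite /T [RHS]mulrC; congr (_ * _).
have -> : 1 - 2 * alpha / beta * c = gap / (beta / 2) by rewrite /gap; field; rewrite gt_eqF.
by rewrite !ln_div ?posrE// opprB.
Qed.

(** The vanishing shifts [s] and [s'] let one limit serve both sides of the squeeze for the climbing
    time. *)
Lemma log_ratio_cvg (s s' : nat -> R) : s @ \oo --> 0 -> s' @ \oo --> 0 ->
  (fun n => (b n + alpha)^-1 * ln ((beta / 2 + s n) /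
    (beta / 2 - ((i n)%:R / n%:R) * (b n + alpha) + s' n))) @ \oo --> T.
Proof.
move=> s0 s'0; rewrite -limit_timeE.
have b20 : 0 < beta / 2 by have := beta_gt0; lra.
have g := gap_gt0.
apply: cvgM.
  apply: cvgV; first by rewrite gt_eqF.
  by rewrite -[X in _ --> X]add0r; apply: cvgD; [exact: birth_rate_cvg|exact: cvg_cst].
apply: continuous_cvg; first by apply: continuous_ln; rewrite divr_gt0.
apply: cvgM.
  by rewrite -[X in _ --> X]addr0; apply: cvgD => //; exact: cvg_cst.
by apply: cvgV; [rewrite gt_eqF|exact: scaled_drift_cvg].
Qed.

Lemma climb_time_subcritical_cvg : F @ \oo --> T.
Proof.
pose eta := gap / 2.
have eta0 : 0 < eta by rewrite divr_gt0// gap_gt0.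
(* The slack required by [step_time_ge]: death rates below the level are at most
   [(c + 1) * n%:R * alpha], [b n + alpha] is at most [alpha + beta], and the drift is at least
   [eta * n%:R]. It is constant in [n], hence vanishes after division by [n%:R]. *)
pose s := (c + 1) * alpha * (alpha + beta) / eta.
have s_gt0 : 0 < s by rewrite divr_gt0// !mulr_gt0// addr_gt0.
pose lo n := (b n + alpha)^-1 * ln ((beta / 2 + (s + (b n + alpha)) / n%:R) /
    (beta / 2 - ((i n)%:R / n%:R) * (b n + alpha) + (s + (b n + alpha)) / n%:R)).
pose up n := (b n + alpha)^-1 * ln ((beta / 2 + 0) /
    (beta / 2 - ((i n)%:R / n%:R) * (b n + alpha) + 0)).
have s'0 : (fun n => (s + (b n + alpha)) / n%:R) @ \oo --> 0.
  rewrite -[X in _ --> X](mulr0 (s + (0 + alpha))).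
  apply: cvgM; first by apply: cvgD; [exact: cvg_cst|apply: cvgD; [exact: birth_rate_cvg|exact: cvg_cst]].
  have := div_nat_cvg0 1; apply: cvg_trans; apply: near_eq_cvg; apply: nearW => n.
  by rewrite mul1r.
apply: (@squeeze_cvgr _ _ _ _ lo up); last 2 first.
- exact: log_ratio_cvg.
- by apply: log_ratio_cvg; exact: cvg_cst.
near=> n.
have n1 : (1 < n)%N by near: n; exact: near_gt1.
have iN : (i n <= N n)%N by near: n; exact: level_le_card_vpair.
have n0 : 0 < n%:R :> R by rewrite ltr0n ltnW.
have hdl : eta * n%:R <= drift n (i n) by near: n; exact: drift_level_ge.
have dl0 : 0 < drift n (i n) by apply: lt_le_trans hdl; rewrite mulr_gt0.
have bg := birth_rate_gt0 n1.
have E0 : drift n 0 = n%:R * beta / 2 by rewrite driftE// mul0r subr0.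
have Ei := driftE n1 iN.
have Fe : F n = \sum_(k < i n) step_time (b n) alpha (N n) k.
  by rewrite /F /climb_time big_mkord.
rewrite Fe; apply/andP; split.
  apply: (@le_trans _ _ (\sum_(k < i n) (drift n k + s)^-1)).
    have := @sum_inv_drift_ge _ (b n) alpha (N n) bg alpha_gt0 s (i n) iN s_gt0 (ltW dl0).
    apply: le_trans; rewrite /lo -/(drift n 0) -/(drift n (i n)) E0 Ei.
    rewrite le_eqVlt; apply/orP; left; apply/eqP; congr (_ * ln _).
    rewrite -[RHS](@div_same _ n%:R); last 2 first.
    - by rewrite gt_eqF.
    - by rewrite gt_eqF//; have := dl0; rewrite Ei; have := alpha_gt0; lra.
    by congr (_ / _); field; rewrite gt_eqF.
  apply: ler_sum => k _; apply: (@step_time_ge _ _ _ _ bg alpha_gt0 s (i n)) => //.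
    exact: ltW.
  move=> l li; rewrite -/(drift n (i n)).
  have h1 : l%:R * alpha * (b n + alpha) <= (c + 1) * n%:R * alpha * (alpha + beta).
    apply: ler_pM.
    - by rewrite mulr_ge0// ltW.
    - by rewrite addr_ge0// ltW.
    - apply: ler_wpM2r; first exact: ltW.
      apply: (@le_trans _ _ (i n)%:R); first by rewrite ler_nat ltnW.
      have /andP[_ h] := level_itv n; apply: (le_trans h).
      have n1' : 1 <= n%:R :> R by rewrite ler1n ltnW.
      by move: n1'; lra.
    - by rewrite addrC lerD2l birth_rate_le_beta.
  apply: (le_trans h1); apply: (@le_trans _ _ (s * (eta * n%:R))).
    rewrite /s; rewrite le_eqVlt; apply/orP; left; apply/eqP; field.
    by rewrite gt_eqF.
  by apply: ler_wpM2l; [exact: ltW|lra].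
apply: (@le_trans _ _ (\sum_(k < i n) (drift n k)^-1)).
  apply: ler_sum => k _; apply: step_time_le => //.
    exact: leq_trans (ltn_ord k) iN.
  apply: (lt_le_trans dl0); apply: (drift_le bg alpha_gt0).
  by rewrite iN andbT ltnW.
have := @sum_inv_drift_le _ (b n) alpha (N n) bg alpha_gt0 (i n) iN dl0.
move=> h; apply: (le_trans h); rewrite /up -/(drift n 0) -/(drift n (i n)) E0 Ei !addr0.
rewrite le_eqVlt; apply/orP; left; apply/eqP; congr (_ * ln _).
rewrite Ei in dl0.
rewrite -[LHS](@div_same _ n%:R) ?gt_eqF//.
by congr (_ / _); field; rewrite gt_eqF.
Unshelve. all: by end_near. Qed.

(** Rates of order [n] meet squared step times of order [1 / n ^ 2]. This is the constant that
    [second_moment_exists] asks for. *)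
Lemma step_variance_le : exists2 C : R, 0 <= C & \forall n \near \oo,
  forall k, (k < i n)%N ->
    (N n - k)%:R * b n * step_time (b n) alpha (N n) k ^+ 2 +
    k%:R * alpha * step_time (b n) alpha (N n) k.-1 ^+ 2 <= C / n%:R.
Proof.
pose eta := gap / 2.
have eta0 : 0 < eta by rewrite divr_gt0// gap_gt0.
exists ((beta / 2 + (c + 1) * alpha) / eta ^+ 2).
  rewrite divr_ge0 ?sqr_ge0// addr_ge0//; [by rewrite divr_ge0// ltW|].
  by rewrite mulr_ge0// ltW// addr_gt0.
near=> n => k ki.
have n1 : (1 < n)%N by near: n; exact: near_gt1.
have iN : (i n <= N n)%N by near: n; exact: level_le_card_vpair.
have n0 : 0 < n%:R :> R by rewrite ltr0n ltnW.
have hdl : eta * n%:R <= drift n (i n) by near: n; exact: drift_level_ge.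
have bg := birth_rate_gt0 n1.
have st l : (l < i n)%N -> step_time (b n) alpha (N n) l ^+ 2 <= (eta * n%:R) ^- 2.
  move=> li.
  have hl : eta * n%:R <= drift n l.
    by apply: (le_trans hdl); apply: (drift_le bg alpha_gt0); rewrite iN andbT ltnW.
  have e0 : 0 < eta * n%:R by rewrite mulr_gt0.
  rewrite -exprVn lerXn2r ?nnegrE//.
  - exact: (step_time_ge0 _ bg alpha_gt0).
  - by rewrite invr_ge0 ltW.
  apply: (@le_trans _ _ (drift n l)^-1).
    apply: step_time_le => //; first exact: leq_trans li iN.
    exact: lt_le_trans hl.
  by rewrite lef_pV2 ?posrE//; exact: lt_le_trans hl.
have s1 := st k ki.
have s2 : step_time (b n) alpha (N n) k.-1 ^+ 2 <= (eta * n%:R) ^- 2.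
  by apply: st; exact: leq_ltn_trans (leq_pred _) ki.
have l1 : (N n - k)%:R * b n <= n%:R * (beta / 2).
  rewrite mulrA -(vpair_rate _ n1) -/(b n) ler_wpM2r ?(ltW bg)// ler_nat leq_subr.
  by [].
have l2 : k%:R * alpha <= n%:R * ((c + 1) * alpha).
  rewrite mulrA ler_wpM2r ?(ltW alpha_gt0)//.
  apply: (@le_trans _ _ (i n)%:R); first by rewrite ler_nat ltnW.
  have /andP[_ h] := level_itv n; apply: (le_trans h).
  have n1' : 1 <= n%:R :> R by rewrite ler1n ltnW.
      by move: n1'; lra.
have -> : (beta / 2 + (c + 1) * alpha) / eta ^+ 2 / n%:R =
    n%:R * (beta / 2) * (eta * n%:R) ^- 2 + n%:R * ((c + 1) * alpha) * (eta * n%:R) ^- 2.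
  by field; rewrite !gt_eqF.
apply: lerD; apply: ler_pM => //; rewrite ?sqr_ge0//.
- by rewrite mulr_ge0// ltW.
- by rewrite mulr_ge0// ltW.
Unshelve. all: by end_near. Qed.

End Subcritical.

End Asymptotics.

(** A Pade bound for the exponential, exact to second order, as [ln_succ_ge] requires. The auxiliary
    [g] is nonincreasing because [1 - z <= expR (- z)]. *)
Lemma expR_le_pade (R : realType) (y : R) : 0 <= y -> (2 - y) * expR y <= 2 + y.
Proof.
rewrite le_eqVlt => /orP[/eqP <-|y0]; first by rewrite expR0; lra.
pose g (x : R) : R := (2 - x) * expR x - x.
have dg (x : R) : is_derive x (1 : R) g ((1 - x) * expR x - 1).
  rewrite /g; apply: is_derive_eq.
  by rewrite /GRing.scale /=; ring.
have cg : {within `[0, y], continuous g}.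
  apply: derivable_within_continuous => x _.
  by have [] := dg x.
have [z /[!in_itv]/= /andP[z0 _]] := @MVT R g (fun x => (1 - x) * expR x - 1) 0 y y0 (fun x _ => dg x) cg.
have h : (1 - z) * expR z - 1 <= 0.
  have := expR_ge1Dx (- z); rewrite expRN => h.
  by rewrite subr_le0 -ler_pdivlMr ?expR_gt0// mul1r.
rewrite /g expR0 subr0 => e.
have : ((1 - z) * expR z - 1) * (y - 0) <= 0 by rewrite mulr_le0_ge0// subr0 ltW.
by move: e; rewrite !subr0 mulr1; lra.
Qed.

Lemma ln_ratio_ge (R : realType) (x y : R) : 0 < x -> 0 < y -> y - x <= y * ln (y / x).
Proof.
move=> x0 y0.
have r0 : 0 < x / y by rewrite divr_gt0.
have := @le_ln1Dx R (x / y - 1) ltac:(lra).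
rewrite addrC subrK -[x / y]invf_div lnV ?posrE ?divr_gt0// => h.
have : y * (1 - (y / x)^-1) <= y * ln (y / x) by rewrite ler_pM2l//; lra.
by rewrite invf_div mulrBr mulr1 mulrCA mulfV ?mulr1// gt_eqF.
Qed.

(** The primitive of [ln (x / a)] that equals [- a] at its minimum [x = a]; it approximates sums of
    [ln (k / a)] over levels. *)
Definition entropy (R : realType) (a x : R) : R := x * ln (x / a) - x.

Lemma entropy_tangent (R : realType) (a x y : R) : 0 < a -> 0 < x -> 0 < y ->
  entropy a x + (y - x) * ln (x / a) <= entropy a y.
Proof.
move=> a0 x0 y0; have := ln_ratio_ge x0 y0.
by rewrite /entropy !ln_div ?posrE//; lra.
Qed.

(** The shift [1 / 2] produces the term [ln k / 2] of Stirling's formula in [weight_ge], and with it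
    the square root in the upper bound for the climb. *)
Lemma ln_succ_ge (R : realType) (k : nat) : (0 < k)%N ->
  1 <= (k%:R + 1 / 2) * ln (k.+1%:R / k%:R) :> R.
Proof.
move=> k0; have k0' : 0 < k%:R :> R by rewrite ltr0n.
have y0 : 0 < (k%:R + 1 / 2)^-1 :> R by rewrite invr_gt0; lra.
have kk : 0 < k%:R + 1 / 2 :> R by lra.
have h := expR_le_pade (ltW y0).
rewrite -ler_pdivrMl// mulr1 -(@expRK R (k%:R + 1 / 2)^-1).
rewrite ler_ln ?posrE ?expR_gt0 ?divr_gt0 ?ltr0n//.
rewrite ler_pdivlMr// -natr1.
move: h; rewrite -(ler_pM2l kk).
have -> : (k%:R + 1 / 2) * ((2 - (k%:R + 1 / 2)^-1) * expR (k%:R + 1 / 2)^-1) =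
  2 * (expR (k%:R + 1 / 2)^-1 * k%:R) :> R by field; rewrite gt_eqF.
have -> : (k%:R + 1 / 2) * (2 + (k%:R + 1 / 2)^-1) = 2 * (k%:R + 1) :> R by field; rewrite gt_eqF.
lra.
Qed.

(** * Exponential growth of the step times above equilibrium *)

Section BirthDeathGrowth.
Context (R : realType) (b d : R) (N : nat).
Hypotheses (b0 : 0 < b) (d0 : 0 < d) (N0 : (0 < N)%N).

Let lam k : R := (N - k)%:R * b.
Let mu k : R := k%:R * d.
Let a : R := N%:R * b / d.
Let m := step_time b d N.

Lemma a_gt0 : 0 < a.
Proof. by rewrite divr_gt0// mulr_gt0// ltr0n. Qed.

Lemma lam_gt k : (k < N)%N -> 0 < lam k.
Proof. by move=> kN; rewrite mulr_gt0// ltr0n subn_gt0. Qed.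

Lemma m_ge0 k : 0 <= m k.
Proof. exact: step_time_ge0. Qed.

Lemma lam_le k : lam k <= d * a.
Proof.
rewrite /a mulrC divfK ?gt_eqF// /lam ler_wpM2r ?(ltW b0)//.
by rewrite ler_nat leq_subr.
Qed.

Lemma step_timeES k : (k.+1 < N)%N -> lam k.+1 * m k.+1 = 1 + mu k.+1 * m k.
Proof. by move=> kN; rewrite /lam /mu /m (step_timeE d b0 kN). Qed.

Lemma step_time_mono k : (k.+1 < N)%N -> m k <= m k.+1.
Proof.
elim: k => [|k IH] kN; rewrite -(ler_pM2l (lam_gt kN)) (step_timeES kN).
  have kN0 : (0 < N)%N := ltnW kN.
  have := step_timeE d b0 kN0; rewrite -/(m 0) -/(lam 0) !mul0r addr0 => h.
  apply: (@le_trans _ _ (lam 0 * m 0)).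
    by rewrite ler_wpM2r ?m_ge0// /lam ler_wpM2r ?(ltW b0)// ler_nat leq_sub2l.
  by rewrite h lerDl mulr_ge0 ?m_ge0// mulr_ge0// ltW.
apply: (@le_trans _ _ (lam k.+1 * m k.+1)).
  by rewrite ler_wpM2r ?m_ge0// /lam ler_wpM2r ?(ltW b0)// ler_nat leq_sub2l.
rewrite (step_timeES (ltnW kN)) lerD2l ler_pM ?m_ge0// ?IH ?(ltnW kN)//.
  by rewrite mulr_ge0// ltW.
by rewrite /mu ler_wpM2r ?(ltW d0)// ler_nat.
Qed.

Lemma step_time_geo k : (k.+1 < N)%N -> k.+1%:R / a * m k <= m k.+1.
Proof.
move=> kN; rewrite -(ler_pM2l (lam_gt kN)) (step_timeES kN).
have k1 : 0 < k.+1%:R :> R by rewrite ltr0n.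
apply: (@le_trans _ _ (d * a * (k.+1%:R / a * m k))).
  by rewrite ler_wpM2r ?lam_le// mulr_ge0 ?m_ge0// divr_ge0// ltW// a_gt0.
have -> : d * a * (k.+1%:R / a * m k) = mu k.+1 * m k.
  by rewrite /mu; field; rewrite gt_eqF ?a_gt0.
lra.
Qed.

(** Multiplies the ratios [k.+1%:R / a] of [step_time_geo]; by convexity each logarithm dominates an
    entropy increment, the tangent being taken at the upper end. *)
Lemma step_time_growth l k : (0 < l <= k)%N -> (k < N)%N ->
  expR (entropy a k%:R - entropy a l%:R) * m l <= m k.
Proof.
move=> /andP[l0]; elim: k => [|k IH]; first by rewrite leqn0 => /eqP l0'; rewrite l0' in l0.
rewrite leq_eqVlt => /orP[/eqP <-|]; first by rewrite subrr expR0 mul1r.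
rewrite ltnS => lk kN.
have k0 : (0 < k)%N by exact: leq_trans lk.
apply: le_trans (step_time_geo kN).
have := IH lk (ltnW kN) => h.
have p : 0 < k.+1%:R / a by rewrite divr_gt0 ?a_gt0// ltr0n.
apply: (@le_trans _ _ (k.+1%:R / a * (expR (entropy a k%:R - entropy a l%:R) * m l))); last first.
  by rewrite ler_pM2l.
rewrite mulrA ler_wpM2r ?m_ge0// -[X in X * _](@lnK R) ?posrE// -expRD ler_expR.
have := @entropy_tangent R a k.+1%:R k%:R a_gt0; rewrite !ltr0n => /(_ isT k0).
by rewrite -natr1; lra.
Qed.

Lemma step_time_decay rho k1 : 0 < rho -> a <= rho * k1%:R -> forall k l,
  (k1 <= l <= k)%N -> (k < N)%N -> m l <= rho ^+ (k - l) * m k.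
Proof.
move=> r0 ar; elim=> [|k IH] l /andP[kl lk] kN.
  by move: lk; rewrite leqn0 => /eqP ->; rewrite subnn expr0 mul1r.
move: lk; rewrite leq_eqVlt => /orP[/eqP ->|]; first by rewrite subnn expr0 mul1r.
rewrite ltnS => lk; have k1k : (k1 <= k)%N by exact: leq_trans lk.
apply: (@le_trans _ _ (rho ^+ (k - l) * m k)); first by apply: IH; [rewrite kl lk|exact: ltnW].
rewrite subSn// exprSr -mulrA ler_wpM2l ?exprn_ge0 ?(ltW r0)//.
have h := step_time_geo kN.
have p : 0 < k.+1%:R / a by rewrite divr_gt0 ?a_gt0// ltr0n.
rewrite -(ler_pM2l p); apply: (le_trans h).
rewrite mulrA -[leLHS]mul1r ler_wpM2r ?m_ge0//.
rewrite mulrAC ler_pdivlMr ?a_gt0// mul1r mulrC; apply: (le_trans ar).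
by rewrite ler_pM2l// ler_nat (leq_trans k1k).
Qed.

Let q := b / d.
(* The unnormalised stationary weights, in detailed balance by [weight_balance]. *)
Let w k : R := 'C(N, k)%:R * q ^+ k.

Lemma weight_balance k : lam k * w k = mu k.+1 * w k.+1.
Proof.
have : (N - k)%:R * 'C(N, k)%:R = k.+1%:R * 'C(N, k.+1)%:R :> R.
  by rewrite -!natrM mul_bin_left.
rewrite /lam /mu /w exprS => h.
have -> : k.+1%:R * d * ('C(N, k.+1)%:R * (q * q ^+ k)) =
  (k.+1%:R * 'C(N, k.+1)%:R) * d * q * q ^+ k by ring.
by rewrite -h /q; field; rewrite gt_eqF.
Qed.

(** Multiplied by the weights, the recursion telescopes by detailed balance: a step time is the mass
    of the levels up to [k] divided by the flux out of [k]. *)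
Lemma step_time_weight k : (k < N)%N -> lam k * w k * m k = \sum_(l < k.+1) w l.
Proof.
elim: k => [|k IH] kN.
  rewrite big_ord_recr big_ord0 /= add0r mulrAC.
  have := step_timeE d b0 kN; rewrite -/(m 0) -/(lam 0) !mul0r addr0 => ->.
  by rewrite mul1r.
by rewrite big_ord_recr /= -(IH (ltnW kN)) (weight_balance k) mulrAC (step_timeES kN); ring.
Qed.

(** The full sum is [(1 + q) ^+ N], and [N%:R * q = a]. *)
Lemma sum_weight_le k : (k < N)%N -> \sum_(l < k.+1) w l <= expR a.
Proof.
move=> kN; apply: (@le_trans _ _ ((1 + q) ^+ N)).
  rewrite exprDn -(big_mkord xpredT (fun l => w l))
    -(big_mkord xpredT (fun l => (1 ^+ (N - l) * q ^+ l) *+ 'C(N, l))).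
  rewrite [leRHS](big_cat_nat (n := k.+1))//=; last exact: leqW.
  rewrite -[leLHS]addr0; apply: lerD.
    by apply: ler_sum => l _; rewrite /w expr1n mul1r mulr_natl.
  apply: sumr_ge0 => l _; rewrite expr1n mul1r mulrn_wge0// exprn_ge0//.
  by rewrite divr_ge0// ltW.
have -> : a = N%:R * q by rewrite /a /q mulrA.
rewrite expRM_natl lerXn2r ?nnegrE ?expR_ge0 ?expR_ge1Dx//.
by rewrite addr_ge0// divr_ge0// ltW.
Qed.

(** A one-sided Stirling estimate, by induction from [w 1 = a]. The weight ratio is
    [a / k.+1%:R * (1 - k%:R / N%:R)]: [ln_succ_ge] accounts for the entropy and logarithm terms,
    and the last factor is at least [expR (- (2 * (k%:R / N%:R)))], with exponents adding up to at
    most [k%:R ^+ 2 / N%:R]. *)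
Lemma weight_ge k : (0 < k)%N -> (2 * k <= N)%N ->
  expR (- (1 + k%:R ^+ 2 / N%:R + entropy a k%:R + ln k%:R / 2)) <= w k.
Proof.
elim: k => // k IH _ kN.
have N0' : 0 < N%:R :> R by rewrite ltr0n.
have [->|k0] := posnP k.
  have -> : w 1 = a by rewrite /w bin1 expr1 /q /a mulrA.
  rewrite -[leRHS](@lnK R) ?posrE ?a_gt0// ler_expR /entropy ln1 expr1n.
  rewrite !mul1r lnV ?posrE ?a_gt0// mul0r.
  have : 0 <= N%:R^-1 :> R by rewrite invr_ge0 ltW.
  lra.
have h := IH k0 ltac:(lia).
have kp : 0 < k%:R :> R by rewrite ltr0n.
have k1p : 0 < k.+1%:R :> R by rewrite ltr0n.
have wE : w k.+1 = a / k.+1%:R * (1 - k%:R / N%:R) * w k.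
  have := weight_balance k => e.
  have lamE : lam k = (N%:R - k%:R) * b by rewrite /lam natrB//; lia.
  have muE : mu k.+1 != 0 by rewrite gt_eqF// mulr_gt0.
  apply: (mulfI muE); rewrite -e lamE /mu /a; field.
  by rewrite !gt_eqF.
have x0 : 0 <= k%:R / N%:R :> R by rewrite divr_ge0// ltW.
have x1 : k%:R / N%:R <= 1 / 2 :> R.
  rewrite ler_pdivrMr//; have : (2 * k)%:R <= N%:R :> R by rewrite ler_nat; lia.
  by rewrite natrM; lra.
have e1 : expR (- (2 * (k%:R / N%:R))) <= 1 - k%:R / N%:R :> R.
  set x : R := k%:R / N%:R in x0 x1 *.
  have := expR_ge1Dx (2 * x) => hx.
  rewrite expRN -[leRHS]invrK lef_pV2 ?posrE ?expR_gt0 ?invr_gt0//; last lra.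
  apply: le_trans hx; rewrite -[(1 - x)^-1]mulr1 ler_pdivrMl; last lra.
  have : 0 <= x * (1 - 2 * x) by rewrite mulr_ge0//; lra.
  by lra.
rewrite wE; apply: (@le_trans _ _ (expR (ln (a / k.+1%:R)) * expR (- (2 * (k%:R / N%:R))) *
   expR (- (1 + k%:R ^+ 2 / N%:R + entropy a k%:R + ln k%:R / 2)))); last first.
  have ap : 0 < a / k.+1%:R by rewrite divr_gt0 ?a_gt0.
  rewrite lnK ?posrE//; apply: ler_pM => //.
  - by rewrite mulr_ge0 ?expR_ge0// ltW.
  - by rewrite ler_pM2l.
rewrite -!expRD ler_expR.
have s := @ln_succ_ge R k k0.
have e2 : k.+1%:R ^+ 2 / N%:R = k%:R ^+ 2 / N%:R + 2 * (k%:R / N%:R) + N%:R^-1 :> R.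
  by rewrite -natr1; field; rewrite gt_eqF.
have : 0 <= N%:R^-1 :> R by rewrite invr_ge0 ltW.
rewrite e2 /entropy; move: s; rewrite !ln_div ?posrE ?a_gt0 ?mulr_gt0//.
by rewrite -(natr1 k) => s i0; lra.
Qed.

Lemma step_time_upper k : (0 < k)%N -> (2 * k <= N)%N ->
  m k <= expR (a + 1 + k%:R ^+ 2 / N%:R + entropy a k%:R + ln k%:R / 2) / lam k.
Proof.
move=> k0 kN; have kN' : (k < N)%N by lia.
have l0 := lam_gt kN'.
have wl := weight_ge k0 kN.
have w0 : 0 < w k by apply: lt_le_trans wl; exact: expR_gt0.
have e := step_time_weight kN'.
rewrite ler_pdivlMr// mulrC.
have : lam k * m k * w k <= expR a by rewrite mulrAC e sum_weight_le.
rewrite -ler_pdivlMr// => h; apply: (le_trans h).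
rewrite ler_pdivrMr//.
apply: (@le_trans _ _ (expR (a + 1 + k%:R ^+ 2 / N%:R + entropy a k%:R + ln k%:R / 2) *
  expR (- (1 + k%:R ^+ 2 / N%:R + entropy a k%:R + ln k%:R / 2)))); last first.
  by rewrite ler_pM2l ?expR_gt0.
by rewrite -expRD ler_expR; lra.
Qed.

End BirthDeathGrowth.

(** * Climbing to the equilibrium level *)

Section Critical.
Context (R : realType) (alpha beta c : R) (i : nat -> nat).
Hypotheses (alpha_gt0 : 0 < alpha) (beta_gt0 : 0 < beta) (c_gt0 : 0 < c)
  (hi : forall n, closest_integer (c * n%:R) (i n)%:Z).

Let b (n : nat) : R := beta / (n%:R - 1).
Let N n := #|vpair n|.
Let F n : R := climb_time (b n) alpha (N n) (i n) 0.
Let drift n k : R := (N n - k)%:R * b n - k%:R * alpha.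

Lemma exists_nat_ge (x : R) : exists k : nat, x <= k%:R.
Proof. by exists (Num.truncn x).+1; exact/ltW/truncnS_gt. Qed.

Lemma critical_climb_le : c = beta / (2 * alpha) ->
  exists C : R, \forall n \near \oo, F n <= C * ln n%:R.
Proof.
move=> cE.
have ca : c * alpha = beta / 2 by rewrite cE; field; rewrite gt_eqF.
(* The drift at the level is at least [- D]: occupied pairs cost at most [2 * beta * (c + 1)] in
   births, and the rounding of [i n] costs [alpha / 2] in deaths. *)
pose D := 2 * beta * (c + 1) + alpha / 2.
have D0 : 0 < D by rewrite /D addr_gt0 ?mulr_gt0 ?addr_gt0// divr_gt0.
(* Going down [L] levels raises the drift by at least [L%:R * alpha], hence to at least 1. Only
   these [L] last steps escape the comparison with the inverse drift. *)
have [L LD] : exists L : nat, D + 1 <= L%:R * alpha.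
  by have [L hL] := exists_nat_ge ((D + 1) / alpha); exists L; rewrite -ler_pdivrMr.
(* From level [Q] on, a drift of at least [- D] makes the birth rate at least 1 and at least half
   the death rate, so [m k.+1 <= 1 + 2 * m k] for any bounds used, and each of the last steps costs
   a factor 3. *)
have [Q QD] : exists Q : nat, 2 * D + 2 <= Q%:R * alpha.
  by have [Q hQ] := exists_nat_ge ((2 * D + 2) / alpha); exists Q; rewrite -ler_pdivrMr.
exists (alpha^-1 * (1 + `|ln (beta / 2)|) + L%:R * 3 ^+ L).
have ngt1 := near_gt1; have niN := level_le_card_vpair hi.
have niL := level_gt c_gt0 hi (L + Q)%N.
near=> n.
have n1 : (1 < n)%N by near: n.
have iN : (i n <= N n)%N by near: n.
have n0 : 0 < n%:R :> R by rewrite ltr0n ltnW.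
have n2 : 2 <= n%:R :> R by rewrite ler_nat.
have bg : 0 < b n := birth_rate_gt0 beta_gt0 n1.
have ble : b n <= 2 * beta / n%:R := birth_rate_le beta_gt0 n1.
have iL : (L + Q < i n)%N by near: n.
have /andP[_ iup] := level_itv hi n.
have dli : - D <= drift n (i n).
  rewrite /drift natrB// mulrBl (vpair_rate _ n1) -/(b n).
  have h1 : (i n)%:R * b n <= (c * n%:R + 1 / 2) * (2 * beta / n%:R).
    by apply: ler_pM => //; exact: ltW.
  have h2 : (c * n%:R + 1 / 2) * (2 * beta / n%:R) <= 2 * beta * (c + 1).
    have -> : (c * n%:R + 1 / 2) * (2 * beta / n%:R) = 2 * beta * c + beta / n%:R.
      by field; rewrite gt_eqF.
    have : beta / n%:R <= 2 * beta by rewrite ler_pdivrMr//; have := beta_gt0; nra.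
    lra.
  have h3 : (i n)%:R * alpha <= n%:R * beta / 2 + alpha / 2.
    have := ler_wpM2r (ltW alpha_gt0) iup; rewrite mulrDl mulrAC ca; lra.
  by rewrite /D; lra.
have LN : (i n - L <= N n)%N by apply: leq_trans iN; exact: leq_subr.
have Li : (L <= i n)%N by apply: ltnW; apply: leq_ltn_trans iL; exact: leq_addr.
have dlL : 1 <= drift n (i n - L).
  have e1 : drift n (i n) = _ := driftE alpha beta n1 iN.
  have e2 : drift n (i n - L) = _ := driftE alpha beta n1 LN.
  have : 0 <= L%:R * b n by rewrite mulr_ge0// ltW.
  rewrite e2; move: dli; rewrite e1 natrB// -/(b n); move: LD.
  by move: (i n)%:R (b n) => x y; lra.
have dlL0 : 0 < drift n (i n - L) by apply: lt_le_trans dlL.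
pose m := step_time (b n) alpha (N n).
have st l : (l < L)%N -> m (i n - L + l)%N <= 3 ^+ l.
  elim: l => [|l IH] lL.
    rewrite addn0 expr0.
    have iLN : (i n - L < N n)%N by apply: leq_trans iN; rewrite ltn_subrL lL (leq_trans lL Li).
    apply: (le_trans (@step_time_le _ (b n) alpha (N n) bg alpha_gt0 _ iLN dlL0)).
    by rewrite invf_le1.
  have {IH} := IH (ltnW lL); rewrite addnS; set k := (i n - L + l)%N => mk.
  have ki : (k.+1 < i n)%N by rewrite /k -addnS -[X in (_ < X)%N](subnK Li) ltn_add2l.
  have kN : (k.+1 < N n)%N by exact: leq_trans iN.
  have Qk : (Q <= k.+1)%N.
    rewrite /k; apply: leqW; apply: leq_trans (leq_addr _ _).
    by rewrite leq_subRL// ltnW.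
  have lam0 := lam_gt bg kN.
  have es : (N n - k.+1)%:R * b n * m k.+1 = 1 + k.+1%:R * alpha * m k.
    exact: (step_timeE alpha bg kN).
  have dk : - D <= (N n - k.+1)%:R * b n - k.+1%:R * alpha.
    by apply: (le_trans dli); apply: (drift_le bg alpha_gt0); rewrite iN andbT ltnW.
  have muk : 2 * D + 2 <= k.+1%:R * alpha.
    by apply: (le_trans QD); rewrite ler_wpM2r ?(ltW alpha_gt0)// ler_nat.
  have t1 : 1 <= 3 ^+ l :> R by rewrite exprn_ege1// ler1n.
  rewrite -(ler_pM2l lam0) es exprS.
  move: dk muk mk t1; move: ((N n - k.+1)%:R * b n) (k.+1%:R * alpha) (m k) (3 ^+ l) => x y z t.
  move=> dk muk mk t1.
  have y0 : 0 <= y by lra.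
  have := ler_wpM2l y0 mk => yz.
  have : 0 <= (2 * x - y) * t by apply: mulr_ge0; lra.
  have : 0 <= (x - 1) * t by apply: mulr_ge0; lra.
  by lra.
have Fe : F n = \sum_(k < i n - L) m k + \sum_(l < L) m (i n - L + l)%N.
  rewrite /F /climb_time -/(m _) (big_cat_nat (n := (i n - L)%N))//=; last exact: leq_subr.
  rewrite big_mkord; congr (_ + _).
  rewrite -[X in \sum_(X <= _ < _) _]add0n big_addn subKn// big_mkord.
  by apply: eq_bigr => l _; rewrite addnC.
have ln1 : 1 <= ln n%:R :> R.
  by rewrite -ler_expR lnK ?posrE//; near: n; exact: nbhs_infty_ger.
have p1 : \sum_(k < i n - L) m k <= alpha^-1 * (1 + `|ln (beta / 2)|) * ln n%:R.
  apply: (@le_trans _ _ (\sum_(k < i n - L) (drift n k)^-1)).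
    apply: ler_sum => k _; apply: step_time_le => //.
      exact: leq_trans (ltn_ord k) LN.
    apply: (lt_le_trans dlL0); apply: (drift_le bg alpha_gt0).
    by rewrite LN andbT ltnW.
  apply: (le_trans (@sum_inv_drift_le _ (b n) alpha (N n) bg alpha_gt0 _ LN dlL0)).
  rewrite -/(drift n 0) -/(drift n (i n - L)) -mulrA.
  have dl00 : drift n 0 = n%:R * (beta / 2).
    by have := driftE alpha beta n1 (leq0n _) => e; rewrite /drift e mul0r subr0 mulrA.
  have b20 : 0 < beta / 2 by rewrite divr_gt0.
  have lnb : ln (drift n 0 / drift n (i n - L)) <= (1 + `|ln (beta / 2)|) * ln n%:R.
    rewrite ln_div ?posrE ?dl00 ?mulr_gt0// lnM ?posrE//.
    have : 0 <= ln (drift n (i n - L)) by exact: ln_ge0.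
    have : ln (beta / 2) <= `|ln (beta / 2)| * ln n%:R.
      by apply: le_trans (ler_norm _) _; rewrite -[leLHS]mulr1 ler_wpM2l.
    lra.
  have ab : (b n + alpha)^-1 <= alpha^-1 by rewrite lef_pV2 ?posrE ?addr_gt0// lerDr ltW.
  apply: (@le_trans _ _ ((b n + alpha)^-1 * ((1 + `|ln (beta / 2)|) * ln n%:R))).
    by rewrite ler_wpM2l// invr_ge0 addr_ge0// ltW.
  by rewrite ler_wpM2r// mulr_ge0 ?addr_ge0//; lra.
have p2 : \sum_(l < L) m (i n - L + l)%N <= L%:R * 3 ^+ L * ln n%:R.
  apply: (@le_trans _ _ (\sum_(l < L) 3 ^+ L)).
    apply: ler_sum => l _; apply: (le_trans (st _ (ltn_ord l))).
    by apply: ler_weXn2l; [rewrite ler1n|exact: ltnW].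
  rewrite sumr_const card_ord -[leLHS]mulr_natl -[leLHS]mulr1.
  by apply: ler_wpM2l => //; apply: mulr_ge0 => //; exact: exprn_ge0.
by rewrite Fe mulrDl; exact: lerD.
Unshelve. all: by end_near. Qed.

End Critical.

Lemma expRN_le_sqr (R : realType) (x : R) : 0 < x -> expR (- x) <= 2 / x ^+ 2.
Proof.
move=> x0; have := @expR_ge1Dxn R x 1 (ltW x0); rewrite (_ : 2`! = 2)%N// => h.
rewrite expRN -[leRHS]invf_div lef_pV2 ?posrE ?expR_gt0 ?divr_gt0 ?exprn_gt0//.
lra.
Qed.

(** * Climbing to a level above equilibrium *)

Section Supercritical.
Context (R : realType) (alpha beta c : R) (i : nat -> nat).
Hypotheses (alpha_gt0 : 0 < alpha) (beta_gt0 : 0 < beta) (c_gt0 : 0 < c)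
  (hi : forall n, closest_integer (c * n%:R) (i n)%:Z).

Let b (n : nat) : R := beta / (n%:R - 1).
Let N n := #|vpair n|.
Let F n : R := climb_time (b n) alpha (N n) (i n) 0.
Let m n := step_time (b n) alpha (N n).
Let cs : R := beta / (2 * alpha).

Hypothesis c_gt : cs < c.

Definition growth_rate : R := c * ln (2 * alpha / beta * c) - c + beta / (2 * alpha).
Let r := growth_rate.

Lemma cs_gt0 : 0 < cs.
Proof. by rewrite divr_gt0// mulr_gt0. Qed.

Lemma growth_rateE : r = c * ln (c / cs) - c + cs.
Proof.
rewrite /r /growth_rate; congr (_ * ln _ - _ + _).
by rewrite /cs; field; rewrite !gt_eqF.
Qed.

(** Strictness comes from [1 - l < expR (- l)] at the nonzero point [l = ln (c / cs)]. *)
Lemma growth_rate_gt0 : 0 < r.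
Proof.
rewrite growth_rateE.
have c0 := cs_gt0; have q0 : 0 < c / cs by rewrite divr_gt0.
have l0 : 0 < ln (c / cs) by apply: ln_gt0; rewrite ltr_pdivlMr// mul1r.
have := @expR_gt1Dx R (- ln (c / cs)); rewrite oppr_eq0 gt_eqF// => /(_ isT).
rewrite expRN lnK ?posrE// => h.
have : c * (1 - ln (c / cs)) < c * (c / cs)^-1 by rewrite ltr_pM2l.
have -> : c * (c / cs)^-1 = cs by field; rewrite !gt_eqF.
by move: (ln _) => l; lra.
Qed.

Lemma equilibriumE n : (1 < n)%N -> (N n)%:R * b n / alpha = cs * n%:R.
Proof.
by move=> n1; rewrite /N /b vpair_rate// /cs; field; rewrite gt_eqF.
Qed.

Lemma entropy_linear n : (0 < n)%N ->
  entropy (cs * n%:R) (c * n%:R) = n%:R * r - cs * n%:R.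
Proof.
move=> n0; have n0' : n%:R != 0 :> R by rewrite pnatr_eq0 -lt0n.
rewrite growth_rateE /entropy.
have -> : c * n%:R / (cs * n%:R) = c / cs.
  by field; rewrite n0' gt_eqF// cs_gt0.
ring.
Qed.

Lemma last_step_le_climb n : (0 < i n)%N -> (i n <= N n)%N -> (1 < n)%N -> m n (i n).-1 <= F n.
Proof.
move=> i0 iN n1; rewrite /F /climb_time -(prednK i0) big_nat_recr//= lerDr.
by rewrite sumr_ge0// => k _; apply: step_time_ge0 => //; exact: birth_rate_gt0.
Qed.

(** Only the last step is kept. It is compared with a step just above the equilibrium [cs * n%:R],
    whose length is at least the inverse of the largest birth rate; this gives the factor
    [n%:R^-1]. *)
Lemma supercritical_climb_ge : exists2 K1 : R, 0 < K1 & \forall n \near \oo,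
  K1 * n%:R^-1 * expR (n%:R * r) <= F n.
Proof.
have c0 := cs_gt0.
have lr : 0 < ln (c / cs) by apply: ln_gt0; rewrite ltr_pdivlMr// mul1r.
exists (expR (- (2 + 3 / 2 * ln (c / cs))) / (alpha * cs)).
  by apply: divr_gt0; [exact: expR_gt0|exact: mulr_gt0].
have ngt1 := near_gt1; have niN := level_le_card_vpair hi.
have ni0 := level_gt c_gt0 hi 0.
near=> n.
have n1 : (1 < n)%N by near: n.
have iN : (i n <= N n)%N by near: n.
have i0 : (0 < i n)%N by near: n.
have n0 : 0 < n%:R :> R by rewrite ltr0n ltnW.
have bg : 0 < b n := birth_rate_gt0 beta_gt0 n1.
have N0 : (0 < N n)%N by exact: leq_trans iN.
have /andP[ilo iup] := level_itv hi n.
have a1 : 1 <= cs * n%:R.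
  have : cs^-1 <= n%:R by near: n; exact: nbhs_infty_ger.
  by rewrite -ler_pdivrMl// mulr1.
have gap : 3 <= (c - cs) * n%:R.
  have : 3 / (c - cs) <= n%:R by near: n; exact: nbhs_infty_ger.
  by rewrite ler_pdivrMr ?subr_gt0// mulrC.
apply: le_trans (last_step_le_climb i0 iN n1).
have a0 : 0 < cs * n%:R by rewrite mulr_gt0.
have [l [la lup]] : exists l : nat, cs * n%:R < l%:R /\ l%:R <= cs * n%:R + 1.
  exists (Num.truncn (cs * n%:R)).+1; split; first exact: truncnS_gt.
  rewrite -natr1 lerD2r; have /andP[] := truncn_itv (ltW a0); done.
have lp : 0 < l%:R :> R by exact: lt_trans la.
have i1E : (i n).-1%:R = (i n)%:R - 1 :> R by rewrite -subn1 natrB.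
have li : (l <= (i n).-1)%N by rewrite -(ler_nat R) i1E; lra.
have kN : ((i n).-1 < N n)%N by rewrite prednK.
have := @step_time_growth _ (b n) alpha (N n) bg alpha_gt0 N0 l (i n).-1.
rewrite li andbT -(ltr0n R) lp => /(_ isT kN).
apply: le_trans; rewrite -/(m n l) (equilibriumE n1).
have ml : (alpha * (cs * n%:R))^-1 <= m n l.
  have lN : (l < N n)%N by exact: leq_ltn_trans kN.
  have l0 : 0 < (N n - l)%:R * b n := lam_gt bg lN.
  have ca0 : 0 < alpha * (cs * n%:R) by apply: mulr_gt0.
  have e := step_timeE alpha bg lN.
  apply: (@le_trans _ _ ((N n - l)%:R * b n)^-1).
    rewrite lef_pV2 ?posrE// -(equilibriumE n1) [leRHS]mulrC divfK ?gt_eqF//.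
    by rewrite ler_wpM2r ?(ltW bg)// ler_nat leq_subr.
  rewrite -(ler_pM2l l0) mulfV ?gt_eqF// /m e lerDl mulr_ge0 ?mulr_ge0 ?(ltW alpha_gt0)//.
  exact: step_time_ge0.
have el : entropy (cs * n%:R) l%:R <= 2 - cs * n%:R.
  have := @le_ln1Dx R (l%:R / (cs * n%:R) - 1).
  have q0 : 0 < l%:R / (cs * n%:R) by rewrite divr_gt0.
  move=> /(_ ltac:(lra)); rewrite addrC subrK => h.
  rewrite /entropy.
  have : l%:R * ln (l%:R / (cs * n%:R)) <= l%:R * (l%:R / (cs * n%:R) - 1) by rewrite ler_pM2l.
  have : l%:R * (l%:R / (cs * n%:R) - 1) <= 2.
    have -> : l%:R * (l%:R / (cs * n%:R) - 1) = l%:R * (l%:R - cs * n%:R) / (cs * n%:R).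
      by field; rewrite !gt_eqF.
    by rewrite ler_pdivrMr//; move: a1 la lup; move: (cs * n%:R) (l%:R : R) => x y; nra.
  lra.
(* The last step starts at a level of at least [c * n%:R - 3 / 2], and the tangent of the entropy at
   [c * n%:R] has slope [ln (c / cs)]. *)
have ei : n%:R * r - cs * n%:R - 3 / 2 * ln (c / cs) <= entropy (cs * n%:R) (i n).-1%:R.
  rewrite -(entropy_linear (ltnW n1)).
  have cn0 : 0 < c * n%:R by rewrite mulr_gt0.
  have ip : 0 < (i n).-1%:R :> R by apply: (lt_le_trans lp); rewrite ler_nat.
  have := entropy_tangent a0 cn0 ip.
  have -> : c * n%:R / (cs * n%:R) = c / cs by field; rewrite !gt_eqF.
  rewrite i1E; have : 0 <= ((i n)%:R - 1 - c * n%:R + 3 / 2) * ln (c / cs).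
    by rewrite mulr_ge0 ?(ltW lr)//; lra.
  lra.
apply: (@le_trans _ _ (expR (n%:R * r - (2 + 3 / 2 * ln (c / cs))) * (alpha * (cs * n%:R))^-1)).
  rewrite le_eqVlt; apply/orP; left; apply/eqP; rewrite expRD; field.
  by rewrite !gt_eqF.
apply: ler_pM => //.
- by rewrite invr_ge0 ltW// mulr_gt0.
- by rewrite ler_expR; lra.
Unshelve. all: by end_near. Qed.

(** A quadratic bound is enough later: it makes relaxation to equilibrium fast on the time scale
    [F n], and it dominates the number of pairs. *)
Lemma supercritical_climb_ge_sqr : \forall n \near \oo, n%:R ^+ 2 <= F n.
Proof.
have [K1 K10 hK] := supercritical_climb_ge; have r0 := growth_rate_gt0.
near=> n.
have n0 : 0 < n%:R :> R by near: n; exact: nbhs_infty_gtr.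
apply: (@le_trans _ _ (K1 * n%:R^-1 * expR (n%:R * r))); last by near: n.
have h : (n%:R * r) ^+ 4 / 24 <= expR (n%:R * r).
  have nr0 : 0 <= n%:R * r by apply: mulr_ge0; exact: ltW.
  have := @expR_ge1Dxn R (n%:R * r) 3 nr0.
  have -> : (4`!%:R : R) = 24 by [].
  lra.
apply: (@le_trans _ _ (K1 * n%:R^-1 * ((n%:R * r) ^+ 4 / 24))); last first.
  by rewrite ler_wpM2l// mulr_ge0 ?invr_ge0// ltW.
have -> : K1 * n%:R^-1 * ((n%:R * r) ^+ 4 / 24) = n%:R ^+ 2 * (n%:R * (K1 * r ^+ 4 / 24)).
  by field; rewrite gt_eqF.
rewrite -[leLHS]mulr1 ler_wpM2l ?sqr_ge0//.
have k0 : 0 < K1 * r ^+ 4 / 24 by rewrite divr_gt0 ?mulr_gt0 ?exprn_gt0.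
rewrite -ler_pdivrMr// div1r.
by near: n; exact: nbhs_infty_ger.
Unshelve. all: by end_near. Qed.

Definition half_way (n : nat) : nat := Num.truncn ((cs + c) / 2 * n%:R).
(** The equilibrium density over the midpoint density: above half-way, each step time is at most
    [rho] times the next. *)
Let rho : R := 2 * cs / (cs + c).
Let eta := (c - cs) / 2.

Lemma rho_gt0 : 0 < rho.
Proof. by have h := cs_gt0; apply: divr_gt0; [exact: mulr_gt0|exact: addr_gt0]. Qed.

Lemma rho_lt1 : rho < 1.
Proof. by have h := cs_gt0; have h' := c_gt; rewrite /rho ltr_pdivrMr; [lra|exact: addr_gt0]. Qed.

Lemma half_way_itv n : (half_way n)%:R <= (cs + c) / 2 * n%:R < (half_way n).+1%:R.
Proof.
have h := cs_gt0; apply: truncn_itv; apply: mulr_ge0 => //.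
by apply: divr_ge0 => //; apply: addr_ge0; exact: ltW.
Qed.

Lemma rho_half_way n : cs * n%:R <= rho * (half_way n).+1%:R.
Proof.
have /andP[_ h] := half_way_itv n.
have := ler_wpM2l (ltW rho_gt0) (ltW h).
apply: le_trans; rewrite le_eqVlt; apply/orP; left; apply/eqP.
by rewrite /rho; field; rewrite gt_eqF// addr_gt0//; exact: cs_gt0.
Qed.

Lemma half_way_lt : \forall n \near \oo, ((half_way n).+1 < i n)%N.
Proof.
near=> n.
have /andP[h _] := half_way_itv n; have /andP[h' _] := level_itv hi n.
rewrite -(ltr_nat R) -natr1.
have : 4 / (c - cs) <= n%:R by near: n; exact: nbhs_infty_ger.
by rewrite ler_pdivrMr ?subr_gt0//; lra.
Unshelve. all: by end_near. Qed.

(** The ratio is in fact exponentially small. Order [n] steps times the bound [expRN_le_sqr], of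
    order [1 / n ^ 2], give the polynomial rate that suffices. *)
Lemma half_way_negligible : exists2 C : R, 0 <= C & \forall n \near \oo,
  \sum_(k < (half_way n).+1) m n k <= C / n%:R * m n (i n).-1.
Proof.
have c0 := cs_gt0.
pose th := - ln rho.
have th0 : 0 < th by rewrite /th oppr_gt0 ln_lt0// rho_gt0 rho_lt1.
have e0 : 0 < eta by rewrite divr_gt0// subr_gt0.
exists ((c + 1) * (expR (5 / 2 * th) * (2 / (th * eta) ^+ 2))).
  by rewrite !mulr_ge0 ?addr_ge0 ?expR_ge0 ?invr_ge0 ?exprn_ge0// ltW// mulr_gt0.
have ngt1 := near_gt1; have niN := level_le_card_vpair hi.
have nhw := half_way_lt.
near=> n.
have n1 : (1 < n)%N by near: n.
have iN : (i n <= N n)%N by near: n.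
have hw : ((half_way n).+1 < i n)%N by near: n.
have n0 : 0 < n%:R :> R by rewrite ltr0n ltnW.
have bg : 0 < b n := birth_rate_gt0 beta_gt0 n1.
have i0 : (0 < i n)%N by exact: leq_ltn_trans hw.
have N0 : (0 < N n)%N by exact: leq_trans iN.
have kN : ((i n).-1 < N n)%N by rewrite prednK.
set k1 := (half_way n).+1 in hw *.
have k1i : (k1 <= (i n).-1)%N by rewrite -ltnS prednK.
have mono : forall k l, (k <= l)%N -> (l < N n)%N -> m n k <= m n l.
  move=> k; elim=> [|l IH]; first by rewrite leqn0 => /eqP ->.
  rewrite leq_eqVlt => /orP[/eqP ->//|]; rewrite ltnS => kl lN.
  by apply: (le_trans (IH kl (ltnW lN))); exact: (step_time_mono bg alpha_gt0).
have ar : (N n)%:R * b n / alpha <= rho * k1%:R by rewrite (equilibriumE n1); exact: rho_half_way.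
have dec := @step_time_decay _ (b n) alpha (N n) bg alpha_gt0 N0 rho k1 rho_gt0 ar (i n).-1 k1.
rewrite leqnn k1i in dec; have {}dec := dec isT kN.
apply: (@le_trans _ _ (k1%:R * m n k1)).
  rewrite -[X in X%:R * _](card_ord k1) mulr_natl -sumr_const; apply: ler_sum => k _.
  by apply: mono; [exact: ltnW|exact: leq_ltn_trans kN].
have m0 : 0 <= m n (i n).-1 by exact: step_time_ge0.
apply: (@le_trans _ _ (k1%:R * (rho ^+ ((i n).-1 - k1) * m n (i n).-1))).
  by rewrite ler_wpM2l.
rewrite mulrA ler_wpM2r//.
have /andP[h1 _] := half_way_itv n; have /andP[h2 h3] := level_itv hi n.
have k1le : k1%:R <= (c + 1) * n%:R.
  apply: (@le_trans _ _ (i n)%:R); first by rewrite ler_nat ltnW.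
  have n1' : 1 <= n%:R :> R by rewrite ler1n ltnW.
  by apply: (le_trans h3); lra.
have eE : ((i n).-1 - k1)%:R = (i n)%:R - 1 - k1%:R :> R.
  by rewrite natrB// -subn1 natrB.
(* [i n] is at least [c * n%:R - 1 / 2] and [k1] at most [(cs + c) / 2 * n%:R + 1], so the exponent
   is at least [eta * n%:R - 5 / 2]. *)
have rE : rho ^+ ((i n).-1 - k1) <= expR (5 / 2 * th) * expR (- (th * eta * n%:R)).
  rewrite -[X in X ^+ _](@lnK R) ?posrE ?rho_gt0// -expRM_natl -expRD ler_expR eE.
  have -> : ln rho = - th by rewrite /th opprK.
  have k1E : k1%:R <= (cs + c) / 2 * n%:R + 1 by rewrite /k1 -natr1 lerD2r.
  have : 0 <= th * ((i n)%:R - 1 - k1%:R - eta * n%:R + 5 / 2).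
    by apply: mulr_ge0; [exact: ltW|rewrite /eta; lra].
  lra.
apply: (@le_trans _ _ ((c + 1) * n%:R * (expR (5 / 2 * th) * (2 / (th * eta * n%:R) ^+ 2)))).
  apply: ler_pM => //; first by rewrite exprn_ge0// ltW// rho_gt0.
  apply: (le_trans rE); rewrite ler_wpM2l ?expR_ge0//.
  by apply: expRN_le_sqr; apply: mulr_gt0 => //; exact: mulr_gt0.
rewrite le_eqVlt; apply/orP; left; apply/eqP; field.
by rewrite !gt_eqF.
Unshelve. all: by end_near. Qed.

(** A geometric sum reduces the climb to its last step, where [step_time_upper] applies. The
    Stirling term contributes the square root of [n], the birth rate in the denominator contributes
    [n]. *)
Lemma supercritical_climb_le : exists2 K2 : R, 0 < K2 & \forall n \near \oo,
  F n <= K2 * (Num.sqrt n%:R)^-1 * expR (n%:R * r).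
Proof.
have c0 := cs_gt0; have r1 := rho_lt1.
have [C C0 hC] := half_way_negligible.
(* Bounds the correction [k%:R ^+ 2 / (N n)%:R] in [weight_ge], as [k] is of order [n] and the
   number of pairs of order [n ^ 2]. *)
pose D := 4 * (c + 1) ^+ 2.
exists ((C + (1 - rho)^-1) * (expR (1 + D + ln c / 2) * (4 / beta))).
  have p1 : 0 < C + (1 - rho)^-1 by rewrite ltr_wpDl// invr_gt0 subr_gt0.
  have p2 : 0 < 4 / beta by rewrite divr_gt0.
  by apply: mulr_gt0 => //; apply: mulr_gt0 => //; exact: expR_gt0.
have ngt1 := near_gt1; have niN := level_le_card_vpair hi.
have nhw := half_way_lt.
near=> n.
have n1 : (1 < n)%N by near: n.
have iN : (i n <= N n)%N by near: n.
have hw : ((half_way n).+1 < i n)%N by near: n.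
have n0 : 0 < n%:R :> R by rewrite ltr0n ltnW.
have n2 : 2 <= n%:R :> R by rewrite ler_nat.
have bg : 0 < b n := birth_rate_gt0 beta_gt0 n1.
have i0 : (0 < i n)%N by exact: leq_ltn_trans hw.
have N0 : (0 < N n)%N by exact: leq_trans iN.
have kN : ((i n).-1 < N n)%N by rewrite prednK.
have hCn : \sum_(k < (half_way n).+1) m n k <= C / n%:R * m n (i n).-1 by near: n.
have nbig : 8 * (c + 1) + 2 <= n%:R by near: n; exact: nbhs_infty_ger.
set k1 := (half_way n).+1 in hw hCn *.
set k := (i n).-1 in kN hCn *.
have k1i : (k1 <= k)%N by rewrite -ltnS prednK.
have ar : (N n)%:R * b n / alpha <= rho * k1%:R by rewrite (equilibriumE n1); exact: rho_half_way.
have m0 l : 0 <= m n l by exact: step_time_ge0.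
have geo : \sum_(k1 <= l < k.+1) m n l <= (1 - rho)^-1 * m n k.
  elim: (k) k1i kN => [|l IH] kl lN.
    move: kl; rewrite leqn0 => /eqP ->; rewrite big_nat1 -[leLHS]mul1r ler_wpM2r//.
    by rewrite invf_ge1 ?subr_gt0//; have := rho_gt0; lra.
  move: kl; rewrite leq_eqVlt => /orP[/eqP ->|].
    rewrite big_nat1 -[leLHS]mul1r ler_wpM2r//.
    by rewrite invf_ge1 ?subr_gt0//; have := rho_gt0; lra.
  rewrite ltnS => kl; rewrite big_nat_recr ?(leqW kl)//.
  have h1 := IH kl (ltnW lN).
  have h2 : m n l <= rho * m n l.+1.
    have := @step_time_decay _ (b n) alpha (N n) bg alpha_gt0 N0 rho k1 rho_gt0 ar l.+1 l.
    by rewrite kl leqnSn subSnn expr1 => /(_ isT lN).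
  have q0 : 0 < 1 - rho by rewrite subr_gt0.
  rewrite -(ler_pM2l q0) [leRHS]mulrA mulfV ?gt_eqF// mul1r mulrDr.
  have h3 : (1 - rho) * (\sum_(k1 <= l0 < l.+1) m n l0) <= m n l by rewrite -ler_pdivlMl.
  move: h2 h3; move: (\sum_(_ <= _ < _) _) (m n l) (m n l.+1) rho => S x y p.
  by lra.
have FE : F n = \sum_(l < k1) m n l + \sum_(k1 <= l < k.+1) m n l.
  rewrite /F /climb_time prednK// (big_cat_nat (n := k1))//=; last exact: ltnW.
  by rewrite big_mkord.
have Fm : F n <= (C + (1 - rho)^-1) * m n k.
  rewrite FE mulrDl; apply: lerD => //; apply: (le_trans hCn); rewrite ler_wpM2r//.
  by rewrite ler_pdivrMr// ler_peMr//; lra.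
apply: (le_trans Fm); rewrite -!mulrA ler_wpM2l//.
  by rewrite addr_ge0// invr_ge0 subr_ge0 ltW.
have /andP[h2 h3] := level_itv hi n.
have kE : k%:R = (i n)%:R - 1 :> R by rewrite /k -subn1 natrB.
have kp : 0 < k%:R :> R by rewrite ltr0n; exact: leq_trans k1i.
have kle : k%:R <= c * n%:R by rewrite kE; lra.
have NE : (N n)%:R = n%:R * (n%:R - 1) / 2 :> R by apply: card_vpair_natr; exact: ltnW.
have k2N : (2 * k <= N n)%N.
  rewrite -(ler_nat R) natrM NE; nra.
have upper := @step_time_upper _ (b n) alpha (N n) bg alpha_gt0 N0 k _ k2N.
rewrite -(ltr0n R) kp in upper; have {}upper := upper isT.
apply: (le_trans upper); rewrite (equilibriumE n1).
have l0 : n%:R * (beta / 4) <= (N n - k)%:R * b n.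
  rewrite natrB; last exact: ltnW.
  have : (N n)%:R / 2 * b n <= ((N n)%:R - k%:R) * b n.
    rewrite ler_wpM2r ?(ltW bg)//.
    have : (2 * k)%:R <= (N n)%:R :> R by rewrite ler_nat.
    by rewrite natrM; lra.
  have := vpair_rate beta n1; rewrite -/(N n) -/(b n); lra.
have kN2 : k%:R ^+ 2 / (N n)%:R <= D.
  rewrite ler_pdivrMr ?ltr0n// NE /D.
  have : k%:R ^+ 2 <= (c * n%:R) ^+ 2 by rewrite lerXn2r ?nnegrE ?mulr_ge0// ltW.
  have : 0 <= n%:R * (n%:R - 2) :> R by rewrite mulr_ge0//; lra.
  have := c_gt0 => cg.
  move=> hh1 hh2; apply: (le_trans hh2); rewrite exprMn.
  apply: (@le_trans _ _ ((c + 1) ^+ 2 * n%:R ^+ 2)).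
    by rewrite ler_wpM2r ?sqr_ge0// lerXn2r ?nnegrE//; lra.
  have -> : 4 * (c + 1) ^+ 2 * (n%:R * (n%:R - 1) / 2) = (c + 1) ^+ 2 * (2 * (n%:R * (n%:R - 1))) by field.
  by rewrite ler_wpM2l ?sqr_ge0// expr2; lra.
have a0 : 0 < cs * n%:R by rewrite mulr_gt0.
have ek : cs * n%:R + entropy (cs * n%:R) k%:R <= n%:R * r.
  have cn0 : 0 < c * n%:R by rewrite mulr_gt0.
  have := entropy_tangent a0 kp cn0; rewrite (entropy_linear (ltnW n1)).
  have : 0 <= (c * n%:R - k%:R) * ln (k%:R / (cs * n%:R)).
    rewrite mulr_ge0 ?subr_ge0// ln_ge0// ler_pdivlMr// mul1r.
    have := rho_half_way n; rewrite -/k1.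
    have : k1%:R <= k%:R :> R by rewrite ler_nat.
    have := rho_gt0; move: r1 kp; move: (k1%:R : R) (k%:R : R) (cs * n%:R) => x y z; nra.
  lra.
have lk : ln k%:R <= ln c + ln n%:R :> R.
  by rewrite -lnM ?posrE// ler_ln ?posrE ?mulr_gt0.
have sq : expR (ln n%:R / 2) = Num.sqrt n%:R :> R.
  rewrite -[LHS]ger0_norm ?expR_ge0// -sqrtr_sqr; congr Num.sqrt.
  by rewrite -expRM_natl mulrCA mulfV// mulr1 lnK ?posrE.
apply: (@le_trans _ _ (expR (1 + D + ln c / 2 + ln n%:R / 2 + n%:R * r) / (n%:R * (beta / 4)))).
  apply: ler_pM => //; rewrite ?expR_ge0 ?invr_ge0//.
  - by rewrite mulr_ge0 ?(ltW bg).
  - by rewrite ler_expR; lra.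
  - by rewrite lef_pV2 ?posrE//; [apply: lt_le_trans l0|]; rewrite mulr_gt0 ?divr_gt0.
rewrite !expRD sq -!expRD.
have s0 : 0 < Num.sqrt n%:R :> R by rewrite sqrtr_gt0.
have -> : expR (1 + D + ln c / 2) * Num.sqrt n%:R * expR (n%:R * r) / (n%:R * (beta / 4)) =
  expR (1 + D + ln c / 2) * (4 / beta) * expR (n%:R * r) * (Num.sqrt n%:R / n%:R).
  by field; rewrite !gt_eqF.
have -> : Num.sqrt n%:R / n%:R = (Num.sqrt n%:R)^-1 :> R.
  by rewrite -[X in _ / X](@sqr_sqrtr R) ?ler0n// expr2 invfM mulrA mulfV ?gt_eqF// mul1r.
by rewrite le_eqVlt; apply/orP; left; apply/eqP; ring.
Unshelve. all: by end_near. Qed.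

End Supercritical.

(** Integrates a pointwise inequality between nonnegative terms; keeping the mean on the left avoids
    a difference of possibly infinite integrals. *)
Lemma second_moment_chebyshev (R : realType) (d : measure_display)
    (T : measurableType d) (P : probability T R) (X : T -> \bar R) (t eps : R) :
  measurable_fun setT X -> (forall w, 0 <= X w)%E -> 0 <= t -> 0 < eps ->
  measurable [set w | (eps%:E < `|X w - t%:E|)%E] /\
  ((eps ^+ 2)%:E * P [set w | (eps%:E < `|X w - t%:E|)%E] + (2 * t)%:E * \int[P]_w X w <=
    \int[P]_w (X w * X w) + (t ^+ 2)%:E)%E.
Proof.
move=> mX X0 t0 e0.
have mS : measurable [set w | (eps%:E < `|X w - t%:E|)%E].
  rewrite -[X in measurable X]setTI; apply: emeasurable_fun_o_infty => //.
  apply: measurableT_comp => //; apply: emeasurable_funB => //.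
set S := [set w | _] in mS *; split => //.
have mI : measurable_fun setT (EFin \o (\1_S : T -> R)).
  by apply/measurable_EFinP; exact: measurable_indic.
have m1 : measurable_fun setT (fun w => (eps ^+ 2)%:E * (\1_S w : R)%:E)%E.
  exact: measurable_funeM.
have m2 : measurable_fun setT (fun w => (2 * t)%:E * X w)%E by exact: measurable_funeM.
have mXX : measurable_fun setT (fun w => X w * X w)%E by exact: emeasurable_funM.
have -> : ((eps ^+ 2)%:E * P S + (2 * t)%:E * \int[P]_w X w =
    \int[P]_w ((eps ^+ 2)%:E * (\1_S w)%:E + (2 * t)%:E * X w))%E.
  rewrite ge0_integralD//; last 2 first.
  - by move=> w _; rewrite -EFinM lee_fin mulr_ge0 ?sqr_ge0.
  - by move=> w _; rewrite mule_ge0// lee_fin mulr_ge0.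
  rewrite !ge0_integralZl_EFin// ?sqr_ge0 ?mulr_ge0//.
  by rewrite integral_indic// setIT.
have -> : (\int[P]_w (X w * X w) + (t ^+ 2)%:E = \int[P]_w (X w * X w + (t ^+ 2)%:E))%E.
  rewrite ge0_integralD//; last 2 first.
  - by move=> w _; rewrite mule_ge0.
  - by move=> w _; rewrite lee_fin sqr_ge0.
  by rewrite integral_cst//= probability_setT mule1.
apply: ge0_le_integral => //.
- move=> w _; apply: adde_ge0; first by rewrite -EFinM lee_fin mulr_ge0 ?sqr_ge0.
  by rewrite mule_ge0// lee_fin mulr_ge0.
- exact: emeasurable_funD.
- by apply: emeasurable_funD.
move=> w _; have := X0 w; rewrite indicE.
have [SX|_] := boolP (w \in S).
  move: SX; rewrite inE /S /=; case: (X w) => [r| |]//.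
    rewrite -EFinB /= lte_fin => h r0; rewrite -!EFinM -!EFinD lee_fin mulr1.
    have : eps ^+ 2 <= `|r - t| ^+ 2 by rewrite lerXn2r ?nnegrE// ltW.
    by rewrite real_normK ?num_real// !expr2; lra.
  by move=> _ _; rewrite mulyy addye// leey.
case: (X w) => [r| |]//.
  move=> r0; rewrite -!EFinM -!EFinD lee_fin mulr0 add0r.
  by have := sqr_ge0 (r - t); rewrite !expr2; lra.
by move=> _; rewrite mulyy addye// leey.
Qed.

(** * Concentration of the edge count near equilibrium *)

Section FarAway.
Context (R : realType) (alpha beta : R) (n : nat) (A : {set vpair n})
  (G : dynER alpha beta A).
Hypotheses (alpha_gt0 : 0 < alpha) (beta_gt0 : 0 < beta) (n_gt1 : (1 < n)%N).

Let b : R := beta / (n%:R - 1).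
Let N := #|vpair n|.
Let mean : R := N%:R * b / (b + alpha).

(* Chebyshev, with the drift inequality [L g <= - alpha g + n beta + alpha] for
   the squared distance [g] to the equilibrium value [mean]. *)
Lemma eta_far (k : nat) (t D : R) : 0 < t -> 0 < D -> mean + D <= k.+1%:R ->
  pr (law G) [set w | (k < eta t w)%N] <=
  (expR (- (alpha * t)) * (#|A|%:R - mean) ^+ 2 + (n%:R * beta + alpha) / alpha) / D ^+ 2.
Proof.
move=> t0 D0 kD.
have b0 : 0 < b by rewrite divr_gt0// subr_gt0 ltr1n.
have ba : 0 < b + alpha by rewrite addr_gt0.
pose g (j : nat) : R := (j%:R - mean) ^+ 2.
have Nb : N%:R * b = n%:R * beta / 2 by exact: vpair_rate.
have mean_le : mean * alpha <= n%:R * beta / 2.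
  rewrite /mean mulrAC ler_pdivrMr// Nb ler_wpM2l//; first by rewrite divr_ge0// mulr_ge0// ltW.
  by rewrite lerDr ltW.
have Lg j : (j <= N)%N ->
    generator (rate alpha beta n false) alpha N g j <= - alpha * g j + (n%:R * beta + alpha).
  move=> jN; rewrite /generator /rate -/b /g natrB//.
  (* The correction of the truncated predecessor at [j = 0] is multiplied by the death rate, which
     vanishes there; [j2] removes it. *)
  have j1 : j.-1%:R = j%:R - 1 + (j == 0%N)%:R :> R.
    by case: j {jN} => [|j] /=; [rewrite subrK|rewrite -[in RHS]natr1 addr0 addrK].
  have j2 : j%:R * (j == 0%N)%:R = 0 :> R by case: j {jN j1} => [|j]; rewrite ?mul0r ?mulr0.
  rewrite j1 -natr1.
  set x : R := j%:R in j2 *; set z : R := (j == 0%N)%:R in j2 *.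
  have -> : (N%:R - x) * b * ((x + 1 - mean) ^+ 2 - (x - mean) ^+ 2) +
     x * alpha * ((x - 1 + z - mean) ^+ 2 - (x - mean) ^+ 2) =
     (N%:R - x) * b * (2 * (x - mean) + 1) + x * alpha * (1 - 2 * (x - mean)) +
     alpha * (x * z) * (2 * (x - 1 - mean) + z) by ring.
  rewrite j2 mulr0 mul0r addr0.
  have mE : mean * (b + alpha) = N%:R * b by rewrite /mean divfK// gt_eqF.
  have -> : (N%:R - x) * b * (2 * (x - mean) + 1) + x * alpha * (1 - 2 * (x - mean)) =
    - 2 * (b + alpha) * (x - mean) ^+ 2 + (N%:R - x) * b + x * alpha.
    have -> : (N%:R - x) * b = mean * (b + alpha) - x * b by rewrite mE; ring.
    by ring.
  have x0 : 0 <= x by [].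
  have h1 : (N%:R - x) * b <= N%:R * b by have := mulr_ge0 x0 (ltW b0); lra.
  have h2 : x * alpha <= mean * alpha + alpha + alpha * (x - mean) ^+ 2.
    have : 0 <= alpha * ((x - mean) ^+ 2 - (x - mean) + 1).
      apply: mulr_ge0; first exact: ltW.
      by have := sqr_ge0 (x - mean - 1 / 2); rewrite !expr2; lra.
    have -> : alpha * ((x - mean) ^+ 2 - (x - mean) + 1) =
      alpha * (x - mean) ^+ 2 - x * alpha + mean * alpha + alpha by ring.
    by lra.
  have h3 : 0 <= b * (x - mean) ^+ 2 by rewrite mulr_ge0 ?sqr_ge0// ltW.
  have h4 : (N%:R - x) * b + x * alpha <= n%:R * beta + alpha + alpha * (x - mean) ^+ 2 by lra.
  have : 2 * (b + alpha) * (x - mean) ^+ 2 =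
    2 * (b * (x - mean) ^+ 2) + 2 * (alpha * (x - mean) ^+ 2) by ring.
  by move: h3 h4; rewrite mulNr !mulNr; lra.
have drift := @eta_drift _ _ _ _ _ G alpha_gt0 beta_gt0 n_gt1 g alpha (n%:R * beta + alpha) t
  alpha_gt0 _ t0 (fun j _ => sqr_ge0 _) Lg.
rewrite ler_pdivlMr ?exprn_gt0//; apply: le_trans (drift _); last first.
  by rewrite addr_ge0 ?mulr_ge0// ltW.
have mk : measurable [set w : space G | (k < eta t w)%N].
  by have [] := @full_history_eta _ _ _ _ _ G t t (fun j => (k < j)%N) (lexx _).
have met j : measurable [set w : space G | eta t w = j] by exact: measurable_eta.
rewrite (pr_partition_nat _ mk met (eta_le t)) mulr_suml.
apply: ler_sum => j _; have [kj|jk] := ltnP k j.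
  apply: (@le_trans _ _ (pr (law G) [set w | eta t w = j] * D ^+ 2)).
    rewrite ler_wpM2r ?sqr_ge0//; apply: pr_le => //; first exact: measurableI.
  rewrite mulrC ler_wpM2r ?pr_ge0// /g lerXn2r ?nnegrE ?(ltW D0)//.
    by rewrite subr_ge0; apply: le_trans (le_trans kD _); rewrite ?ler_nat// lerDl ltW.
  have : k.+1%:R <= j%:R :> R by rewrite ler_nat.
  lra.
have -> : [set w : space G | (k < eta t w)%N] `&` [set w | eta t w = j] = set0.
  by apply/seteqP; split => // w /= [h e]; move: h; rewrite e ltnNge jk.
by rewrite pr0 mul0r mulr_ge0 ?sqr_ge0 ?pr_ge0.
Qed.

End FarAway.

Lemma expR_near (R : realType) (x delta : R) : 0 <= x -> 0 < delta -> delta <= 1 / 2 ->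
  x * delta <= 1 / 2 ->
  expR (- x) - 2 * (x * delta) <= expR (- x / (1 - delta)) /\
  expR (- x / (1 + delta)) <= expR (- x) + 2 * (x * delta).
Proof.
move=> x0 d0 d1 xd.
have xd0 : 0 <= x * delta by rewrite mulr_ge0// ltW.
have ex1 : expR (- x) <= 1 by rewrite expR_le1; lra.
split.
  apply: (@le_trans _ _ (expR (- x - 2 * (x * delta)))).
    rewrite expRD; have := expR_ge1Dx (- (2 * (x * delta))); have := expR_ge0 (- x) => h1 h2.
    have := ler_wpM2l h1 h2.
    have : 0 <= (1 - expR (- x)) * (2 * (x * delta)) by apply: mulr_ge0; lra.
    lra.
  rewrite ler_expR mulNr -opprD lerN2 ler_pdivrMr; last lra.
  have : 0 <= (x * delta) * (1 - 2 * delta) by apply: mulr_ge0; lra.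
  lra.
apply: (@le_trans _ _ (expR (- x + x * delta))).
  rewrite ler_expR mulNr lerNl opprD opprK ler_pdivlMr; last lra.
  have : 0 <= (x * delta) * delta by rewrite mulr_ge0// ltW.
  lra.
rewrite expRD.
have h : expR (x * delta) <= 1 + 2 * (x * delta).
  set y := x * delta in xd xd0 *.
  have h := expR_ge1Dx (- y); rewrite expRN in h.
  have : expR y * (1 - y) <= 1 by rewrite mulrC -ler_pdivlMr ?expR_gt0// div1r.
  move=> h1; have := expR_ge1Dx y => h2.
  have : 0 <= (expR y) * (1 - 2 * y) by rewrite mulr_ge0 ?expR_ge0//; lra.
  have : 0 <= (expR y - 1) * (1 / 2 - y) by rewrite mulr_ge0//; lra.
  nra.
have h0 := expR_ge0 (- x); have := ler_wpM2l h0 h.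
have : 0 <= (1 - expR (- x)) * (2 * (x * delta)) by apply: mulr_ge0; lra.
lra.
Qed.

Section HittingTime.
Context (R : realType) (alpha beta : R) (n : nat) (A : {set vpair n})
  (G : dynER alpha beta A) (i : nat).
Hypotheses (alpha_gt0 : 0 < alpha) (beta_gt0 : 0 < beta) (n_gt1 : (1 < n)%N)
  (iN : (i <= #|vpair n|)%N) (Ai : (#|A| < i)%N).

Let b : R := beta / (n%:R - 1).
Let N := #|vpair n|.
Let F : R := climb_time b alpha N i #|A|.

Let b0 : 0 < b.
Proof. by rewrite divr_gt0// subr_gt0 ltr1n. Qed.

Lemma Etau_climb_time : Etau G i = F%:E.
Proof.
have [f [hf fc _]] := hitting_time_exists b0 alpha_gt0 iN.
by rewrite (Etau_eq G alpha_gt0 beta_gt0 n_gt1 _ hf) ?fc ?(ltnW Ai)// ltn_eqF.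
Qed.

(** By [second_moment_exists] the second moment is at most [F ^+ 2 + v * F], so the variance is at
    most [v * F]; centring at [t] adds the squared bias. *)
Lemma tau_chebyshev (v t eps : R) : 0 <= v -> 0 <= t -> 0 < eps ->
  (forall k, (k < i)%N -> (N - k)%:R * b * step_time b alpha N k ^+ 2 +
    k%:R * alpha * step_time b alpha N k.-1 ^+ 2 <= v) ->
  (law G [set w | (eps%:E < `|tau i w - t%:E|)%E] <=
    (((F - t) ^+ 2 + v * F) / eps ^+ 2)%:E)%E.
Proof.
move=> v0 t0 e0 hv.
have [f [hf fc _]] := hitting_time_exists b0 alpha_gt0 iN.
have [g [gi g0 Lg gE]] := second_moment_exists b0 alpha_gt0 iN v0 hf fc hv.
have Ani : #|A| != i by rewrite ltn_eqF.
have fA : f #|A| = F by rewrite fc// ltnW.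
have := Etau_sqr_le G alpha_gt0 beta_gt0 n_gt1 Ani hf gi g0 Lg.
rewrite gE ?(ltnW Ai)// fA => sq.
have [mS] := second_moment_chebyshev (law G) (@measurable_tau _ _ _ _ _ G i) (@tau_ge0 _ _ _ _ _ G i) t0 e0.
rewrite -[X in (_ + _ * X)%E]/(Etau G i) Etau_climb_time.
have [P0 P1] : (0 <= law G [set w | (eps%:E < `|tau i w - t%:E|)%E] /\
  law G [set w | (eps%:E < `|tau i w - t%:E|)%E] <= 1)%E.
  by split; [|exact: probability_le1].
move=> /le_trans/(_ (leeD2r _ sq)).
move: P0 P1; case: (law G _) => [p| |]//= p0 p1.
rewrite -!EFinM -!EFinD !lee_fin ler_pdivlMr ?exprn_gt0// => h.
have -> : (F - t) ^+ 2 = F ^+ 2 + t ^+ 2 - 2 * t * F by ring.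
by rewrite mulrC; lra.
Qed.

End HittingTime.

Lemma expRN_le_inv (R : realType) (x : R) : 0 < x -> expR (- x) <= x^-1.
Proof.
by move=> x0; rewrite expRN lef_pV2 ?posrE ?expR_gt0//; have := expR_ge1Dx x; lra.
Qed.

Lemma exponential_prob_neg (R : realType) (r x : R) : x < 0 ->
  exponential_prob r `]-oo, x]%classic = 0%E.
Proof.
move=> x0; rewrite /exponential_prob integral0_eq// => y /=; rewrite in_itv/= => yx.
by rewrite lt0_exponential_pdf// (le_lt_trans yx).
Qed.

Lemma ereal_div_le (R : realType) (r x : R) (y : \bar R) : 0 < r ->
  (y / r%:E <= x%:E)%E = (y <= (x * r)%:E)%E.
Proof.
move=> r0; rewrite inver gt_eqF//; case: y => [y| |].
- by rewrite -EFinM !lee_fin ler_pdivrMr.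
- by rewrite gt0_mulye ?lte_fin ?invr_gt0.
- by rewrite gt0_mulNye ?lte_fin ?invr_gt0// !leNye.
Qed.

(** * From climbing times to the limit statements *)

Section Limits.
Context (R : realType) (alpha beta c : R) (i : nat -> nat)
  (G : forall (n : nat) (A : {set vpair n}), dynER alpha beta A).
Hypotheses (alpha_gt0 : 0 < alpha) (beta_gt0 : 0 < beta) (c_gt0 : 0 < c)
  (hi : forall n, closest_integer (c * n%:R) (i n)%:Z).

Let b (n : nat) : R := beta / (n%:R - 1).
Let N n := #|vpair n|.
Let F n : R := climb_time (b n) alpha (N n) (i n) 0.

Lemma Etau_near : \forall n \near \oo, Etau (@G n finset.set0) (i n) = (F n)%:E.
Proof.
have iN := level_le_card_vpair hi; have i0 := level_gt c_gt0 hi 0.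
near=> n.
have n1 : (1 < n)%N by near: n; exact: near_gt1.
by rewrite Etau_climb_time ?cards0//; near: n.
Unshelve. all: by end_near. Qed.

Lemma subcritical_Etau : c < beta / (2 * alpha) ->
  (fun n => Etau (@G n finset.set0) (i n)) @ \oo -->
    (- ln (1 - 2 * alpha / beta * c) / alpha)%:E.
Proof.
move=> cl; have Fcvg := climb_time_subcritical_cvg alpha_gt0 beta_gt0 c_gt0 hi cl.
have : (EFin \o F) @ \oo --> (- ln (1 - 2 * alpha / beta * c) / alpha)%:E.
  by apply: cvg_EFin; [exact: nearW|exact: Fcvg].
apply: cvg_trans; apply: near_eq_cvg; apply: filterS Etau_near => n ->.
by [].
Qed.

Lemma subcritical_probability : c < beta / (2 * alpha) ->
  cvg_in_probability (fun n => law (@G n finset.set0))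
    (fun n => tau (G := @G n finset.set0) (i n)) (- ln (1 - 2 * alpha / beta * c) / alpha).
Proof.
move=> cl eps e0; set T := - ln _ / alpha.
have Fcvg : F @ \oo --> T := climb_time_subcritical_cvg alpha_gt0 beta_gt0 c_gt0 hi cl.
have [C C0 hC] := step_variance_le alpha_gt0 beta_gt0 c_gt0 hi cl.
have T0 : 0 <= T.
  rewrite -(cvg_lim _ Fcvg)//; apply: limr_ge; first exact: cvgP Fcvg.
  by apply: filterS near_gt1 => n n1; rewrite climb_time_ge0//; exact: birth_rate_gt0.
have ub : (fun n => (((F n - T) ^+ 2 + C / n%:R * F n) / eps ^+ 2)%:E) @ \oo --> 0%E.
  apply: (@cvg_EFin _ _ _ _ (fun n => (((F n - T) ^+ 2 + C / n%:R * F n) / eps ^+ 2)%:E)).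
    by apply: nearW.
  rewrite /comp /=.
  rewrite -[X in _ --> X](mul0r ((eps ^+ 2)^-1)); apply: cvgM; last exact: cvg_cst.
  rewrite -[X in _ --> X](addr0 0); apply: cvgD.
    have FT : (fun n => F n - T) @ \oo --> 0.
      by rewrite -[X in _ --> X](subrr T); apply: cvgB => //; exact: cvg_cst.
    by rewrite -[X in _ --> X](mul0r 0); apply: cvgM.
  by rewrite -[X in _ --> X](mul0r T); apply: cvgM => //; exact: div_nat_cvg0.
apply: (@squeeze_cvge _ _ _ _ (fun=> 0%E) _ _ _ _ (cvg_cst _) ub).
have iN := level_le_card_vpair hi; have i0 := level_gt c_gt0 hi 0.
near=> n; apply/andP; split; first exact: measure_ge0.
have := @tau_chebyshev _ _ _ n finset.set0 (@G n finset.set0) (i n) alpha_gt0 beta_gt0.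
rewrite cards0; apply => //; [by near: n; exact: near_gt1|by near: n|by near: n| |by near: n].
by rewrite divr_ge0.
Unshelve. all: by end_near. Qed.

(** The climb from [j] edges is a final part of the climb from the empty graph, so one constant
    serves every [j]. *)
Lemma critical_Etau : c = beta / (2 * alpha) ->
  forall j : nat, exists C : R, \forall n \near \oo,
    forall A : {set vpair n}, #|A| = j -> (Etau (@G n A) (i n) <= (C * ln n%:R)%:E)%E.
Proof.
move=> cE j; have [C hC] := critical_climb_le alpha_gt0 beta_gt0 c_gt0 hi cE.
exists C; have iN := level_le_card_vpair hi; have ij := level_gt c_gt0 hi j.
near=> n => A Aj.
have iNn : (i n <= N n)%N by near: n.
have ijn : (j < i n)%N by near: n.
have n1 : (1 < n)%N by near: n; exact: near_gt1.
rewrite Etau_climb_time ?Aj// lee_fin.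
apply: (@le_trans _ _ (F n)); last by near: n.
rewrite /F /climb_time (@big_cat_nat _ _ _ j 0)//= ?(ltnW ijn)// lerDr sumr_ge0// => k _.
by apply: step_time_ge0; [exact: birth_rate_gt0|].
Unshelve. all: by end_near. Qed.

Section Supercritical.
Let cs : R := beta / (2 * alpha).

Hypothesis c_gt : cs < c.

Let G0 n := @G n finset.set0.
Let above x n := pr (law (G0 n)) [set w | ((x * F n)%:E < tau (i n) w)%E].
Let at_least x n := pr (law (G0 n)) [set w | ((x * F n)%:E <= tau (i n) w)%E].

Lemma climb_time_split n j : (1 < n)%N -> (j <= i n)%N ->
  F n = \sum_(k < j) step_time (b n) alpha (N n) k + climb_time (b n) alpha (N n) (i n) j.
Proof.
by move=> n1 ji; rewrite /F /climb_time (@big_cat_nat _ _ _ j 0)//= big_mkord.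
Qed.

(** Positive multiples of [delta * F n] are at least [delta * n%:R ^+ 2], so the initial term of
    [eta_far] stays bounded; with a remaining term of order [n] and a distance [gap * n%:R],
    Chebyshev leaves [C / n%:R]. *)
Lemma eta_rarely_high (delta : R) : 0 < delta -> exists2 C : R, 0 <= C &
  \forall n \near \oo, forall k, (0 < k)%N ->
    pr (law (G0 n)) [set w | (half_way alpha beta c n < eta (k%:R * (delta * F n)) w)%N] <= C / n%:R.
Proof.
move=> d0; have csE : cs * (2 * alpha) = beta by rewrite divfK// gt_eqF// mulr_gt0.
have cs0 : 0 < cs by rewrite divr_gt0// mulr_gt0.
pose gap := (c - cs) / 2.
have gap0 : 0 < gap by rewrite divr_gt0// subr_gt0.
pose C := (cs ^+ 2 / (alpha * delta) + beta / alpha + 1) / gap ^+ 2.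
have ad0 : 0 < alpha * delta by rewrite mulr_gt0.
have C'0 : 0 <= cs ^+ 2 / (alpha * delta).
  by rewrite divr_ge0 ?sqr_ge0// ltW.
have ba0 : 0 < beta / alpha by rewrite divr_gt0.
exists C; first by rewrite divr_ge0 ?sqr_ge0// !addr_ge0// ltW.
have Fn := supercritical_climb_ge_sqr alpha_gt0 beta_gt0 c_gt0 hi c_gt.
near=> n => k k0.
have n1 : (1 < n)%N by near: n; exact: near_gt1.
have n_ge1 : 1 <= n%:R :> R by rewrite ler1n ltnW.
have n0 : 0 < n%:R :> R by lra.
have Fn2 : n%:R ^+ 2 <= F n by near: n.
have n20 : 0 < n%:R ^+ 2 :> R by rewrite exprn_gt0.
have F0 : 0 < F n by lra.
have bn0 : 0 < b n by exact: birth_rate_gt0.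
set mean := (N n)%:R * b n / (b n + alpha).
have mean0 : 0 <= mean.
  rewrite /mean; apply: divr_ge0; last by apply: addr_ge0; exact: ltW.
  by apply: mulr_ge0 => //; exact: ltW.
have mean_le : mean <= cs * n%:R.
  rewrite -(@equilibriumE _ alpha beta alpha_gt0 n n1) /mean.
  apply: ler_wpM2l; first by apply: mulr_ge0 => //; exact: ltW.
  by rewrite lef_pV2 ?posrE ?addr_gt0// lerDr ltW.
have t_ge : delta * n%:R ^+ 2 <= k%:R * (delta * F n).
  apply: (@le_trans _ _ (1 * (delta * F n))); first by rewrite mul1r ler_wpM2l// ltW.
  by apply: ler_wpM2r; [apply/ltW/mulr_gt0|rewrite ler1n].
set t := k%:R * _ in t_ge *.
have dn0 : 0 < delta * n%:R ^+ 2 by rewrite mulr_gt0.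
have t0 : 0 < t by lra.
have gn0 : 0 < gap * n%:R by rewrite mulr_gt0.
have hk : mean + gap * n%:R <= (half_way alpha beta c n).+1%:R.
  have /andP[_ /ltW] := half_way_itv alpha_gt0 beta_gt0 c_gt0 n.
  apply: le_trans; rewrite -/cs.
  have -> : (cs + c) / 2 * n%:R = cs * n%:R + gap * n%:R by rewrite /gap; field.
  by lra.
apply: le_trans (eta_far (G0 n) alpha_gt0 beta_gt0 n1 t0 gn0 hk) _.
rewrite cards0 sub0r sqrrN -/mean.
rewrite ler_pdivrMr; last by rewrite exprn_gt0.
have -> : C / n%:R * (gap * n%:R) ^+ 2 =
    (cs ^+ 2 / (alpha * delta)) * n%:R + n%:R * beta / alpha + n%:R.
  by rewrite /C; field; rewrite !gt_eqF.
have h1 : expR (- (alpha * t)) * mean ^+ 2 <= cs ^+ 2 / (alpha * delta).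
  apply: (@le_trans _ _ ((alpha * (delta * n%:R ^+ 2))^-1 * (cs * n%:R) ^+ 2)).
    apply: ler_pM; rewrite ?expR_ge0 ?sqr_ge0//.
      apply: le_trans (expRN_le_inv (mulr_gt0 alpha_gt0 t0)) _.
      rewrite lef_pV2 ?posrE; [|exact: mulr_gt0|exact: mulr_gt0].
      by apply: ler_wpM2l => //; exact: ltW.
    by rewrite lerXn2r ?nnegrE//; apply/ltW/mulr_gt0.
  by rewrite le_eqVlt; apply/orP; left; apply/eqP; field; rewrite !gt_eqF.
have h2 : (n%:R * beta + alpha) / alpha = n%:R * beta / alpha + 1.
  by field; rewrite gt_eqF.
have h3 : cs ^+ 2 / (alpha * delta) <= cs ^+ 2 / (alpha * delta) * n%:R by rewrite ler_peMr.
by rewrite h2; lra.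
Unshelve. all: by end_near. Qed.

(** Up to half-way the climb loses a fraction of order [1 / n]. Above [i n] only [f m <= m%:R] is
    known, but this is at most the number of pairs, hence at most [n%:R ^+ 2 <= F n]. *)
Lemma hitting_time_near : exists2 C : R, 0 <= C & \forall n \near \oo,
  exists f : nat -> R, [/\ hitting_time (b n) alpha (N n) (i n) f, f 0%N = F n,
    forall m, (m <= half_way alpha beta c n)%N -> `|F n - f m| <= C / n%:R * F n &
    forall m, (m <= N n)%N -> f m <= F n].
Proof.
have [C C0 hC] := half_way_negligible alpha_gt0 beta_gt0 c_gt0 hi c_gt.
exists C => //.
have iN := level_le_card_vpair hi; have i0 := level_gt c_gt0 hi 0.
have hw := half_way_lt alpha_gt0 beta_gt0 c_gt0 hi c_gt.
have Fn := supercritical_climb_ge_sqr alpha_gt0 beta_gt0 c_gt0 hi c_gt.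
have gap0 : 0 < (c - cs) * alpha by rewrite mulr_gt0// subr_gt0.
have csE : cs * (2 * alpha) = beta by rewrite divfK// gt_eqF// mulr_gt0.
near=> n.
have n1 : (1 < n)%N by near: n; exact: near_gt1.
have n_ge1 : 1 <= n%:R :> R by rewrite ler1n ltnW.
have n0 : 0 < n%:R :> R by lra.
have bn0 : 0 < b n by exact: birth_rate_gt0.
have iNn : (i n <= N n)%N by near: n.
have i0n : (0 < i n)%N by near: n.
have hwn : ((half_way alpha beta c n).+1 < i n)%N by near: n.
have hCn : \sum_(k < (half_way alpha beta c n).+1) step_time (b n) alpha (N n) k <=
  C / n%:R * step_time (b n) alpha (N n) (i n).-1 by near: n.
have Fn2 : n%:R ^+ 2 <= F n by near: n.
have ngap : ((c - cs) * alpha)^-1 <= n%:R by near: n; exact: nbhs_infty_ger.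
have s0 k : 0 <= step_time (b n) alpha (N n) k by exact: step_time_ge0.
have [f [hf fc fk]] := hitting_time_exists bn0 alpha_gt0 iNn.
have fm m : (m <= i n)%N -> F n = \sum_(k < m) step_time (b n) alpha (N n) k + f m.
  by move=> mi; rewrite fc// -climb_time_split.
exists f; split => //; first by rewrite fc.
  move=> m mh; rewrite (fm m); last by apply: leq_trans (ltnW hwn); exact: leqW.
  rewrite addrK ger0_norm ?sumr_ge0//.
  apply: (@le_trans _ _ (C / n%:R * step_time (b n) alpha (N n) (i n).-1)).
    apply: le_trans hCn; rewrite -!(big_mkord xpredT).
    rewrite (@big_cat_nat _ _ _ m 0 (half_way alpha beta c n).+1)//= ?leqW//.
    by rewrite lerDl sumr_ge0.
  rewrite ler_wpM2l ?divr_ge0// -(fm m) ?last_step_le_climb//.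
  by apply: leq_trans (ltnW hwn); exact: leqW.
move=> m mN; have [mi|im] := leqP m (i n).
  by rewrite (fm _ mi) lerDr sumr_ge0.
apply: (@le_trans _ _ m%:R).
  apply: fk; last by rewrite im.
  move=> k /andP[ik kN].
  have ki : (i n)%:R + 1 <= k%:R :> R by rewrite natr1 ler_nat.
  have /andP[ci _] := level_itv hi n.
  have h1 : (c * n%:R + 1 / 2) * alpha <= k%:R * alpha.
    by rewrite ler_wpM2r ?(ltW alpha_gt0)//; lra.
  have h2 : (N n - k)%:R * b n <= cs * n%:R * alpha.
    apply: (@le_trans _ _ ((N n)%:R * b n)).
      by rewrite ler_wpM2r ?(ltW bn0)// ler_nat leq_subr.
    by rewrite vpair_rate//; have := csE; nra.
  have h3 : 1 <= (c - cs) * alpha * n%:R by rewrite mulrC -ler_pdivrMr// div1r.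
  have -> : 1 = 1 :> R by [].
  have : 0 <= 1 / 2 * alpha by have := alpha_gt0; lra.
  by move: h1 h2 h3; lra.
apply: le_trans Fn2; apply: (@le_trans _ _ (N n)%:R); first by rewrite ler_nat.
rewrite card_vpair_natr ?(ltnW n1)//.
have := sqr_ge0 (n%:R : R); rewrite !expr2; lra.
Unshelve. all: by end_near. Qed.

Lemma tau_tail (x : R) (K : nat) : 0 < x -> 2 * x <= K%:R -> 2 * x * x <= K%:R ->
  exists2 C : R, 0 <= C & \forall n \near \oo,
  expR (- x) - 2 * (x * (x / K%:R)) - C / n%:R <=
    at_least x n /\
  above x n <=
    expR (- x) + 2 * (x * (x / K%:R)) + C / n%:R.
Proof.
move=> x0 xK xxK; have K0 : 0 < K%:R :> R by lra.
have d0 : 0 < x / K%:R by rewrite divr_gt0.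
have [C1 C10 h1] := hitting_time_near.
have [C2 C20 h2] := eta_rarely_high d0.
exists ((x + 1) * (C1 + C2)); first by rewrite mulr_ge0 ?addr_ge0// ltW.
have i0 := level_gt c_gt0 hi 0.
have Fn := supercritical_climb_ge_sqr alpha_gt0 beta_gt0 c_gt0 hi c_gt.
near=> n.
have n1 : (1 < n)%N by near: n; exact: near_gt1.
have n0 : 0 < n%:R :> R by rewrite ltr0n ltnW.
have i0n : (0 < i n)%N by near: n.
have Fn2 : n%:R ^+ 2 <= F n by near: n.
have F0 : 0 < F n by apply: lt_le_trans Fn2; rewrite exprn_gt0.
have [f [hf f0 fdist fle]] : exists f : nat -> R, [/\ hitting_time (b n) alpha (N n) (i n) f, f 0%N = F n,
    forall m, (m <= half_way alpha beta c n)%N -> `|F n - f m| <= C1 / n%:R * F n &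
    forall m, (m <= N n)%N -> f m <= F n] by near: n.
have hp : forall k, (0 < k)%N ->
    pr (law (G0 n)) [set w | (half_way alpha beta c n < eta (k%:R * (x / K%:R * F n)) w)%N] <= C2 / n%:R.
  by near: n.
have := @tau_almost_exponential _ _ _ n _ (G0 n) (i n) alpha_gt0 beta_gt0 n1 f
  (half_way alpha beta c n) K x (C2 / n%:R) (C1 / n%:R * F n) (F n) hf.
rewrite cards0 f0 eq_sym -lt0n i0n; move=> /(_ isT F0 x0).
have epsE : (x + 1) * ((C1 / n%:R * F n + F n * (C2 / n%:R)) / F n) = (x + 1) * (C1 + C2) / n%:R.
  by field; rewrite !gt_eqF.
rewrite /= epsE => /(_ _ _ fle hp) [|m _|lo up]; [lra|exact: fdist|].
have [e1 e2] : expR (- x) - 2 * (x * (x / K%:R)) <= expR (- x / (1 - x / K%:R)) /\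
    expR (- x / (1 + x / K%:R)) <= expR (- x) + 2 * (x * (x / K%:R)).
  apply: expR_near => //; first exact: ltW.
    by rewrite ler_pdivrMr//; lra.
  by rewrite mulrA ler_pdivrMr//; lra.
by rewrite /above /at_least; split; lra.
Unshelve. all: by end_near. Qed.

(** [K] is fixed first, making the Euler error at most [e / 2]; the constant of [tau_tail], which
    depends on [K], is then beaten by [n]. *)
Lemma tau_tail_cvg (x e : R) : 0 < x -> 0 < e -> \forall n \near \oo,
  expR (- x) - e <= at_least x n /\
  above x n <= expR (- x) + e.
Proof.
move=> x0 e0.
have [K hK] := exists_nat_ge (2 * x + 2 * x * x + 4 * (x * x) / e).
have xx0 : 0 < x * x by rewrite mulr_gt0.
have q0 : 0 <= 4 * (x * x) / e by rewrite divr_ge0 ?mulr_ge0// ltW.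
have [C C0 hC] : exists2 C : R, 0 <= C & \forall n \near \oo,
  expR (- x) - 2 * (x * (x / K%:R)) - C / n%:R <=
    at_least x n /\
  above x n <=
    expR (- x) + 2 * (x * (x / K%:R)) + C / n%:R.
  by apply: tau_tail => //; lra.
have K0 : 0 < K%:R :> R by lra.
have Ke : 2 * (x * (x / K%:R)) <= e / 2.
  rewrite [_ * (_ / _)]mulrA mulrA ler_pdivrMr//.
  have : 4 * (x * x) / e <= K%:R by lra.
  by rewrite ler_pdivrMr//; lra.
near=> n.
have n0 : 0 < n%:R :> R by near: n; exact: nbhs_infty_gtr.
have Cn : C / n%:R <= e / 2.
  rewrite ler_pdivrMr// mulrC -ler_pdivrMr ?divr_gt0//.
  by near: n; exact: nbhs_infty_ger.
have [lo up] : expR (- x) - 2 * (x * (x / K%:R)) - C / n%:R <=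
    at_least x n /\
  above x n <=
    expR (- x) + 2 * (x * (x / K%:R)) + C / n%:R by near: n.
by split; lra.
Unshelve. all: by end_near. Qed.

Let F_gt0 : \forall n \near \oo, 0 < F n.
Proof.
have Fn := supercritical_climb_ge_sqr alpha_gt0 beta_gt0 c_gt0 hi c_gt.
near=> n; have : n%:R ^+ 2 <= F n by near: n.
apply: lt_le_trans; rewrite exprn_gt0//; near: n; exact: nbhs_infty_gtr.
Unshelve. all: by end_near. Qed.

Let law_ratio (x : R) : \forall n \near \oo,
  law (G0 n) [set w | (tau (i n) w / Etau (G0 n) (i n) <= x%:E)%E] =
  (1 - above x n)%:E.
Proof.
have FE := Etau_near.
have Fp := F_gt0.
near=> n; have -> : Etau (G0 n) (i n) = (F n)%:E by near: n.
have F0 : 0 < F n by near: n.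
have mt := @measurable_tau_gt _ _ _ _ _ (G0 n) (i n) (x * F n)%:E.
rewrite -prC// -prE; last exact: measurableC.
congr (law (G0 n) _); apply/seteqP; split => w /=; rewrite ereal_div_le// leNgt => /negP.
  by [].
by [].
Unshelve. all: by end_near. Qed.

Lemma tau_cvg_exponential :
  cvg_in_distribution (fun n => law (G0 n))
    (fun n w => (tau (i n) w / Etau (G0 n) (i n))%E) (exponential_prob 1).
Proof.
move=> x _; have Fp := F_gt0; have [x0|x0] := ltP x 0.
  rewrite exponential_prob_neg//; apply: cvg_near_cst.
  have lr := law_ratio x.
  near=> n; have -> : law (G0 n) [set w | (tau (i n) w / Etau (G0 n) (i n) <= x%:E)%E] =
    (1 - above x n)%:E by near: n.
  have F0 : 0 < F n by near: n.
  rewrite /above (_ : [set w | _] = setT) ?prT ?subrr//.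
  apply/seteqP; split => // w _ /=; apply: lt_le_trans (tau_ge0 _ _).
  by rewrite lte_fin pmulr_llt0.
rewrite exponential_prob_le// mulN1r.
have : (fun n => (1 - above x n)%:E) @ \oo --> (1 - expR (- x))%:E.
  apply: cvg_EFin; first exact: nearW.
  (* The lower tail bound concerns the non-strict event. Taken at [x + h], it bounds the strict
     event at [x] from below, and the shift changes the exponential by at most [h]. *)
  apply/cvgrPdist_le => e e0; pose h := e / 2.
  have h0 : 0 < h by rewrite divr_gt0.
  have xh : 0 < x + h by lra.
  have lo := tau_tail_cvg xh h0.
  have up : \forall n \near \oo, above x n <= expR (- x) + e.
    move: x0; rewrite le_eqVlt => /predU1P[<-|x0].
      near=> n; rewrite oppr0 expR0; apply: (@le_trans _ _ 1); last lra.
      by rewrite -(prT (law (G0 n))) pr_le//; exact: measurable_tau_gt.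
    by apply: filterS (tau_tail_cvg x0 e0) => n [].
  near=> n; have F0 : 0 < F n by near: n.
  have upn : above x n <= expR (- x) + e by near: n.
  have [lon _] : expR (- (x + h)) - h <= at_least (x + h) n /\
     above (x + h) n <= expR (- (x + h)) + h by near: n.
  have inc : at_least (x + h) n <= above x n.
    apply: pr_le; [exact: measurable_tau_ge|exact: measurable_tau_gt|].
    by move=> w /=; apply: lt_le_trans; rewrite lte_fin ltr_pM2r// ltrDl.
  have ex : expR (- x) - h <= expR (- (x + h)).
    have e1 : expR (- x) <= 1 by rewrite expR_le1 oppr_le0.
    rewrite opprD expRD; have := ler_wpM2l (expR_ge0 (- x)) (expR_ge1Dx (- h)).
    have : 0 <= (1 - expR (- x)) * h by rewrite mulr_ge0 ?subr_ge0// ltW.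
    by lra.
  have eh : e = h + h by rewrite /h; field.
  change (`|(1 - expR (- x)) - (1 - above x n)| <= e).
  by rewrite ler_norml; apply/andP; split; lra.
apply: cvg_trans; apply: near_eq_cvg; apply: filterS (law_ratio x) => n /esym.
by [].
Unshelve. all: by end_near. Qed.

End Supercritical.

End Limits.

Theorem theorem2 (R : realType) (alpha beta c : R) (i : nat -> nat)
    (G : forall (n : nat) (A : {set vpair n}), dynER alpha beta A)
    (halpha : 0 < alpha) (hbeta : 0 < beta) (hc : 0 < c)
    (hi : forall n, closest_integer (c * n%:R) (i n)%:Z) :
  [/\ c < beta / (2 * alpha) ->
        cvg_in_probability (fun n => law (G n finset.set0))
          (fun n => tau (G := G n finset.set0) (i n))
          (- ln (1 - 2 * alpha / beta * c) / alpha)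
        /\ (fun n => Etau (G n finset.set0) (i n)) @ \oo -->
             (- ln (1 - 2 * alpha / beta * c) / alpha)%:E,
      c = beta / (2 * alpha) ->
        forall j : nat, exists C : R, \forall n \near \oo,
          forall A : {set vpair n}, #|A| = j ->
            (Etau (G n A) (i n) <= (C * ln n%:R)%:E)%E
    & beta / (2 * alpha) < c ->
        let r := c * ln (2 * alpha / beta * c) - c + beta / (2 * alpha) in
        [/\ 0 < r,
            exists K1 K2 : R, [/\ 0 < K1, 0 < K2 &
              \forall n \near \oo,
                ((K1 * n%:R^-1 * expR (n%:R * r))%:E
                   <= Etau (G n finset.set0) (i n)
                   <= (K2 * (Num.sqrt n%:R)^-1 * expR (n%:R * r))%:E)%E]
          & cvg_in_distribution (fun n => law (G n finset.set0))
              (fun n w => (tau (G := G n finset.set0) (i n) w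
                           / Etau (G n finset.set0) (i n))%E)
              (exponential_prob 1)]].
Proof.
split => [cl|cE|cg].
- split; first exact: subcritical_probability.
  exact: subcritical_Etau.
- exact: (critical_Etau G halpha hbeta hc hi cE).
move=> r; split; first exact: growth_rate_gt0.
  have [K1 K10 h1] := supercritical_climb_ge halpha hbeta hc hi cg.
  have [K2 K20 h2] := supercritical_climb_le halpha hbeta hc hi cg.
  exists K1, K2; split => //; have FE := Etau_near G halpha hbeta hc hi.
  near=> n.
  rewrite (_ : Etau _ _ = (climb_time (beta / (n%:R - 1)) alpha #|vpair n| (i n) 0)%:E).
    by rewrite !lee_fin; apply/andP; split; near: n.
  by near: n.
exact: (tau_cvg_exponential G halpha hbeta hc hi cg).
Unshelve. all: by end_near. Qed.
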